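(* Assume that $\mathbb{E}X=0$, $0<\mathbb{E}|X|<\infty$, and that, for some $r\in(0,1)$, $\limsup_{t\to\star}m_t(r)<\infty$. If $R_t\Rightarrow R$ as $t\to\star$, where $R$ is nondegenerate, then there are $p\in(1,2]$ and $c\in(0,1]$ such that $$m_t(p)\longrightarrow c\qquad(t\to\star).$$ More precisely, let $X_+=\max(X,0)$, $X_-=\max(-X,0)$, and put $$a_+=\sup\{q>0:\mathbb{E}X_+^q<\infty\},\quad a_-=\sup\{q>0:\mathbb{E}X_-^q<\infty\},\quad a_X=a_+\wedge a_-.$$ If $a_X=1$, then for every fixed $p\in(1,2)$ there is a possibly $p$-dependent $c_p\in(0,1]$ such that $m_t(p)\to c_p$. If $1<a_X<2$, then $m_t(p)\to c$ for some $c\in(0,1]$ with $p=a_X$, and if $a_X\ge2$, this holds with $p=2$.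
   Context: $t$ ranges over $(0,\infty)$ and $t\to\star$ means either $t\downarrow0$ or $t\to\infty$ (one fixed choice). For each $t$, $P(t)=(P_j(t))_{j\ge1}$ is a random subprobability sequence: $P_j(t)\ge0$ and $\sum_{j\ge1}P_j(t)\le1$. $X,X_1,X_2,\ldots$ are iid real random variables, independent of the weights. Put $$R_t=\sum_{j\ge1}P_j(t)X_j,\qquad m_t(s)=\mathbb{E}\sum_{j\ge1}P_j(t)^s,$$ where zero weights are omitted from the sum of powers. $\Rightarrow$ denotes convergence in distribution; nondegenerate means not almost surely constant. *)

(* Defs.v *)
From HB Require Import structures.
From mathcomp Require Import all_boot all_order all_algebra.
From mathcomp Require Import all_classical all_reals all_analysis.
Set Implicit Arguments.
Unset Strict Implicit.
Unset Printing Implicit Defensive.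
Import Order.TTheory GRing.Theory Num.Theory.
Import numFieldNormedType.Exports.
Local Open Scope classical_set_scope.
Local Open Scope ring_scope.

Definition seq_cons (T : Type) (x : T) (u : nat -> T) : nat -> T :=
  fun n => if n is k.+1 then u k else x.

Section Independence.
Context (d : measure_display) (T : measurableType d) (R : realType).
Context (P : probability T R).

Definition mutually_independent (Z : nat -> {RV P >-> R}) : Prop :=
  forall (J : seq nat) (B : nat -> set R), uniq J ->
    (forall j, measurable (B j)) ->
    P (\big[setI/setT]_(j <- J) (Z j @^-1` B j)) =
    (\prod_(j <- J) P (Z j @^-1` B j))%E.

Definition identically_distributed (Z : nat -> {RV P >-> R}) : Prop :=
  forall (i j : nat) (B : set R), measurable B ->
    distribution P (Z i) B = distribution P (Z j) B.

Definition iid (Z : nat -> {RV P >-> R}) : Prop :=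
  mutually_independent Z /\ identically_distributed Z.

Definition family_sigma_algebra (Z : nat -> {RV P >-> R}) : set (set T) :=
  <<s \bigcup_j preimage_set_system setT (Z j) measurable >>.

Definition independent_families (Y Z : nat -> {RV P >-> R}) : Prop :=
  forall A B : set T,
    family_sigma_algebra Y A -> family_sigma_algebra Z B ->
    P (A `&` B) = (P A * P B)%E.

End Independence.

(* Y and Z may live on different probability spaces.  All expectations below
   are finite, the test functions being bounded. *)
Definition cvg_in_distribution (R : realType) (I : Type) (F : set_system I)
    (d : measure_display) (T : measurableType d) (P : probability T R)
    (Y : I -> T -> R)
    (d' : measure_display) (T' : measurableType d') (P' : probability T' R)
    (Z : T' -> R) : Prop :=
  forall f : R -> R, continuous f -> (exists M : R, forall x, `|f x| <= M) ->
    ('E_P[f \o Y i] @[i --> F] --> 'E_P'[f \o Z])%E.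

Definition nondegenerate_rv (R : realType) (d : measure_display)
    (T : measurableType d) (P : probability T R) (Z : T -> R) : Prop :=
  ~ exists a : R, {ae P, forall w, Z w = a}.

Section WeightedSums.
Context (d : measure_display) (T : measurableType d) (R : realType).
Context (P : probability T R).

(* Indices are shifted: [W t j] is the weight P_(j+1)(t), [Xs j] is X_(j+1). *)

Definition subprobability_weights (W : nat -> {RV P >-> R}) : Prop :=
  forall w, (forall j, 0 <= W j w) /\
            (\sum_(0 <= j <oo) (W j w)%:E <= 1)%E.

(* When E|X| is finite the series converges almost surely; on the
   exceptional null set [limn] is a default value. *)
Definition weighted_sum (W Xs : nat -> {RV P >-> R}) (w : T) : R :=
  limn (fun n => \sum_(0 <= j < n) W j w * Xs j w).

(* The condition [W j w != 0] matters only for s = 0, as 0 `^ 0 = 1. *)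
Definition weight_moment (W : nat -> {RV P >-> R}) (s : R) : \bar R :=
  (\int[P]_w \sum_(0 <= j <oo | W j w != 0%R) ((W j w) `^ s)%:E)%E.

Definition moment_index (Y : T -> R) : \bar R :=
  ereal_sup [set q%:E | q in
    [set q : R | 0 < q /\ ('E_P[fun w => (Y w `^ q)%R] < +oo)%E]].

End WeightedSums.

(* Main.v *)
Require Import Defs.
From HB Require Import structures.
From mathcomp Require Import all_boot all_order all_algebra.
From mathcomp Require Import all_classical all_reals all_analysis.
From mathcomp Require Import measurable_realfun ring lra.
Set Implicit Arguments.
Unset Strict Implicit.
Unset Printing Implicit Defensive.
Import Order.TTheory GRing.Theory Num.Theory.
Import numFieldNormedType.Exports.
Local Open Scope classical_set_scope.
Local Open Scope ring_scope.

(* Write a weight as [exp (- v)] and put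
   [m_t(f) = E sum_j P_j(t) f (- ln P_j(t))], so that [m_t(s)] is the value of
   [m_t] at [exp (- (s - 1) v)].  Let [q(f)] be the oscillation of [m_t(f)] as
   [t -> star]; since [m_t(r)] is bounded, [q] is a seminorm controlled by
   [sup_v |f(v)| exp (- (1 - r) v)], and convergence of [m_t(s)] means
   [q (exp (- (s - 1) v)) = 0].

   If [G] is Lipschitz and additive up to an error [L (1 + |s|) |x|], adding the
   terms of [R_t] one at a time shows that [E G(R_t)] and [m_t(f_G)], where
   [f_G(v) = e^v E G(e^-v X)], differ by at most [L (E|X| + (E|X|)^2)].  As
   [E G(R_t)] converges, [q(f_G)] is at most twice this bound.  Two families of
   [G] are used.
   - For hinges [(|x| - e^tau)_+], [L = O(e^-tau)] and [f_G(v) = k(tau + v)] with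
     [k(tau) = E (|X| - e^tau)_+].  If [a_X = 1], then [k] is not exponentially
     small, so there are large [tau] with [k(tau + v)] nearly equal to [k(tau)]
     on long intervals and [k(tau) >> e^-tau]; dividing by [k(tau)] gives
     [q(1) = 0].  The same argument applies to the seminorm obtained by composing
     [q] with integration from [0], whence [q(v^j) = 0] for all [j], and a Taylor
     expansion gives [q(e^-zv) = 0] for all [z >= 0].
   - For truncated powers [|x| min(|x|, e^tau)^p] with [0 < p <= 1], [L] does not
     depend on [tau] and [f_G(v) = e^-pv g(tau + v)] with [g] nondecreasing.  If
     [E|X|^(1+p)] is infinite but [E|X|^(1+p-eta)] is finite, then [g] is unbounded
     but grows at most like [e^(eta tau)]; dividing by [g(tau)] at a [tau] of slow
     growth bounds [q(e^-pv)] by a quantity vanishing with [eta].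
   When [E X^2] is finite, [E R_t^2 = E X^2 m_t(2)] and [R_t^2] is uniformly
   integrable.  Finally [m_t(s) -> 0] would force [m_t(1) -> 0] by interpolation
   with [m_t(r)], hence [E|R_t| -> 0] and [R = 0]. *)

(** The error [L (1 + |s|) |x|], summed along [R_t], does not vanish as [t -> star]; it becomes
    negligible only after division by something large: [k(tau)] against [e^-tau] for hinges,
    [g(tau)] against a constant for truncated powers. The obstacle is that the tail of [X] need not
    vary regularly, so [k] and [g] may be irregular at most [tau]. Arguments by contradiction select
    single levels [tau] where they are nearly flat on a window of prescribed length; past the window
    the comparison is paid for by the weight [e^(kappa v)], [kappa = 1 - r], which is what the bound
    on [m_t(r)] provides. Flatness of [k] reaches only the constant function. Integration from 0
    leads further because Riemann sums of shifts of [k] still cost [O(e^-tau)]. The passage to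
    [e^-zv] advances by at most [kappa / 4] at a time, as the Taylor remainder must stay below
    [e^(kappa v)]. For truncated powers, the moment of order [a_X] itself may be finite, and then
    [g] is bounded at that exponent; slightly larger exponents are used and sent back to the
    critical one. *)

Section TestFunctions.
Context {R : realType}.
Implicit Types (G : R -> R).

Lemma lipschitz_continuous G (Lam : R) :
  (forall a b, `|G a - G b| <= Lam * `|a - b|) -> continuous G.
Proof.
move=> GL x; apply/cvgrPdist_le => e e0.
have L1 : 0 < `|Lam| + 1 by rewrite ltr_wpDl.
near=> y; apply: (le_trans (GL _ _)).
apply: (@le_trans _ _ ((`|Lam| + 1) * `|x - y|)).
  by rewrite ler_wpM2r// (le_trans (ler_norm _))// lerDl.
rewrite mulrC -ler_pdivlMr//; near: y.
by apply: cvgr_dist_le; [exact: cvg_id|rewrite divr_gt0].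
Unshelve. all: by end_near. Qed.

Definition hinge (u x : R) := Num.max (`|x| - u) 0.

Lemma hinge_ge0 u x : 0 <= hinge u x. Proof. by rewrite le_max lexx orbT. Qed.

Lemma hinge_le u x : 0 <= u -> hinge u x <= `|x|.
Proof. by move=> u0; rewrite ge_max normr_ge0 andbT; lra. Qed.

Lemma hinge_lipschitz u a b : `|hinge u a - hinge u b| <= 1 * `|a - b|.
Proof.
rewrite mul1r; have := ler_dist_dist a b; rewrite !ler_norml => /andP[h1 h2].
have h3 := ler_norm (a - b); have h4 := ler_norm (b - a); rewrite distrC in h4.
by rewrite /hinge; case: (leP (`|b| - u) 0) => b0; case: (leP (`|a| - u) 0) => a0;
  apply/andP; split; lra.
Qed.

(** The defect vanishes when [|s| + |x| <= u]. Otherwise it is at most [2 min(|s|, |x|)], and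
    [u < 2 max(|s|, |x|)] turns this into [4 |s| |x| / u]. The decay in [u] is what makes the hinge
    error [O(e^-tau)]. *)
Lemma hinge_quasi_additive u s x : 0 < u ->
  `|hinge u (s + x) - hinge u s - hinge u x| <= 4 / u * ((1 + `|s|) * `|x|).
Proof.
move=> u0.
have sx0 : 0 <= `|s| * `|x| by rewrite mulr_ge0.
apply: (@le_trans _ _ (4 / u * (`|s| * `|x|))); last first.
  rewrite ler_wpM2l ?divr_ge0 ?(ltW u0)//.
  by rewrite ler_wpM2r// lerDr.
rewrite mulrAC ler_pdivlMr//.
have := ler_normD s x; have := lerB_normD s x; have := lerB_normD x s.
rewrite [x + s]addrC.
have : 0 <= `|s| by []. have : 0 <= `|x| by [].
rewrite /hinge; move: (`|s|) (`|x|) (`|s + x|) sx0 => a b c ab0 b0 a0 c1 c2 c3.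
pose m := Num.min a b.
have [abu|uab] := leP (a + b) u.
  rewrite !max_r ?subr0 ?normr0 ?mul0r ?mulr_ge0//; lra.
have Dm : `|Num.max (c - u) 0 - Num.max (a - u) 0 - Num.max (b - u) 0| <= 2 * m.
  rewrite -ler_pdivrMl// /m le_min !ler_pdivrMl// !ler_norml.
  case: (leP (c - u) 0) => h1; case: (leP (a - u) 0) => h2;
    case: (leP (b - u) 0) => h3; apply/andP; split; apply/andP; split; lra.
have mu2 : 2 * m * u <= 4 * (a * b).
  rewrite /m; case: (leP a b) => ab; nra.
by apply: le_trans mu2; rewrite ler_wpM2r// ltW.
Qed.

End TestFunctions.

(** * Truncated powers: quasi-additivity uniform in the cutoff, scaling, growth *)

Section TruncatedPower.
Context {R : realType}.
Implicit Types (p u x a b s : R).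

(** A power of order [1 + p] up to the cutoff and linear beyond it: a finite [E|X|] makes it
    integrable, and raising the cutoff recovers the full power. *)
Definition truncated_power p u x := `|x| * (Num.min `|x| u) `^ p.

Lemma truncated_power_ge0 p u x : 0 <= truncated_power p u x.
Proof. by rewrite mulr_ge0// powR_ge0. Qed.

Lemma truncated_power0 p u : truncated_power p u 0 = 0.
Proof. by rewrite /truncated_power normr0 mul0r. Qed.

Lemma powR_le_1D p x : 0 <= p -> p <= 1 -> 0 <= x -> x `^ p <= 1 + x.
Proof.
move=> p0 p1 x0; have [x1|/ltW x1] := leP x 1.
  apply: (@le_trans _ _ 1); last by rewrite lerDl.
  by have := ge0_ler_powR p0 x0 (ler01 : (1 : R) \in Num.nneg) x1; rewrite powR1.
apply: (@le_trans _ _ x); last by rewrite lerDr.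
by rewrite -[leRHS](powRr1 x0) ler_powR.
Qed.

(** Apart from [A^p (a - b)], the increment contains [b (A^p - B^p)]. When [B = b], the inequality
    [b/A <= (b/A)^p], valid as [b/A <= 1] and [p <= 1], bounds it by [A^p (b/A) (A - b)]. *)
Lemma truncated_power_increment p u a b : 0 < p -> p <= 1 -> 0 < u ->
  `|b| <= `|a| -> `|truncated_power p u a - truncated_power p u b| <=
  2 * Num.min `|a| u `^ p * (`|a| - `|b|).
Proof.
move=> p0 p1 u0 ba; rewrite /truncated_power.
have a0 : 0 <= `|a| by []. have b0 : 0 <= `|b| by [].
move: (`|a|) (`|b|) a0 b0 ba => {}a {}b a0 b0 ba.
set A := Num.min a u; set B := Num.min b u.
have A0 : 0 <= A by rewrite le_min a0 ltW.
have B0 : 0 <= B by rewrite le_min b0 ltW.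
have BA : B <= A by rewrite /A /B le_min !ge_min ba lexx orbT.
have BAp : B `^ p <= A `^ p by apply: ge0_ler_powR => //; rewrite ?nnegrE// ltW.
have Ap0 := powR_ge0 A p; have Bp0 := powR_ge0 B p.
rewrite ger0_norm; last by rewrite subr_ge0 ler_pM.
suff h : b * (A `^ p - B `^ p) <= A `^ p * (a - b) by lra.
have [ub|bu] := leP u b.
  have -> : A = u by apply: min_r; exact: le_trans ba.
  have -> : B = u by exact: min_r.
  by rewrite subrr mulr0 mulr_ge0 ?powR_ge0 ?subr_ge0.
have Bb : B = b by apply: min_l; exact: ltW.
rewrite Bb in BA BAp Bp0 *; have Aa : A <= a by rewrite ge_min lexx.
move: b0; rewrite le_eqVlt => /predU1P[<-|b0].
  by rewrite mul0r mulr_ge0 ?subr_ge0.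
have A1 : 0 < A by exact: lt_le_trans BA.
have bA1 : b / A <= 1 by rewrite ler_pdivrMr// mul1r.
have bA0 : 0 < b / A by rewrite divr_gt0.
have h1 : b / A <= (b / A) `^ p.
  rewrite -[leLHS](powRr1 (ltW bA0)); apply: ger_powR => //.
  by rewrite bA0 bA1.
have h2 : b `^ p = A `^ p * (b / A) `^ p.
  by rewrite -powRM ?(ltW bA0)// mulrC divfK// gt_eqF.
have h3 : A `^ p * (b / A) <= b `^ p by rewrite h2 ler_wpM2l.
apply: (@le_trans _ _ (b * (A `^ p - A `^ p * (b / A)))).
  by rewrite ler_wpM2l ?(ltW b0)// lerB.
have -> : b * (A `^ p - A `^ p * (b / A)) = A `^ p * ((b / A) * (A - b)).
  by field; rewrite gt_eqF.
rewrite ler_wpM2l//; apply: (@le_trans _ _ (A - b)); last by rewrite lerB.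
by rewrite ler_piMl// subr_ge0.
Qed.

Lemma truncated_power_dist p u a b : 0 < p -> p <= 1 -> 0 < u ->
  `|truncated_power p u a - truncated_power p u b| <=
  2 * Num.min (Num.max `|a| `|b|) u `^ p * `|a - b|.
Proof.
move=> p0 p1 u0; have := ler_dist_dist a b; rewrite ler_norml => /andP[d1 d2].
have [ab|/ltW ba] := leP `|a| `|b|.
  rewrite distrC; apply: (le_trans (truncated_power_increment p0 p1 u0 ab)).
  by rewrite ler_wpM2l ?mulr_ge0 ?powR_ge0//; lra.
apply: (le_trans (truncated_power_increment p0 p1 u0 ba)).
by rewrite ler_wpM2l ?mulr_ge0 ?powR_ge0.
Qed.

Lemma truncated_power_lipschitz p u a b : 0 < p -> p <= 1 -> 0 < u ->
  `|truncated_power p u a - truncated_power p u b| <= 2 * u `^ p * `|a - b|.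
Proof.
move=> p0 p1 u0; apply: (le_trans (truncated_power_dist a b p0 p1 u0)).
rewrite ler_wpM2r// ler_wpM2l//.
apply: ge0_ler_powR; rewrite ?nnegrE ?(ltW p0) ?(ltW u0)//.
  by rewrite le_min le_max normr_ge0/= ltW.
by rewrite ge_min lexx orbT.
Qed.

(** [G (s + x)] is compared with [G s] when [|x| <= 1 + |s|] and with [G x] otherwise; the remaining
    term is estimated alone. The local Lipschitz bound [loc] does not involve [u], hence neither
    does the constant. For [p < 1] the summand 1 in [1 + |s|] is essential near 0, where the defect
    at [s = x] has order [|x|^(1+p)]. *)
Lemma truncated_power_quasi_additive p u s x : 0 < p -> p <= 1 -> 0 < u ->
  `|truncated_power p u (s + x) - truncated_power p u s - truncated_power p u x|
  <= 10 * ((1 + `|s|) * `|x|).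
Proof.
move=> p0 p1 u0; set G := truncated_power p u.
have loc a b : `|G a - G b| <= 2 * (1 + `|a| + `|b|) * `|a - b|.
  apply: (le_trans (truncated_power_dist a b p0 p1 u0)).
  rewrite ler_wpM2r// ler_wpM2l//.
  have m0 : 0 <= Num.min (Num.max `|a| `|b|) u by rewrite le_min le_max normr_ge0/= ltW.
  apply: (le_trans (powR_le_1D (ltW p0) p1 m0)).
  rewrite -addrA lerD2l ge_min; apply/orP; left.
  by rewrite ge_max lerDl lerDr !normr_ge0.
have G0 : G 0 = 0 by exact: truncated_power0.
have Gx : `|G x| <= 2 * (1 + `|x|) * `|x|.
  by have := loc x 0; rewrite G0 normr0 !subr0 addr0.
have Gs : `|G s| <= 2 * (1 + `|s|) * `|s|.
  by have := loc s 0; rewrite G0 normr0 !subr0 addr0.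
have := ler_normD s x; have s0 := normr_ge0 s; have x0 := normr_ge0 x.
have sx0 : 0 <= `|s| * `|x| by rewrite mulr_ge0.
move=> sx; have [xs|/ltW xs] := leP `|x| (1 + `|s|).
  apply: (le_trans (ler_normB _ _)).
  have l1 := loc (s + x) s.
  have e1 : s + x - s = x by ring.
  rewrite e1 in l1.
  apply: (le_trans (lerD l1 Gx)); rewrite -mulrDl mulrA ler_wpM2r//; lra.
have -> : G (s + x) - G s - G x = G (s + x) - G x - G s by ring.
apply: (le_trans (ler_normB _ _)).
have := loc (s + x) x; rewrite addrK => l1.
apply: (le_trans (lerD l1 Gs)); rewrite -mulrDl.
have h1 : (2 * (1 + `|s + x| + `|x|) + 2 * (1 + `|s|)) * `|s| <=
    (10 * `|x|) * (1 + `|s|).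
  by rewrite ler_pM//; lra.
by apply: (le_trans h1); rewrite mulrAC mulrA.
Qed.

(** A weight [e^-v] acts by raising the cutoff; multiplied by [e^v], the prefactor becomes the
    target function [e^(-p v)]. *)
Lemma truncated_power_scale p u v x : 0 <= u ->
  truncated_power p u (expR (- v) * x) =
  expR (- ((1 + p) * v)) * truncated_power p (u * expR v) x.
Proof.
move=> u0; rewrite /truncated_power normrM (ger0_norm (expR_ge0 _)).
have -> : Num.min (expR (- v) * `|x|) u = expR (- v) * Num.min `|x| (u * expR v).
  rewrite minr_pMr ?expR_ge0//; congr Num.min.
  by rewrite mulrCA -expRD addNr expR0 mulr1.
rewrite powRM ?expR_ge0//; last by rewrite le_min normr_ge0 mulr_ge0 ?expR_ge0.
rewrite -expRM.
have -> : expR (- ((1 + p) * v)) = expR (- v) * expR (- v * p).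
  by rewrite -expRD; congr expR; ring.
by ring.
Qed.

Lemma truncated_power_homo p u u' x : 0 <= p -> 0 <= u -> u <= u' ->
  truncated_power p u x <= truncated_power p u' x.
Proof.
move=> p0 u0 uu'; rewrite ler_wpM2l//; apply: ge0_ler_powR => //.
- by rewrite nnegrE le_min normr_ge0.
- by rewrite nnegrE le_min normr_ge0 (le_trans u0).
- by rewrite le_min !ge_min lexx uu' orbT.
Qed.

Lemma truncated_power_growth p u v x : 0 <= p -> 0 <= u -> 0 <= v ->
  truncated_power p (u * expR v) x <= expR (p * v) * truncated_power p u x.
Proof.
move=> p0 u0 v0; rewrite /truncated_power mulrCA ler_wpM2l//.
have m0 : 0 <= Num.min `|x| u by rewrite le_min normr_ge0.
rewrite [p * v]mulrC expRM -powRM ?expR_ge0//; apply: ge0_ler_powR => //.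
- by rewrite nnegrE le_min normr_ge0 mulr_ge0 ?expR_ge0.
- by rewrite nnegrE mulr_ge0 ?expR_ge0.
rewrite minr_pMr ?expR_ge0// le_min !ge_min; apply/andP; split.
  by apply/orP; left; rewrite ler_peMl// -expR0 ler_expR.
by apply/orP; right; rewrite mulrC.
Qed.

(** Split the [p]-th power of the minimum into exponents [p - eta] and [eta]; bound the first factor
    through [|x|], the second through the cutoff. *)
Lemma truncated_power_le_expR p eta tau x : 0 <= eta -> eta <= p ->
  truncated_power p (expR tau) x <= `|x| `^ (1 + p - eta) * expR (eta * tau).
Proof.
move=> e0 ep; have p0 : 0 <= p by exact: le_trans ep.
rewrite /truncated_power; have [->|x0] := eqVneq `|x| 0.
  by rewrite mul0r mulr_ge0 ?powR_ge0 ?expR_ge0.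
rewrite -addrA powRD; last by rewrite x0 implybT.
rewrite powRr1// -mulrA ler_wpM2l//.
have m0 : 0 < Num.min `|x| (expR tau) by rewrite lt_min expR_gt0 andbT lt_neqAle eq_sym x0/=.
have -> : Num.min `|x| (expR tau) `^ p =
    Num.min `|x| (expR tau) `^ (p - eta) * Num.min `|x| (expR tau) `^ eta.
  by rewrite -powRD ?subrK// (gt_eqF m0) implybT.
rewrite [eta * tau]mulrC expRM; apply: ler_pM; rewrite ?powR_ge0//.
  apply: ge0_ler_powR; rewrite ?subr_ge0 ?nnegrE ?(ltW m0)//.
  by rewrite ge_min lexx.
apply: ge0_ler_powR; rewrite ?nnegrE ?(ltW m0) ?expR_ge0//.
by rewrite ge_min lexx orbT.
Qed.

End TruncatedPower.

(** * Abstract seminorms on functions of exponential growth *)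

Section Seminorm.
Context {R : realType}.
Implicit Types (f g k : R -> R) (q : (R -> R) -> R).

(** Only [v >= 0] matters because [v] stands for minus the logarithm of a weight in [[0, 1]]. Growth
    of order [e^(kappa v)] is what a bound on the moment of order [1 - kappa] can integrate. *)
Definition exp_dominated (kappa : R) f :=
  continuous f /\ exists b, forall v, 0 <= v -> `|f v| <= b * expR (kappa * v).

(** An abstraction of the oscillation of [m_t] along [star], so that [q] may later be replaced by
    its composition with integration or with multiplication by [e^(-c v)]. Nonnegativity and
    insensitivity to [v < 0] follow from the three fields. *)
Record exp_seminorm (kappa B : R) q : Prop := ExpSeminorm {
  esn_add : forall f g, exp_dominated kappa f -> exp_dominated kappa g ->
    q (fun v => f v + g v) <= q f + q g ;
  esn_scale : forall a f, exp_dominated kappa f ->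
    q (fun v => a * f v) <= `|a| * q f ;
  esn_bound : forall f b, continuous f ->
    (forall v, 0 <= v -> `|f v| <= b * expR (kappa * v)) -> q f <= B * b }.

Lemma exp_dominatedD (kappa : R) f g : exp_dominated kappa f ->
  exp_dominated kappa g -> exp_dominated kappa (fun v => f v + g v).
Proof.
move=> [cf [b fb]] [cg [c gc]]; split.
  by move=> x; apply: continuousD; [exact: cf|exact: cg].
exists (b + c) => v v0; rewrite mulrDl.
exact: (le_trans (ler_normD _ _) (lerD (fb _ v0) (gc _ v0))).
Qed.

Lemma exp_dominatedZ (kappa a : R) f : exp_dominated kappa f ->
  exp_dominated kappa (fun v => a * f v).
Proof.
move=> [cf [b fb]]; split.
  by move=> x; apply: continuousM; [exact: cvg_cst|exact: cf].
exists (`|a| * b) => v v0; rewrite normrM -mulrA ler_wpM2l//; exact: fb.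
Qed.

Lemma exp_dominatedN (kappa : R) f : exp_dominated kappa f ->
  exp_dominated kappa (fun v => - f v).
Proof.
move=> /(exp_dominatedZ (-1)); congr exp_dominated.
by apply/funext => v; rewrite mulN1r.
Qed.

Lemma exp_dominatedB (kappa : R) f g : exp_dominated kappa f ->
  exp_dominated kappa g -> exp_dominated kappa (fun v => f v - g v).
Proof. by move=> df dg; apply: exp_dominatedD => //; exact: exp_dominatedN. Qed.

Lemma exp_dominated_cst (kappa a : R) : 0 <= kappa ->
  exp_dominated kappa (fun=> a).
Proof.
move=> k0; split; first by move=> x; exact: cvg_cst.
exists `|a| => v v0; rewrite ler_peMr//.
by rewrite -expR0 ler_expR mulr_ge0.
Qed.

Lemma exp_dominated_le (kappa b : R) f : continuous f ->
  (forall v, 0 <= v -> `|f v| <= b * expR (kappa * v)) ->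
  exp_dominated kappa f.
Proof. by move=> cf fb; split => //; exists b. Qed.

Lemma exp_dominated_shift (kappa t : R) k : 0 <= kappa -> 0 <= t ->
  {homo k : x y / x <= y >-> y <= x} -> (forall x, 0 <= k x) -> continuous k ->
  exp_dominated kappa (fun v => k (t + v)).
Proof.
move=> kap0 t0 kdecr k0 ck; apply: (@exp_dominated_le _ (k t)).
  move=> x; apply: (@continuous_comp _ _ _ (fun v => t + v) k); last exact: ck.
  by apply: continuousD; [exact: cvg_cst|exact: cvg_id].
move=> v v0; rewrite ger0_norm//.
apply: (le_trans (kdecr _ _ (_ : t <= _))); first by rewrite lerDl.
by rewrite ler_peMr ?k0// -expR0 ler_expR mulr_ge0.
Qed.

Lemma continuous_expRN (c : R) : continuous (fun v : R => expR (- (c * v))).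
Proof.
move=> x; apply: (@continuous_comp _ _ _ (fun v => - (c * v)) expR).
  by apply: cvgN; apply: cvgM; [exact: cvg_cst|exact: cvg_id].
exact: continuous_expR.
Qed.

Section Basics.
Variables (kappa B : R) (q : (R -> R) -> R).
Hypotheses (kappa_ge0 : 0 <= kappa) (qP : exp_seminorm kappa B q).

Lemma esn_zero_ge0 : 0 <= q (fun=> 0).
Proof.
have d0 := exp_dominated_cst 0 kappa_ge0.
have := esn_add qP d0 d0.
rewrite (_ : (fun v => _) = (fun=> 0)); last by apply/funext => v; rewrite addr0.
by rewrite -lerBlDl subrr.
Qed.

Lemma esn_ge0 f : exp_dominated kappa f -> 0 <= q f.
Proof.
move=> df; have := esn_add qP df (exp_dominatedN df).
rewrite (_ : (fun v => f v + - f v) = (fun=> 0)); last first.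
  by apply/funext => v; rewrite subrr.
move/(le_trans esn_zero_ge0); have := esn_scale qP (-1) df.
rewrite (_ : (fun v => -1 * f v) = (fun v => - f v)); last first.
  by apply/funext => v; rewrite mulN1r.
rewrite normrN1 mul1r => qN q0.
by have := le_trans q0 (lerD (lexx (q f)) qN); rewrite -mulr2n pmulrn_lge0.
Qed.

Lemma esn_bound_ge0 : 0 <= B.
Proof.
rewrite -[B]mulr1; apply: (le_trans esn_zero_ge0); apply: (esn_bound qP).
  by move=> x; exact: cvg_cst.
by move=> v _; rewrite normr0 mul1r expR_ge0.
Qed.

(** All later approximations go through this bound: the difference is measured in the sup norm
    weighted by [e^(-kappa v)]. *)
Lemma esn_dist f g b : exp_dominated kappa f -> exp_dominated kappa g ->
  (forall v, 0 <= v -> `|f v - g v| <= b * expR (kappa * v)) ->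
  q f <= q g + B * b.
Proof.
move=> df dg fgb; have dB := exp_dominatedB df dg.
have := esn_add qP dg dB.
rewrite (_ : (fun v => g v + (f v - g v)) = f); last first.
  by apply/funext => v; rewrite addrC subrK.
move/le_trans; apply; rewrite lerD2l; apply: (esn_bound qP) => //.
by case: dB.
Qed.

Lemma esn_eq f g : exp_dominated kappa f -> exp_dominated kappa g ->
  (forall v, 0 <= v -> f v = g v) -> q f <= q g.
Proof.
move=> df dg fg; rewrite -[leRHS]addr0 -[X in _ <= _ + X](mulr0 B).
by apply: esn_dist => // v v0; rewrite fg ?subrr ?normr0 ?mul0r.
Qed.

Lemma esn_sum (n : nat) (h : nat -> R -> R) (c : nat -> R) :
  (forall i, exp_dominated kappa (h i)) -> (forall i, q (h i) <= c i) ->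
  exp_dominated kappa (fun v => \sum_(i < n) h i v) /\
  q (fun v => \sum_(i < n) h i v) <= \sum_(i < n) c i.
Proof.
move=> dh hc; elim: n => [|n [IHd IHq]].
  rewrite big_ord0 (_ : (fun v => _) = (fun=> 0)); last first.
    by apply/funext => v; rewrite big_ord0.
  split; first exact: exp_dominated_cst.
  rewrite -[leRHS](mulr0 B); apply: (esn_bound qP) => [x|v _]; first exact: cvg_cst.
  by rewrite normr0 mul0r.
rewrite big_ord_recr/= (_ : (fun v => _) =
    (fun v => \sum_(i < n) h i v + h n v)); last first.
  by apply/funext => v; rewrite big_ord_recr.
split; first exact: exp_dominatedD.
by apply: (le_trans (esn_add qP IHd (dh n))); rewrite lerD.
Qed.

End Basics.

(* [k] is not [O(expR (- beta * tau))] for any [beta > 0]; it may still be much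
   smaller than [expR (- beta * tau)] at some [tau]. *)
Definition subexponential k :=
  forall beta C : R, 0 < beta -> exists2 tau, 0 <= tau & C * expR (- beta * tau) < k tau.

(** If no such [tau] existed, each step of length [L] would either shrink [k] by the factor [1 - e]
    or start where [k < M e^-tau]. Both alternatives force exponential decay along the multiples of
    [L]. *)
Lemma subexponential_select k (e L M : R) :
  {homo k : x y / x <= y >-> y <= x} -> (forall x, 0 <= k x) ->
  subexponential k -> 0 < e -> e < 1 -> 0 < L -> 0 < M ->
  exists tau, [/\ 0 <= tau, M * expR (- tau) <= k tau &
                  (1 - e) * k tau <= k (tau + L)].
Proof.
move=> kdecr k0 ksub e0 e1 L0 M0; apply: contrapT => /forallNP nsel.
have {}nsel tau : 0 <= tau -> M * expR (- tau) <= k tau ->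
    k (tau + L) < (1 - e) * k tau.
  move=> t0 Mk; rewrite ltNge; apply/negP => ke; exact: (nsel tau).
(* A rate slow enough for both alternatives: [e^(-beta L)] dominates [1 - e] and [e^-L]. *)
pose beta := Num.min (- ln (1 - e) / L) 1.
have beta0 : 0 < beta.
  rewrite lt_min ltr01 andbT divr_gt0// oppr_gt0 ln_lt0//; lra.
have b1 : 1 - e <= expR (- (beta * L)).
  have <- : expR (ln (1 - e)) = 1 - e by rewrite lnK// posrE subr_gt0.
  by rewrite ler_expR lerNr -ler_pdivlMr// /beta ge_min lexx.
have b2 : expR (- L) <= expR (- (beta * L)).
  have beta1 : beta <= 1 by rewrite ge_min lexx orbT.
  by rewrite ler_expR lerN2 ler_piMl// ltW.
(* The factor [e^L] pays for the step from [n L] to [(n + 1) L] in the case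
   [k (n L) < M e^(-n L)]. *)
pose A := Num.max (k 0) (M * expR L).
have A0 : 0 <= A by rewrite le_max k0.
have kA n : k (n%:R * L) <= A * expR (- (beta * L) * n%:R).
  elim: n => [|n IHn]; first by rewrite mul0r mulr0 expR0 mulr1 le_max lexx.
  have nL0 : 0 <= n%:R * L by rewrite mulr_ge0 ?ler0n ?ltW.
  rewrite -natr1 mulrDl mul1r mulrDr mulr1 expRD mulrA.
  have [Mk|/ltW Mk] := lerP (M * expR (- (n%:R * L))) (k (n%:R * L)).
    apply: (le_trans (ltW (nsel _ nL0 Mk))).
    by rewrite mulrC ler_pM// subr_ge0 ltW.
  apply: (@le_trans _ _ (k (n%:R * L))); first by apply: kdecr; lra.
  apply: (le_trans Mk).
  have -> : M * expR (- (n%:R * L)) = M * expR L * expR (- L) ^+ n.+1.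
    by rewrite -mulrA -expRM_natl -expRD -natr1; congr (_ * expR _); lra.
  have -> : A * expR (- (beta * L) * n%:R) * expR (- (beta * L)) =
      A * expR (- (beta * L)) ^+ n.+1.
    by rewrite -mulrA -expRM_natl -expRD -natr1; congr (_ * expR _); lra.
  rewrite ler_pM ?mulr_ge0 ?expR_ge0 ?exprn_ge0 ?(ltW M0)//.
    by rewrite le_max lexx orbT.
  by rewrite lerXn2r ?nnegrE ?expR_ge0.
(* The extra [e^(beta L)] absorbs rounding [tau] down to a multiple of [L]. *)
have [tau t0] := ksub beta (A * expR (beta * L)) beta0.
apply/negP; rewrite -leNgt.
have tL0 : 0 <= tau / L by rewrite divr_ge0// ltW.
have /andP[n1 n2] := truncn_itv tL0.
rewrite ler_pdivlMr// in n1; rewrite ltr_pdivrMr// in n2.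
apply: (le_trans (kdecr _ _ n1)); apply: (le_trans (kA _)).
rewrite -mulrA -expRD ler_wpM2l// ler_expR.
move: n2; rewrite -natr1; move: (Num.trunc _)%:R => N.
move=> /ltW; rewrite -(ler_pM2l beta0); nra.
Qed.

(** At a selected [tau], the quotient [k (tau + v) / k tau] is close to 1 in the weighted norm,
    while its seminorm is at most [C e^-tau / k tau], which the selection makes small. *)
Lemma esn_cst1 (kappa B C : R) q k : 0 < kappa -> exp_seminorm kappa B q ->
  {homo k : x y / x <= y >-> y <= x} -> (forall x, 0 <= k x) ->
  continuous k -> subexponential k ->
  (forall tau, 0 <= tau -> q (fun v => k (tau + v)) <= C * expR (- tau)) ->
  q (fun=> 1) <= 0.
Proof.
move=> kap0 qP kdecr k0 ck ksub qk.
have B0 : 0 <= B by apply: esn_bound_ge0 qP; exact: ltW.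
apply/ler_addgt0Pr => d d0; rewrite add0r.
(* Makes the approximation cost [B * e] at most [d / 2], with [e < 1]. *)
pose e := Num.min (d / (2 * (B + 1))) (1 / 2).
have e0 : 0 < e.
  by rewrite lt_min divr_gt0 ?mulr_gt0 ?ltr_pwDr//=; lra.
have e1 : e < 1 by rewrite gt_min; apply/orP; right; lra.
(* Chosen so that [e * e^(kappa L) = 1]: past [L], the trivial error 1 is below
   [e * e^(kappa v)]. *)
pose L := - ln e / kappa.
have L0 : 0 < L by rewrite divr_gt0// oppr_gt0 ln_lt0// e0.
(* Gives [C e^-tau / k tau <= d / 2] once [k tau >= M e^-tau]. *)
pose M := 2 * (`|C| + 1) / d.
have M0 : 0 < M by rewrite divr_gt0// mulr_gt0// ltr_pwDr.
have [tau [t0 Mk ke]] := subexponential_select kdecr k0 ksub e0 e1 L0 M0.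
have kt0 : 0 < k tau by apply: lt_le_trans Mk; rewrite mulr_gt0 ?expR_gt0.
pose f := fun v => (k tau)^-1 * k (tau + v).
have dk := exp_dominated_shift (ltW kap0) t0 kdecr k0 ck.
have df : exp_dominated kappa f by exact: exp_dominatedZ.
have d1 := exp_dominated_cst 1 (ltW kap0).
have : q (fun=> 1) <= q f + B * e.
  apply: (esn_dist qP) => // v v0.
  have f1 : f v <= 1.
    by rewrite /f mulrC ler_pdivrMr// mul1r; apply: kdecr; rewrite lerDl.
  rewrite ger0_norm ?subr_ge0//.
  have [vL|Lv] := leP v L.
    apply: (@le_trans _ _ e).
      rewrite lerBlDl -lerBlDr /f mulrC ler_pdivlMr//; apply: (le_trans ke).
      by apply: kdecr; rewrite lerD2l.
    by rewrite ler_peMr ?(ltW e0)// -expR0 ler_expR mulr_ge0// ltW.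
  apply: (@le_trans _ _ 1).
    by rewrite lerBlDr lerDl mulr_ge0 ?invr_ge0 ?k0.
  have <- : expR (ln e) = e by rewrite lnK// posrE.
  rewrite -expRD -expR0 ler_expR.
  have : kappa * L <= kappa * v by rewrite ler_pM2l// ltW.
  by rewrite /L mulrCA divff ?gt_eqF// mulr1; lra.
move/le_trans; apply.
have q1 : q f <= d / 2.
  apply: (le_trans (esn_scale qP _ dk)).
  rewrite ger0_norm ?invr_ge0// ler_pdivrMl//.
  apply: (le_trans (qk _ t0)).
  apply: (@le_trans _ _ (d / 2 * (M * expR (- tau)))); last first.
    by rewrite [leRHS]mulrC ler_wpM2l// divr_ge0// ltW.
  rewrite mulrA ler_wpM2r ?expR_ge0//.
  have -> : d / 2 * M = `|C| + 1 by rewrite /M; field; rewrite gt_eqF.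
  by apply: (le_trans (ler_norm _)); rewrite lerDl.
have q2 : B * e <= d / 2.
  apply: (@le_trans _ _ ((B + 1) * (d / (2 * (B + 1))))).
    by rewrite ler_pM// ?(ltW e0)// ?lerDl// ge_min lexx.
  by rewrite le_eqVlt; apply/orP; left; apply/eqP; field; rewrite gt_eqF// ltr_pwDr.
lra.
Qed.

End Seminorm.

(** * Integration from 0 as an operator on continuous functions *)

Section Primitive.
Context {R : realType}.
Implicit Types (f g F : R -> R).

(** The derivative is prescribed only for [v > 0]: the primitives constructed below are constant on
    [v <= 0] and need not be differentiable at 0, and the mean value theorem asks only for interior
    points. *)
Definition is_primitive F f :=
  continuous F /\ forall v : R, 0 < v -> is_derive v 1 F (f v).

Lemma primitive_exists f : continuous f ->
  exists F, F 0 = 0 /\ is_primitive F f.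
Proof.
(* Starting at -1 makes 0 an interior point, so [G] is continuous there from both sides. *)
move=> cf; pose G x := \int[lebesgue_measure]_(t in `[(-1 : R), x]) f t.
have dG (x : R) : -1 < x -> is_derive x 1 G (f x).
  move=> x1.
  have [| | | |dG G'] := @continuous_FTC1_closed R f (-1) x (x + 1).
  - by rewrite ltrDl.
  - apply: continuous_compact_integrable; first exact: segment_compact.
    exact: continuous_subspaceT.
  - exact: x1.
  - exact: cf.
  by apply: DeriveDef; [exact: dG|rewrite -derive1E; exact: G'].
have cG (x : R) : -1 < x -> {for x, continuous G}.
  move=> /dG [dx _]; apply: differentiable_continuous.
  exact/derivable1_diffP.
(* Freezing the argument at 0 avoids the endpoint -1 and yields continuity on the whole line. *)
exists (fun v : R => G (Num.max v 0) - G 0); split; first by rewrite maxxx subrr.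
split.
  move=> x; apply: cvgB; last exact: cvg_cst.
  apply: (@continuous_comp _ _ _ (fun v : R => Num.max v 0) G).
    rewrite (_ : (fun v : R => _) = (fun v => (v + 0 + `|v - 0|) / 2)); last first.
      by apply/funext => v; rewrite maxr_absE.
    apply: cvgM; last exact: cvg_cst.
    apply: cvgD; first by apply: cvgD; [exact: cvg_id|exact: cvg_cst].
    by apply: cvg_norm; apply: cvgB; [exact: cvg_id|exact: cvg_cst].
  by apply: cG; rewrite lt_max orbC ltrN10.
move=> v v0; apply: (@near_eq_is_derive _ _ _ (fun x => G x - G 0)).
  near=> x; congr (G _ - _); apply/esym/max_l.
  by apply: ltW; near: x; exact: lt_nbhsr.
have dv : is_derive v 1 G (f v) by apply: dG; apply: lt_trans v0; exact: ltrN10.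
rewrite -[f v]subr0; apply: is_deriveB.
Unshelve. all: by end_near. Qed.

Lemma primitive_le F G f g : is_primitive F f -> is_primitive G g ->
  forall a b : R, 0 <= a -> a <= b ->
  (forall v : R, a < v -> v < b -> f v <= g v) -> F b - F a <= G b - G a.
Proof.
move=> [cF dF] [cG dG] a b a0 ab fg.
move: ab; rewrite le_eqVlt => /predU1P[->|ab]; first by rewrite !subrr.
have [||c cab] := @MVT R (G - F) (g - f) a b ab.
- move=> x /[!in_itv]/= /andP[ax _]; have x0 : 0 < x by exact: le_lt_trans ax.
  by have := dF _ x0; have := dG _ x0 => d1 d2; apply: is_deriveB.
- by apply: continuous_subspaceT => x; apply: continuousB; [exact: cG|exact: cF].
move=> e.
  have {}e : G b - F b - (G a - F a) = (g c - f c) * (b - a) by exact: e.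
suff : 0 <= (g c - f c) * (b - a) by rewrite -e; lra.
rewrite mulr_ge0 ?subr_ge0 ?(ltW ab)//.
by move: cab; rewrite in_itv/= => /andP[]; exact: fg.
Qed.

Lemma primitive_uniq F G f g : is_primitive F f -> is_primitive G g ->
  (forall v : R, 0 < v -> f v = g v) -> forall a b : R, 0 <= a -> a <= b ->
  F b - F a = G b - G a.
Proof.
move=> pF pG fg a b a0 ab; apply/eqP; rewrite eq_le.
have {}fg v : a < v -> f v = g v by move=> av; rewrite fg// (le_lt_trans a0).
rewrite (primitive_le pF pG)//; last by move=> v av _; rewrite fg.
by rewrite (primitive_le pG pF)// => v av _; rewrite fg.
Qed.

Lemma is_primitiveD F G f g : is_primitive F f -> is_primitive G g ->
  is_primitive (fun v => F v + G v) (fun v => f v + g v).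
Proof.
move=> [cF dF] [cG dG]; split => [x|v v0].
  by apply: continuousD; [exact: cF|exact: cG].
by have := dF _ v0; have := dG _ v0 => d1 d2; apply: is_deriveD.
Qed.

Lemma is_primitiveZ a F f : is_primitive F f ->
  is_primitive (fun v => a * F v) (fun v => a * f v).
Proof.
move=> [cF dF]; split => [x|v v0].
  by apply: continuousM; [exact: cvg_cst|exact: cF].
by have := dF _ v0 => d; apply: is_deriveZ.
Qed.

Lemma is_primitive_shift t F f : 0 <= t -> is_primitive F f ->
  is_primitive (fun v => F (t + v)) (fun v => f (t + v)).
Proof.
move=> t0 [cF dF]; split => [x|v v0].
  apply: (@continuous_comp _ _ _ (fun v => t + v) F); last exact: cF.
  by apply: continuousD; [exact: cvg_cst|exact: cvg_id].
rewrite -[f _]mulr1; apply: (@is_derive1_comp _ F (fun v => t + v)).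
  by apply: dF; rewrite ltr_wpDl.
rewrite (_ : (fun v => t + v) = cst t + id); last exact/funext.
by rewrite -[1 in X in is_derive _ _ _ X]add0r; apply: is_deriveD.
Qed.

Lemma is_primitive_id : is_primitive (@id R) (fun=> 1).
Proof. by split=> [x|v v0]; [exact: cvg_id|exact: is_derive_id]. Qed.

Lemma is_primitive_expR (a : R) :
  is_primitive (fun v => expR (a * v)) (fun v => a * expR (a * v)).
Proof.
split=> [x|v v0].
  apply: (@continuous_comp _ _ _ (fun v => a * v) expR).
    by apply: continuousM; [exact: cvg_cst|exact: cvg_id].
  exact: continuous_expR.
rewrite mulrC; apply: (@is_derive1_comp _ expR (fun v => a * v)).
rewrite -[a in X in is_derive _ _ _ X]mulr1; apply: is_deriveZ.
Qed.

Lemma is_primitive_exprn n :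
  is_primitive (fun v : R => v ^+ n.+1) (fun v => n.+1%:R * v ^+ n).
Proof.
split=> [x|v v0]; first exact: exprn_continuous.
have := @is_deriveX R R id n.+1 v 1 1 (is_derive_id _ _).
by rewrite /GRing.scale/= mulr1; congr is_derive; apply/funext => w; rewrite exprfctE.
Qed.

(** Made total so that a seminorm can be composed with it. The value 0 for discontinuous [f] is a
    default; the seminorm fields concern continuous functions only. *)
Definition primitive f : R -> R :=
  if pselect (continuous f) is left cf then sval (cid (primitive_exists cf))
  else fun=> 0.

Lemma primitiveP f : continuous f -> primitive f 0 = 0 /\ is_primitive (primitive f) f.
Proof. by move=> cf; rewrite /primitive; case: pselect => // ?; case: cid. Qed.

Lemma primitiveE F f : continuous f -> is_primitive F f ->
  forall v : R, 0 <= v -> primitive f v = F v - F 0.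
Proof.
move=> cf pF v v0; have [p0 pf] := primitiveP cf.
by rewrite -(primitive_uniq pf pF (fun _ _ => erefl) (lexx 0) v0) p0 subr0.
Qed.

End Primitive.

(** * From constants to monomials to exponentials when [k] is subexponential *)

Section SubexponentialVanishing.
Context {R : realType}.
Implicit Types (f g k F : R -> R) (q : (R -> R) -> R).

Lemma le_mul_expR (c v : R) : 0 < c -> v <= c^-1 * expR (c * v).
Proof.
move=> c0; rewrite ler_pdivlMl//.
by apply: le_trans (expR_ge1Dx _); rewrite lerDr.
Qed.

(** For [n > 0], raise [v <= (n / c) e^(c v / n)] to the power [n]. *)
Lemma exprn_le_expR (c : R) n : 0 < c -> exists2 C : R, 0 <= C &
  forall v : R, 0 <= v -> v ^+ n <= C * expR (c * v).
Proof.
move=> c0; exists ((c^-1 * n%:R) ^+ n + 1) => [|v v0].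
  by rewrite addr_ge0 ?exprn_ge0 ?mulr_ge0 ?invr_ge0 ?(ltW c0).
case: n => [|n]; first by rewrite expr0 mulrDl ler_wpDl ?mulr_ge0 ?expr0 ?expR_ge0//
  mul1r -expR0 ler_expR mulr_ge0// ltW.
rewrite mulrDl; apply: ler_wpDr; first by rewrite mul1r expR_ge0.
have cn0 : 0 < c / n.+1%:R by rewrite divr_gt0.
have -> : expR (c * v) = expR (c / n.+1%:R * v) ^+ n.+1.
  by rewrite -expRM_natl; congr expR; rewrite mulrA (mulrCA n.+1%:R) divff ?pnatr_eq0 ?mulr1.
rewrite -exprMn lerXn2r ?nnegrE ?mulr_ge0 ?invr_ge0 ?expR_ge0 ?(ltW c0)//.
by rewrite (mulrC c^-1) -invf_div; exact: le_mul_expR.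
Qed.

Lemma primitive_dominated (kappa b : R) f : 0 < kappa -> continuous f ->
  (forall v, 0 <= v -> `|f v| <= b * expR (kappa * v)) ->
  forall v, 0 <= v -> `|primitive f v| <= b / kappa * expR (kappa * v).
Proof.
move=> kap0 cf fb v v0; have [p0 pf] := primitiveP cf.
have b0 : 0 <= b.
  by have := fb _ (lexx 0); rewrite mulr0 expR0 mulr1; exact: le_trans.
have pe := is_primitiveZ (b / kappa) (is_primitive_expR kappa).
have fb' x : 0 < x -> `|f x| <= b / kappa * (kappa * expR (kappa * x)).
  by move=> x0; rewrite mulrA divfK ?gt_eqF// fb// ltW.
have e1 : b / kappa * expR (kappa * v) - b / kappa * expR (kappa * 0) <=
    b / kappa * expR (kappa * v).
  by rewrite lerBlDr lerDl mulr_ge0 ?expR_ge0 ?divr_ge0// ltW.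
rewrite ler_norml; apply/andP; split; last first.
  apply: le_trans e1; rewrite -[leLHS]subr0 -[X in _ - X <= _]p0.
  apply: (primitive_le pf pe) => // x x0 _; exact: le_trans (ler_norm _) (fb' _ x0).
rewrite lerNl; apply: le_trans e1.
have -> : - primitive f v = -1 * primitive f v - -1 * primitive f 0.
  by rewrite p0 mulr0 subr0 mulN1r.
apply: (primitive_le (is_primitiveZ (-1) pf) pe) => // x x0 _.
by rewrite mulN1r; apply: le_trans (fb' _ x0); rewrite -normrN ler_norm.
Qed.

Lemma exp_dominated_primitive (kappa : R) f : 0 < kappa ->
  exp_dominated kappa f -> exp_dominated kappa (primitive f).
Proof.
move=> kap0 [cf [b fb]]; have [_ [cp _]] := primitiveP cf.
exact: exp_dominated_le (primitive_dominated kap0 cf fb).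
Qed.

(** Integrating [b e^(kappa v)] from 0 gives at most [(b / kappa) e^(kappa v)], so for [kappa > 0]
    integration preserves the class. Results proved for every [q] can therefore be iterated. *)
Lemma exp_seminorm_primitive (kappa B : R) q : 0 < kappa ->
  exp_seminorm kappa B q -> exp_seminorm kappa (B / kappa) (q \o primitive).
Proof.
move=> kap0 qP; have kap0' := ltW kap0; split => /=.
- move=> f g df dg; have [cf _] := df; have [cg _] := dg.
  have dp h : exp_dominated kappa h -> exp_dominated kappa (primitive h).
    exact: exp_dominated_primitive.
  apply: le_trans (esn_add qP (dp _ df) (dp _ dg)).
  apply: (esn_eq qP).
  + by apply: dp; exact: exp_dominatedD.
  + by apply: exp_dominatedD; exact: dp.
  + move=> v v0; have [f0 pf] := primitiveP cf; have [g0 pg] := primitiveP cg.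
    rewrite (primitiveE _ (is_primitiveD pf pg))//; last first.
      by move=> x; apply: continuousD; [exact: cf|exact: cg].
    by rewrite f0 g0 addr0 subr0.
- move=> a f df; have [cf _] := df.
  have dp h : exp_dominated kappa h -> exp_dominated kappa (primitive h).
    exact: exp_dominated_primitive.
  apply: le_trans (esn_scale qP a (dp _ df)).
  apply: (esn_eq qP).
  + by apply: dp; exact: exp_dominatedZ.
  + by apply: exp_dominatedZ; exact: dp.
  + move=> v v0; have [f0 pf] := primitiveP cf.
    rewrite (primitiveE _ (is_primitiveZ a pf))//; last first.
      by move=> x; apply: continuousM; [exact: cvg_cst|exact: cf].
    by rewrite f0 mulr0 subr0.
- move=> f b cf fb; rewrite mulrAC -mulrA.
  have [_ [cp _]] := primitiveP cf.
  by apply: (esn_bound qP) => // v v0; apply: primitive_dominated.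
Qed.

Lemma primitive_increment F k x h : is_primitive F k ->
  {homo k : x y / x <= y >-> y <= x} -> 0 <= x -> 0 <= h ->
  h * k (x + h) <= F (x + h) - F x <= h * k x.
Proof.
move=> pF kdecr x0 h0.
have pFx := is_primitive_shift x0 pF.
have pid (a : R) : is_primitive (fun v => a * v) (fun=> a).
  by have := is_primitiveZ a (@is_primitive_id R); rewrite mulr1.
have -> : F (x + h) - F x = F (x + h) - F (x + 0) by rewrite addr0.
have hE (a : R) : h * a = a * h - a * 0 by rewrite mulr0 subr0 mulrC.
apply/andP; split; rewrite hE.
  apply: (primitive_le (pid _) pFx) => // v _ vh.
  by apply: kdecr; rewrite lerD2l ltW.
apply: (primitive_le pFx (pid _)) => // v v0 _.
by apply: kdecr; rewrite lerDl ltW.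
Qed.

(** Geometric sum, combined with [h <= (1 + h) (1 - e^-h)], which is [1 + h <= e^h] rearranged. *)
Lemma sum_expR_le (h : R) n : 0 < h -> h * \sum_(i < n) expR (- h) ^+ i <= 1 + h.
Proof.
move=> h0; have e1 : expR (- h) < 1 by rewrite -expR0 ltr_expR oppr_lt0.
have /(congr1 -%R) := subrX1 (expR (- h)) n.
rewrite opprB -mulNr opprB => s1.
have s1' : (1 - expR (- h)) * \sum_(i < n) expR (- h) ^+ i <= 1.
  by rewrite -s1 lerBlDr lerDl exprn_ge0 ?expR_ge0.
have he : h <= (1 + h) * (1 - expR (- h)).
  rewrite mulrBr mulr1 lerBrDr [leRHS]addrC lerD2l expRN.
  by rewrite ler_pdivrMr ?expR_gt0// mul1r expR_ge1Dx.
have s0 : 0 <= \sum_(i < n) expR (- h) ^+ i.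
  by rewrite sumr_ge0// => i _; rewrite exprn_ge0 ?expR_ge0.
apply: (le_trans (ler_wpM2r s0 he)).
by rewrite -mulrA ler_piMr// addr_ge0// ltW.
Qed.

(** For nonincreasing [k], the error on each cell is at most [h] times the drop of [k] across it;
    the drops telescope. *)
Lemma riemann_sum_bound F k h x n : is_primitive F k ->
  {homo k : x y / x <= y >-> y <= x} -> 0 < h -> 0 <= x ->
  `|F (x + n%:R * h) - F x - \sum_(i < n) h * k (x + i%:R * h)| <=
  h * (k x - k (x + n%:R * h)).
Proof.
move=> pF kdecr h0 x0; elim: n => [|n IHn].
  by rewrite big_ord0 mul0r addr0 !subrr mulr0 normr0.
have xn0 : 0 <= x + n%:R * h by rewrite addr_ge0// mulr_ge0// ltW.
have := primitive_increment pF kdecr xn0 (ltW h0).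
have -> : x + n%:R * h + h = x + n.+1%:R * h by rewrite -natr1 mulrDl mul1r addrA.
rewrite big_ord_recr/=.
set u := F (x + n.+1%:R * h); set w := F (x + n%:R * h).
set s := \sum_(i < n) _ in IHn *.
set kn := k (x + n%:R * h); set kn1 := k (x + n.+1%:R * h).
move=> /andP[l1 l2].
move: IHn; rewrite !ler_norml -/kn -/w => /andP[l3 l4].
apply/andP; split; lra.
Qed.

(* Summation by steps of size [exp (- tau)]: the increments of [F] cost
   [exp (- tau)] in the seminorm, and the remainder vanishes at infinity. *)
Lemma esn_primitive_decay (kappa B C : R) q k : 0 < kappa ->
  exp_seminorm kappa B q ->
  {homo k : x y / x <= y >-> y <= x} -> (forall x, 0 <= k x) ->
  continuous k -> (forall e, 0 < e -> exists2 tau, 0 <= tau & k tau <= e) ->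
  (forall tau, 0 <= tau -> q (fun v => k (tau + v)) <= C * expR (- tau)) ->
  q (fun=> 1) <= 0 ->
  forall tau, 0 <= tau -> q (primitive (fun v => k (tau + v))) <=
    (2 * C + B * k 0) * expR (- tau).
Proof.
move=> kap0 qP kdecr k0 ck klim qk q1 tau tau0.
have kap0' := ltW kap0.
have B0 : 0 <= B := esn_bound_ge0 kap0' qP.
have dsh t : 0 <= t -> exp_dominated kappa (fun v => k (t + v)).
  by move=> t0; exact: exp_dominated_shift.
have C0 : 0 <= C.
  have := qk 0 (lexx 0); rewrite oppr0 expR0 mulr1; apply: le_trans.
  by apply: (esn_ge0 kap0' qP); exact: dsh.
have [F0 pF] := primitiveP ck.
set F := primitive k in F0 pF.
apply/ler_addgt0Pr => d d0.
(* The mesh is [e^-tau] because the Riemann error is at most [h * k 0]. *)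
pose h := expR (- tau); have h0 : 0 < h := expR_gt0 _.
have h1 : h <= 1 by rewrite -expR0 ler_expR oppr_le0.
(* Once [k tn <= e], the far remainder [v * k tn <= (k tn / kappa) e^(kappa v)] costs at most
   [d]. *)
pose e := d * kappa / (B + 1).
have e0 : 0 < e by rewrite !(mulr_gt0, invr_gt0)// ltr_wpDl.
have [s s0 ks] := klim _ e0.
pose n := (Num.trunc (s / h)).+1.
have sn : s <= n%:R * h.
  rewrite -ler_pdivrMr// ltW//.
  by have /andP[] := truncn_itv (divr_ge0 s0 (ltW h0)).
pose tn := tau + n%:R * h.
have tn0 : 0 <= tn by rewrite addr_ge0 ?mulr_ge0 ?(ltW h0).
have ktn : k tn <= e by apply: le_trans ks; apply: kdecr; rewrite ler_wpDl.
(* [F (tau + v) - F tau] splits as [[F tn - F tau] - [F (tn + v) - F (tau + v)] +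
   [F (tn + v) - F tn]]: a constant killed by [q], a piece approximated by [S], and the far
   remainder. *)
pose S := fun v => \sum_(i < n) (- h) * k (tau + i%:R * h + v).
have ti0 i : 0 <= tau + i%:R * h by rewrite addr_ge0 ?mulr_ge0 ?(ltW h0).
have [dS qS] : exp_dominated kappa S /\
    q S <= \sum_(i < n) h * (C * expR (- (tau + i%:R * h))).
  apply: (@esn_sum _ _ _ _ kap0' qP n (fun i v => (- h) * k (tau + i%:R * h + v))
    (fun i => h * (C * expR (- (tau + i%:R * h))))) => i.
    exact/exp_dominatedZ/dsh.
  apply: (le_trans (esn_scale qP _ (dsh _ (ti0 i)))).
  by rewrite normrN gtr0_norm// ler_wpM2l ?(ltW h0)// qk.
pose c := F tn - F tau.
have dc : exp_dominated kappa (fun=> c * 1).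
  exact/exp_dominatedZ/exp_dominated_cst.
have pE v : 0 <= v -> primitive (fun v => k (tau + v)) v = F (tau + v) - F tau.
  move=> v0; rewrite (primitiveE _ (is_primitive_shift tau0 pF))// ?addr0//.
  by case: (dsh _ tau0).
have key : q (primitive (fun v => k (tau + v))) <=
    q (fun v => S v + c * 1) + B * (h * k 0 + k tn / kappa).
  apply: (esn_dist qP).
  - by apply: exp_dominated_primitive => //; exact: dsh.
  - exact: exp_dominatedD.
  move=> v v0; rewrite pE// mulr1.
  have tv0 : 0 <= tau + v by rewrite addr_ge0.
  have := riemann_sum_bound n pF kdecr h0 tv0.
  have := primitive_increment pF kdecr tn0 v0.
  have -> : tau + v + n%:R * h = tn + v by rewrite /tn addrAC.
  have -> : \sum_(i < n) h * k (tau + v + i%:R * h) = - S v.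
    rewrite /S -sumrN; apply: eq_bigr => i _.
    by rewrite mulNr opprK [tau + v + _]addrAC.
  move=> /andP[l1 l2]; rewrite ler_norml => /andP[l3 l4].
  have l5 : h * (k (tau + v) - k (tn + v)) <= h * k 0.
    rewrite ler_wpM2l ?(ltW h0)// lerBlDr; apply: ler_wpDr => //.
    exact: kdecr.
  have l6 : v * k tn <= k tn / kappa * expR (kappa * v).
    by rewrite mulrC -mulrA ler_wpM2l// le_mul_expR.
  have l7 : h * k 0 <= h * k 0 * expR (kappa * v).
    rewrite ler_peMr//; first by rewrite mulr_ge0 ?(ltW h0).
    by rewrite -expR0 ler_expR mulr_ge0.
  have l8 : 0 <= v * k (tn + v) by rewrite mulr_ge0.
  rewrite mulrDl ler_norml /c; apply/andP; split; lra.
have qS2 : \sum_(i < n) h * (C * expR (- (tau + i%:R * h))) <= 2 * C * expR (- tau).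
  have -> : \sum_(i < n) h * (C * expR (- (tau + i%:R * h))) =
      C * expR (- tau) * (h * \sum_(i < n) expR (- h) ^+ i).
    rewrite mulr_sumr mulr_sumr; apply: eq_bigr => i _.
    rewrite -expRM_natl opprD expRD -mulrN; ring.
  have ce0 : 0 <= C * expR (- tau) by rewrite mulr_ge0 ?expR_ge0.
  apply: (le_trans (ler_wpM2l ce0 (sum_expR_le n h0))).
  by rewrite -mulrA [leRHS]mulrC ler_wpM2l//; lra.
have qsum : q (fun v => S v + c * 1) <= 2 * C * expR (- tau).
  apply: (le_trans (esn_add qP dS dc)).
  have d1 := exp_dominated_cst 1 kap0'.
  have : q (fun=> c * 1) <= 0.
    apply: (le_trans (esn_scale qP c d1)).
    by rewrite mulr_ge0_le0.
  by have := le_trans qS qS2; lra.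
have Be : B * (k tn / kappa) <= d.
  apply: (@le_trans _ _ ((B + 1) * (e / kappa))).
    rewrite ler_pM ?divr_ge0 ?lerDl//.
    by rewrite ler_wpM2r ?invr_ge0.
  rewrite le_eqVlt; apply/orP; left; apply/eqP; rewrite /e; field.
  by rewrite !gt_eqF// ltr_wpDl.
apply: (le_trans key); move: qsum Be; rewrite mulrDr mulrDl -/h.
have -> : B * (h * k 0) = B * k 0 * h by ring.
lra.
Qed.

(** Induction on [j] with [q] varying: [v^(j+1)] is [j + 1] times the primitive of [v^j], and
    [esn_primitive_decay] returns for [q \o primitive] the very hypothesis made on [q], with other
    constants. *)
Lemma esn_exprn (kappa B C : R) q k j : 0 < kappa ->
  exp_seminorm kappa B q ->
  {homo k : x y / x <= y >-> y <= x} -> (forall x, 0 <= k x) ->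
  continuous k -> (forall e, 0 < e -> exists2 tau, 0 <= tau & k tau <= e) ->
  subexponential k ->
  (forall tau, 0 <= tau -> q (fun v => k (tau + v)) <= C * expR (- tau)) ->
  q (fun v => v ^+ j) <= 0.
Proof.
move=> kap0 qP kdecr k0 ck klim ksub; elim: j q B C qP => [|j IHj] q B C qP qk.
  by rewrite (_ : (fun v => _) = (fun=> 1))//; exact: (esn_cst1 _ qP _ _ _ _ qk).
have q1 : q (fun=> 1) <= 0 by exact: (esn_cst1 _ qP _ _ _ _ qk).
have := IHj _ _ _ (exp_seminorm_primitive kap0 qP)
  (esn_primitive_decay kap0 qP kdecr k0 ck klim qk q1).
rewrite /= => qj.
have dom i : exp_dominated kappa (fun v => v ^+ i).
  have [D D0 Dv] := exprn_le_expR i kap0.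
  apply: (@exp_dominated_le _ _ D) => [|v v0]; first exact: exprn_continuous.
  by rewrite ger0_norm ?exprn_ge0// Dv.
have := esn_scale qP j.+1%:R (exp_dominated_primitive kap0 (dom j)).
rewrite normr_nat => qs.
apply: le_trans (le_trans qs _); last by rewrite mulr_ge0_le0.
apply: (esn_eq qP) => [//||v v0].
  exact/exp_dominatedZ/exp_dominated_primitive.
have pj := is_primitiveZ j.+1%:R^-1 (@is_primitive_exprn R j).
have {}pj : is_primitive (fun v : R => j.+1%:R^-1 * v ^+ j.+1) (fun v => v ^+ j).
  case: pj => cp dp; split => // w /dp.
  by rewrite mulrA mulVf ?pnatr_eq0// mul1r.
rewrite (primitiveE _ pj)//; last exact: exprn_continuous.
by rewrite expr0n/= mulr0 subr0 mulrA divff ?pnatr_eq0// mul1r.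
Qed.

(** For [i >= n] one has [x^i <= 2^-n (2x)^i], so the tail is at most [2^-n] times the series of
    [e^(2x)]. *)
Lemma expRN_taylor (x : R) n : 0 <= x ->
  `|expR (- x) - \sum_(i < n) (- x) ^+ i / i`!%:R| <= 2 ^- n * expR (2 * x).
Proof.
move=> x0; pose s := series (exp_coeff (- x)).
have cs : s m @[m --> \oo] --> expR (- x) by exact: is_cvg_series_exp_coeff.
have -> : \sum_(i < n) (- x) ^+ i / i`!%:R = s n.
  by rewrite /s /series/= big_mkord.
have c2 : `|s m - s n| @[m --> \oo] --> `|expR (- x) - s n|.
  by apply: cvg_norm; apply: cvgB => //; exact: cvg_cst.
apply: (cvgr_to_le c2); near=> m.
have nm : (n <= m)%N by near: m; exact: nbhs_infty_ge.
rewrite /s sub_series_geq//; apply: (le_trans (ler_norm_sum _ _ _)).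
have x20 : 0 <= 2 * x by rewrite mulr_ge0.
apply: (@le_trans _ _ (\sum_(n <= i < m) 2 ^- n * exp_coeff (2 * x) i)).
  apply: ler_sum_nat => i /andP[ni _].
  rewrite /exp_coeff/= normrM normrX normrN (ger0_norm x0).
  rewrite ger0_norm ?invr_ge0 ?ler0n// mulrA ler_wpM2r ?invr_ge0 ?ler0n//.
  rewrite exprMn mulrA ler_peMl ?exprn_ge0// mulrC ler_pdivlMr ?exprn_gt0//.
  by rewrite mul1r ler_eXn2l// ltr1n.
rewrite -mulr_sumr ler_wpM2l ?invr_ge0 ?exprn_ge0//.
apply: (@le_trans _ _ (series (exp_coeff (2 * x)) m)).
  rewrite /series/= [leRHS](big_cat_nat _ nm)//= lerDr sumr_ge0// => i _.
  exact: exp_coeff_ge0.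
apply: nondecreasing_cvgn_le; last exact: is_cvg_series_exp_coeff.
apply/nondecreasing_seqP => i.
by rewrite /series/= big_nat_recr//= lerDl exp_coeff_ge0.
Unshelve. all: by end_near. Qed.

Lemma exp_seminorm_twist (kappa B c : R) q : 0 <= c ->
  exp_seminorm kappa B q ->
  exp_seminorm kappa B (fun f => q (fun v => expR (- (c * v)) * f v)).
Proof.
move=> c0 qP.
have ce := @continuous_expRN R c.
have le f v : 0 <= v -> `|expR (- (c * v)) * f v| <= `|f v|.
  move=> v0; rewrite normrM ger0_norm ?expR_ge0// ler_piMl//.
  by rewrite -expR0 ler_expR oppr_le0 mulr_ge0.
have dt f : exp_dominated kappa f ->
    exp_dominated kappa (fun v => expR (- (c * v)) * f v).
  move=> [cf [b fb]]; apply: (@exp_dominated_le _ _ b).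
    by move=> x; apply: cvgM; [exact: ce|exact: cf].
  by move=> v v0; apply: (le_trans (le f v v0)); exact: fb.
split.
- move=> f g /dt df /dt dg; apply: le_trans (esn_add qP df dg).
  rewrite (_ : (fun v => expR _ * (f v + g v)) =
    (fun v => expR (- (c * v)) * f v + expR (- (c * v)) * g v))//.
  by apply/funext => v; rewrite mulrDr.
- move=> a f /dt df; apply: le_trans (esn_scale qP a df).
  rewrite (_ : (fun v => expR _ * (a * f v)) =
    (fun v => a * (expR (- (c * v)) * f v)))//.
  by apply/funext => v; rewrite mulrCA.
- move=> f b cf fb; apply: (esn_bound qP).
    by move=> x; apply: cvgM; [exact: ce|exact: cf].
  by move=> v v0; apply: (le_trans (le f v v0)); exact: fb.
Qed.

(** Taylor polynomials are killed by [q]. The remainder carries [e^(2 c v)] and [v^j] costs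
    [e^(kappa v / 2)]; the product stays below [e^(kappa v)] exactly when [c <= kappa / 4]. *)
Lemma esn_exprn_expR_small (kappa B c : R) q : 0 < kappa -> 0 <= c -> c <= kappa / 4 ->
  exp_seminorm kappa B q -> (forall j, q (fun v => v ^+ j) <= 0) ->
  forall j, q (fun v => expR (- (c * v)) * v ^+ j) <= 0.
Proof.
move=> kap0 c0 ck qP qv j; have kap0' := ltW kap0.
have B0 : 0 <= B := esn_bound_ge0 kap0' qP.
have kap2 : 0 < kappa / 2 by rewrite divr_gt0.
have [D D0 Dv] := exprn_le_expR j kap2.
have dom i : exp_dominated kappa (fun v => v ^+ i).
  have [E E0 Ev] := exprn_le_expR i kap0.
  apply: (@exp_dominated_le _ _ E) => [|v v0]; first exact: exprn_continuous.
  by rewrite ger0_norm ?exprn_ge0// Ev.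
have ce := @continuous_expRN R c.
have small n : q (fun v => expR (- (c * v)) * v ^+ j) <= B * (D * 2 ^- n).
  pose a i := (- c) ^+ i / i`!%:R.
  pose S v := \sum_(i < n) a i * v ^+ (i + j).
  have [dS qS] : exp_dominated kappa S /\ q S <= \sum_(i < n) 0.
    apply: (@esn_sum _ _ _ _ kap0' qP n (fun i v => a i * v ^+ (i + j)) (fun=> 0)) => i.
      exact: exp_dominatedZ.
    by apply: (le_trans (esn_scale qP _ (dom _))); rewrite mulr_ge0_le0.
  move: qS; rewrite big1// => qS.
  have : q (fun v => expR (- (c * v)) * v ^+ j) <= q S + B * (D * 2 ^- n).
    apply: (esn_dist qP) => //.
      apply: (@exp_dominated_le _ _ D).
        by move=> x; apply: cvgM; [exact: ce|exact: exprn_continuous].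
      move=> v v0; rewrite ger0_norm ?mulr_ge0 ?expR_ge0 ?exprn_ge0//.
      apply: (@le_trans _ _ (v ^+ j)).
        rewrite ler_piMl ?exprn_ge0//.
        by rewrite -expR0 ler_expR oppr_le0 mulr_ge0.
      apply: (le_trans (Dv _ v0)); rewrite ler_wpM2l// ler_expR ler_wpM2r//; lra.
    move=> v v0.
    have -> : S v = (\sum_(i < n) (- (c * v)) ^+ i / i`!%:R) * v ^+ j.
      rewrite mulr_suml; apply: eq_bigr => i _; rewrite /a exprD -mulNr exprMn.
      ring.
    rewrite -mulrBl normrM [X in _ * X]ger0_norm ?exprn_ge0//.
    have cv0 : 0 <= c * v by rewrite mulr_ge0.
    apply: (le_trans (ler_wpM2r (exprn_ge0 _ v0) (expRN_taylor n cv0))).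
    apply: (@le_trans _ _ (2 ^- n * expR (2 * (c * v)) * (D * expR (kappa / 2 * v)))).
      by rewrite ler_wpM2l ?Dv// mulr_ge0 ?expR_ge0 ?invr_ge0 ?exprn_ge0.
    have -> : 2 ^- n * expR (2 * (c * v)) * (D * expR (kappa / 2 * v)) =
        D * 2 ^- n * (expR (2 * (c * v)) * expR (kappa / 2 * v)) by ring.
    rewrite ler_wpM2l ?mulr_ge0 ?invr_ge0 ?exprn_ge0// -expRD ler_expR mulrA -mulrDl.
    by rewrite ler_wpM2r//; lra.
  by move=> h; apply: (le_trans h); rewrite -[leRHS]add0r lerD2r.
have cv : B * (D * 2 ^- n) @[n --> \oo] --> B * (D * 0).
  apply: cvgM; first exact: cvg_cst.
  apply: cvgM; first exact: cvg_cst.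
  rewrite (_ : (fun n => 2 ^- n) = (fun n => (2^-1 : R) ^+ n)); last first.
    by apply/funext => n; rewrite exprVn.
  by apply: cvg_expr; rewrite ger0_norm ?invr_ge0// invf_lt1// ltr1n.
move: cv; rewrite !mulr0 => cv; apply: (cvgr_to_ge cv).
by apply: nearW => n; exact: small.
Qed.

(** Write [z = n c] with [c <= kappa / 4] and move one factor [e^(-c v)] at a time into the
    seminorm. *)
Lemma esn_expRN (kappa B C : R) q k z : 0 < kappa ->
  exp_seminorm kappa B q ->
  {homo k : x y / x <= y >-> y <= x} -> (forall x, 0 <= k x) ->
  continuous k -> (forall e, 0 < e -> exists2 tau, 0 <= tau & k tau <= e) ->
  subexponential k ->
  (forall tau, 0 <= tau -> q (fun v => k (tau + v)) <= C * expR (- tau)) ->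
  0 <= z -> q (fun v => expR (- (z * v))) <= 0.
Proof.
move=> kap0 qP kdecr k0 ck klim ksub qk z0.
have q0 j : q (fun v => v ^+ j) <= 0 by exact: (esn_exprn _ _ qP _ _ _ _ _ qk).
pose n := (Num.trunc (z / (kappa / 4))).+1.
pose c := z / n%:R.
have kap4 : 0 < kappa / 4 by rewrite divr_gt0.
have c0 : 0 <= c by rewrite divr_ge0.
have ck4 : c <= kappa / 4.
  rewrite ler_pdivrMr// mulrC -ler_pdivrMr// ltW//.
  by have /andP[] := truncn_itv (divr_ge0 z0 (ltW kap4)).
(* The seminorm varies in the induction. All [j] are kept since a twisted seminorm must again kill
   every monomial. *)
have step m j : q (fun v => expR (- (m%:R * c * v)) * v ^+ j) <= 0.
  elim: m j q qP {qk} q0 => [|m IHm] j q qP q0.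
    rewrite (_ : (fun v => _) = (fun v => v ^+ j))//; apply/funext => v.
    by rewrite !mul0r oppr0 expR0 mul1r.
  have qt := exp_seminorm_twist c0 qP.
  have := IHm j _ qt (esn_exprn_expR_small kap0 c0 ck4 qP q0).
  congr (q _ <= 0); apply/funext => v.
  by rewrite mulrA -expRD -natr1; congr (expR _ * _); ring.
have := step n 0%N; congr (q _ <= 0); apply/funext => v.
by rewrite expr0 mulr1 /c [n%:R * _]mulrC divfK ?pnatr_eq0.
Qed.

End SubexponentialVanishing.

(** * Exponentials reached through an unbounded, slowly growing [g] *)

Section RegularGrowth.
Context {R : realType}.
Implicit Types (g : R -> R) (q : (R -> R) -> R).

(** If every [tau] beyond a point with [g >= M] failed, [g] would gain [e^(2 eta L)] per step [L]
    and outgrow [A e^(eta tau)]. The factor 2 leaves a surplus [e^(n eta L)] after [n] steps. *)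
Lemma growth_select g (eta A L M : R) :
  {homo g : x y / x <= y} -> 0 < eta -> 0 < L ->
  (forall tau, 0 <= tau -> g tau <= A * expR (eta * tau)) ->
  (forall N, exists2 tau, 0 <= tau & N <= g tau) -> 0 < M ->
  exists tau, [/\ 0 <= tau, M <= g tau &
                  g (tau + L) <= expR (2 * eta * L) * g tau].
Proof.
move=> gincr eta0 L0 gA glim M0; apply: contrapT => /forallNP nsel.
have [t0 t00 Mt0] := glim M.
have {}nsel tau : t0 <= tau -> expR (2 * eta * L) * g tau < g (tau + L).
  move=> tt; rewrite ltNge; apply/negP => h; apply: (nsel tau); split => //.
    exact: le_trans tt.
  exact: le_trans (gincr _ _ tt).
have gn n : expR (2 * eta * L) ^+ n * M <= g (t0 + n%:R * L).
  elim: n => [|n IHn]; first by rewrite expr0 mul1r mul0r addr0.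
  have nL : t0 <= t0 + n%:R * L by rewrite lerDl mulr_ge0// ltW.
  have -> : t0 + n.+1%:R * L = t0 + n%:R * L + L by rewrite -natr1; ring.
  apply: le_trans (ltW (nsel _ nL)).
  by rewrite exprS -mulrA ler_wpM2l// expR_ge0.
have A0 : 0 < A.
  have := gA _ t00; have gt0 : 0 < g t0 by exact: lt_le_trans Mt0.
  by move=> /(lt_le_trans gt0); rewrite pmulr_lgt0// expR_gt0.
(* An upper bound for the surplus, hence for [n * (eta * L)] for every [n], which is absurd. *)
pose D := A * expR (eta * t0) / M.
have bound n : n%:R * (eta * L) <= D.
  have nL0 : 0 <= t0 + n%:R * L by rewrite addr_ge0// mulr_ge0// ltW.
  have := le_trans (gn n) (gA _ nL0).
  rewrite -ler_pdivlMr// mulrDr expRD -expRM_natl.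
  rewrite (_ : n%:R * (2 * eta * L) = n%:R * (eta * L) + n%:R * (eta * L)); last by ring.
  rewrite expRD (_ : eta * (n%:R * L) = n%:R * (eta * L)); last by ring.
  rewrite (_ : A * (expR (eta * t0) * _) / M = D * expR (n%:R * (eta * L))); last first.
    by rewrite /D; ring.
  rewrite ler_pM2r ?expR_gt0//; apply: le_trans.
  by apply: le_trans (expR_ge1Dx _); rewrite lerDr.
have eL0 : 0 < eta * L by rewrite mulr_gt0.
have D0 : 0 <= D by rewrite divr_ge0 ?mulr_ge0 ?expR_ge0 ?(ltW A0) ?(ltW M0).
have := bound (Num.trunc (D / (eta * L))).+1.
rewrite leNgt => /negP; apply.
rewrite -ltr_pdivrMr//.
by have /andP[] := truncn_itv (divr_ge0 D0 (ltW eL0)).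
Qed.

(** Divide by [g tau] at a selected [tau]. On [[0, L]] the quotient exceeds [e^(-p v)] by a factor
    of at most [e^(2 eta L)]; past [L] both lie in [[0, 1]] and [e^(-kappa L) e^(kappa v) >= 1]. The
    seminorm of the quotient is at most [C / g tau], arbitrarily small as [g] is unbounded. *)
Lemma esn_expRN_growth (kappa B C p eta A L : R) q g : 0 < kappa -> 0 <= p ->
  exp_seminorm kappa B q -> {homo g : x y / x <= y} -> continuous g ->
  (forall tau v, 0 <= v -> g (tau + v) <= expR (p * v) * g tau) ->
  0 < eta -> 0 < L ->
  (forall tau, 0 <= tau -> g tau <= A * expR (eta * tau)) ->
  (forall N, exists2 tau, 0 <= tau & N <= g tau) ->
  (forall tau, 0 <= tau -> q (fun v => expR (- (p * v)) * g (tau + v)) <= C) ->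
  q (fun v => expR (- (p * v))) <=
    B * (expR (2 * eta * L) - 1 + expR (- (kappa * L))).
Proof.
move=> kap0 p0 qP gincr cg gp eta0 L0 gA glim qg; have kap0' := ltW kap0.
apply/ler_addgt0Pr => d d0.
pose M := (`|C| + 1) / d.
have M0 : 0 < M by rewrite divr_gt0// ltr_wpDl.
have [tau [t0 Mg gL]] := growth_select gincr eta0 L0 gA glim M0.
have gt0 : 0 < g tau by exact: lt_le_trans Mg.
have ce := @continuous_expRN R p.
have eg1 v : 0 <= v -> expR (- (p * v)) * g (tau + v) <= g tau.
  by move=> v0; rewrite expRN ler_pdivrMl ?expR_gt0// gp.
have e1 v : 0 <= v -> 1 <= expR (kappa * v).
  by move=> v0; rewrite -expR0 ler_expR mulr_ge0.
have dg : exp_dominated kappa (fun v => expR (- (p * v)) * g (tau + v)).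
  apply: (@exp_dominated_le _ _ (g tau)).
    move=> x; apply: cvgM; first exact: ce.
    apply: (@continuous_comp _ _ _ (fun v => tau + v) g); last exact: cg.
    by apply: cvgD; [exact: cvg_cst|exact: cvg_id].
  move=> v v0; rewrite ger0_norm; last first.
    by rewrite mulr_ge0 ?expR_ge0// (le_trans (ltW gt0))// gincr// lerDl.
  by apply: (le_trans (eg1 v v0)); rewrite ler_peMr ?e1// ltW.
have de : exp_dominated kappa (fun v => expR (- (p * v))).
  apply: (@exp_dominated_le _ _ 1) => // v v0.
  rewrite ger0_norm ?expR_ge0// mul1r (le_trans _ (e1 _ v0))//.
  by rewrite -expR0 ler_expR oppr_le0 mulr_ge0.
pose f := fun v => (g tau)^-1 * (expR (- (p * v)) * g (tau + v)).
have q1 : q f <= d.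
  apply: (le_trans (esn_scale qP _ dg)).
  rewrite gtr0_norm ?invr_gt0// ler_pdivrMl//.
  apply: (le_trans (qg _ t0)); apply: (le_trans (ler_norm _)).
  apply: (@le_trans _ _ (M * d)); last by rewrite ler_wpM2r// ltW.
  by rewrite /M divfK ?gt_eqF// lerDl.
have : q (fun v => expR (- (p * v))) <=
    q f + B * (expR (2 * eta * L) - 1 + expR (- (kappa * L))).
  apply: (esn_dist qP) => //; first exact: exp_dominatedZ.
  move=> v v0.
  have ev1 : expR (- (p * v)) <= 1 by rewrite -expR0 ler_expR oppr_le0 mulr_ge0.
  have fe : expR (- (p * v)) <= f v.
    rewrite /f mulrCA ler_peMr ?expR_ge0// ler_pdivlMl// mulr1.
    by apply: gincr; rewrite lerDl.
  rewrite distrC ger0_norm ?subr_ge0//.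
  have E1 : 0 <= expR (2 * eta * L) - 1.
    by rewrite subr_ge0 -expR0 ler_expR !mulr_ge0// ltW.
  have [vL|Lv] := leP v L.
    apply: (@le_trans _ _ (expR (2 * eta * L) - 1)).
      apply: (@le_trans _ _ (expR (- (p * v)) * (expR (2 * eta * L) - 1))).
        rewrite mulrBr mulr1 lerD2r /f mulrCA ler_wpM2l ?expR_ge0//.
        rewrite ler_pdivrMl// mulrC; apply: le_trans gL.
        by apply: gincr; rewrite lerD2l.
      by rewrite ler_piMl.
    rewrite [(_ + expR (- (kappa * L))) * _]mulrDl -[leLHS]addr0 lerD ?mulr_ge0 ?expR_ge0//.
    by rewrite ler_peMr ?e1.
  apply: (@le_trans _ _ 1).
    rewrite lerBlDr; apply: ler_wpDr; first exact: expR_ge0.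
    by rewrite /f ler_pdivrMl// mulr1 eg1.
  rewrite [(_ + expR (- (kappa * L))) * _]mulrDl.
  apply: ler_wpDl; first by rewrite mulr_ge0 ?expR_ge0.
  rewrite -expRD -expR0 ler_expR addrC subr_ge0 ler_pM2l//.
  exact: ltW.
by rewrite addrC => /le_trans; apply; rewrite lerD2l.
Qed.

(** The order of limits matters: for fixed [L], [d -> 0] removes [expR (4 * d * L) - 1] and the cost
    [B * (d / kappa)] of replacing [a + b] by [a]; only then [L] goes to infinity. The shift [b]
    leaves room for an exponent at which the moment is infinite. *)
Lemma esn_expRN_approx (kappa B a d0 : R) q : 0 < kappa -> 0 <= a -> 0 < d0 ->
  exp_seminorm kappa B q ->
  (forall d L, 0 < d -> d < d0 -> 0 < L -> exists2 b, 0 <= b <= d &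
    q (fun v => expR (- ((a + b) * v))) <=
      B * (expR (4 * d * L) - 1 + expR (- (kappa * L)))) ->
  q (fun v => expR (- (a * v))) <= 0.
Proof.
move=> kap0 a0 d00 qP qd; have kap0' := ltW kap0.
have B0 : 0 <= B := esn_bound_ge0 kap0' qP.
have de b : 0 <= b -> exp_dominated kappa (fun v => expR (- (b * v))).
  move=> b0; apply: (@exp_dominated_le _ _ 1); first exact: continuous_expRN.
  move=> v v0; rewrite ger0_norm ?expR_ge0// mul1r ler_expR.
  by rewrite (@le_trans _ _ 0)// ?oppr_le0 mulr_ge0.
have qL L : 0 < L -> q (fun v => expR (- (a * v))) <= B * expR (- (kappa * L)).
  move=> L0.
  have cf : B * (expR (4 * d * L) - 1 + expR (- (kappa * L))) + B * (d / kappa)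
      @[d --> 0^'+] --> B * (expR (4 * 0 * L) - 1 + expR (- (kappa * L))) + B * (0 / kappa).
    apply: cvg_at_right_filter; apply: cvgD.
      apply: cvgM; first exact: cvg_cst.
      apply: cvgD; last exact: cvg_cst.
      apply: cvgB; last exact: cvg_cst.
      apply: (@cvg_comp _ _ _ (fun d : R => 4 * d * L) expR); last exact: continuous_expR.
      apply: cvgM; last exact: cvg_cst.
      by apply: cvgM; [exact: cvg_cst|exact: cvg_id].
    apply: cvgM; first exact: cvg_cst.
    by apply: cvgM; [exact: cvg_id|exact: cvg_cst].
  rewrite mulr0 !mul0r expR0 subrr add0r mulr0 addr0 in cf.
  apply: (cvgr_to_ge cf); near=> d.
  have dp : 0 < d by near: d; exact: nbhs_right_gt.
  have dd : d < d0 by near: d; exact: nbhs_right_lt.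
  have [b /andP[b0 bd] qb] := qd d L dp dd L0.
  apply: (@le_trans _ _ (q (fun v => expR (- ((a + b) * v))) + B * (d / kappa))).
    apply: (esn_dist qP); [exact: de|by apply: de; rewrite addr_ge0|].
    move=> v v0; have bv0 : 0 <= b * v by rewrite mulr_ge0.
    rewrite mulrDl opprD expRD -[X in X - _]mulr1 -mulrBr normrM.
    have b1 : 0 <= 1 - expR (- (b * v)) by rewrite subr_ge0 -expR0 ler_expR oppr_le0.
    rewrite ger0_norm ?expR_ge0// ger0_norm//.
    apply: (@le_trans _ _ (1 - expR (- (b * v)))).
      by rewrite ler_piMl// -expR0 ler_expR oppr_le0 mulr_ge0.
    apply: (@le_trans _ _ (d * v)).
      by have := expR_ge1Dx (- (b * v)); have := ler_wpM2r v0 bd; lra.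
    by rewrite -mulrA ler_wpM2l ?(ltW dp)// le_mul_expR.
  by rewrite lerD2r.
have cL : B * expR (- (kappa * n%:R)) @[n --> \oo] --> B * 0.
  apply: cvgM; first exact: cvg_cst.
  rewrite (_ : (fun n => _) = (fun n => (expR (- kappa)) ^+ n)); last first.
    by apply/funext => n; rewrite -expRM_natl; congr expR; ring.
  apply: cvg_expr; rewrite ger0_norm ?expR_ge0//.
  by rewrite -expR0 ltr_expR oppr_lt0.
rewrite mulr0 in cL; apply: (cvgr_to_ge cL); near=> n.
apply: qL; rewrite ltr0n; near: n; exact: nbhs_infty_gt.
Unshelve. all: by end_near. Qed.

End RegularGrowth.

(** * Integrals of functions of independent variables *)

Section Independence.
Context d (T : measurableType d) (R : realType) (P : probability T R).
Implicit Types (U V : T -> R).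

Definition independent U V := forall A B : set R, measurable A -> measurable B ->
  P (U @^-1` A `&` V @^-1` B) = (P (U @^-1` A) * P (V @^-1` B))%E.

Lemma independent_comp U V (f g : R -> R) : measurable_fun setT f ->
  measurable_fun setT g -> independent U V -> independent (f \o U) (g \o V).
Proof.
move=> mf mg ind A B mA mB; apply: (ind (f @^-1` A) (g @^-1` B)).
  by rewrite -[X in measurable X]setTI; exact: mf.
by rewrite -[X in measurable X]setTI; exact: mg.
Qed.

(** Independence identifies the joint law with the product of the marginals on rectangles, hence
    everywhere; Tonelli then applies. *)
Lemma ge0_integral_independent U V (F : R * R -> \bar R) :
  measurable_fun setT U -> measurable_fun setT V -> independent U V ->
  measurable_fun setT F -> (forall z, 0 <= F z)%E ->
  (\int[P]_w F (U w, V w) = \int[P]_w \int[P]_w' F (U w, V w'))%E.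
Proof.
move=> mU mV ind mF F0.
pose U' : {mfun T >-> R} := HB.pack U (isMeasurableFun.Build _ _ _ _ U mU).
pose V' : {mfun T >-> R} := HB.pack V (isMeasurableFun.Build _ _ _ _ V mV).
have mUV : measurable_fun setT (fun w => (U w, V w)) by exact: measurable_fun_pair.
pose UV' : {mfun T >-> (R * R)%type} :=
  HB.pack (fun w => (U w, V w)) (isMeasurableFun.Build _ _ _ _ _ mUV).
have -> : (\int[P]_w F (U w, V w) = \int[distribution P UV']_z F z)%E.
  by rewrite ge0_integral_distribution.
have E A : measurable A ->
    (distribution P U' \x distribution P V')%E A = distribution P UV' A.
  apply: product_measure_unique => B C mB mC.
  by rewrite /distribution/= /pushforward/= -ind.
rewrite (eq_measure_integral (distribution P U' \x distribution P V')%E); last first.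
  by move=> A mA _; apply/esym; exact: E.
rewrite fubini_tonelli1//= ge0_integral_distribution//; last 2 first.
  - exact: measurable_fun_fubini_tonelli_F.
  - by move=> x; apply: integral_ge0 => y _.
apply: eq_integral => w _ /=; rewrite /fubini_F ge0_integral_distribution//.
exact: measurableT_comp.
Qed.

Lemma ge0_integralM_independent U V : measurable_fun setT U ->
  measurable_fun setT V -> independent U V ->
  (forall w, 0 <= U w) -> (forall w, 0 <= V w) ->
  (\int[P]_w (U w * V w)%:E = \int[P]_w (U w)%:E * \int[P]_w (V w)%:E)%E.
Proof.
move=> mU mV ind U0 V0.
(* Absolute values make the integrand nonnegative on the whole plane. *)
have := @ge0_integral_independent U V (fun z => (`|z.1| * `|z.2|)%:E) mU mV ind.
have mF : measurable_fun setT (fun z : R * R => (`|z.1| * `|z.2|)%:E).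
  by apply/measurable_EFinP; apply: measurable_funM; exact: measurableT_comp.
have -> : (\int[P]_w (U w * V w)%:E = \int[P]_w (`|(U w, V w).1| * `|(U w, V w).2|)%:E)%E.
  by apply: eq_integral => w _ /=; rewrite !ger0_norm.
move=> /(_ mF) ->; last by move=> z; rewrite lee_fin mulr_ge0.
have iV0 : (0 <= \int[P]_w (V w)%:E)%E by apply: integral_ge0 => w _; rewrite lee_fin.
transitivity (\int[P]_w ((U w)%:E * \int[P]_w' (V w')%:E))%E.
  apply: eq_integral => w _; rewrite -ge0_integralZl//.
  - by apply: eq_integral => w' _ /=; rewrite !ger0_norm.
  - exact/measurable_EFinP.
  - by move=> w' _; rewrite lee_fin.
  - by rewrite lee_fin.
rewrite ge0_integralZr//; first exact/measurable_EFinP.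
by move=> w _; rewrite lee_fin.
Qed.

Lemma independent_integrableM U V : measurable_fun setT U ->
  measurable_fun setT V -> independent U V ->
  P.-integrable setT (EFin \o U) -> P.-integrable setT (EFin \o V) ->
  P.-integrable setT (EFin \o (fun w => U w * V w)).
Proof.
move=> mU mV ind /integrableP[_ iU] /integrableP[_ iV]; apply/integrableP; split.
  by apply/measurable_EFinP; exact: measurable_funM.
under eq_integral => w _ do rewrite /= normrM.
have mn : measurable_fun setT (@Num.norm R R) by exact: normr_measurable.
rewrite (@ge0_integralM_independent (Num.norm \o U) (Num.norm \o V))//=; last 3 first.
- exact: measurableT_comp.
- exact: measurableT_comp.
- exact: independent_comp.
by apply: lte_mul_pinfty => //; [exact: integral_ge0|rewrite ge0_fin_numE//; exact: integral_ge0].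
Qed.

Lemma RintegralM_independent U V : measurable_fun setT U ->
  measurable_fun setT V -> independent U V ->
  P.-integrable setT (EFin \o U) -> P.-integrable setT (EFin \o V) ->
  \int[P]_w (U w * V w) = \int[P]_w U w * \int[P]_w V w.
Proof.
move=> mU mV ind iU iV.
have mp : measurable_fun setT (fun x : R => Num.max x 0).
  by apply: measurable_maxr => //; exact: measurable_cst.
have mm : measurable_fun setT (fun x : R => Num.max (- x) 0).
  by apply: measurable_maxr; [exact: oppr_measurable|exact: measurable_cst].
have ge0M U' V' : measurable_fun setT U' -> measurable_fun setT V' ->
    independent U' V' -> (forall w, 0 <= U' w) -> (forall w, 0 <= V' w) ->
    P.-integrable setT (EFin \o U') -> P.-integrable setT (EFin \o V') ->
    \int[P]_w (U' w * V' w) = \int[P]_w U' w * \int[P]_w V' w.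
  move=> mU' mV' ind' U0 V0 iU' iV'.
  by rewrite /Rintegral ge0_integralM_independent// fineM//; exact: integrable_fin_num.
have ip V' : P.-integrable setT (EFin \o V') ->
    P.-integrable setT (EFin \o (fun w => Num.max (V' w) 0)).
  by move=> iV'; exact: (integrable_funrpos measurableT iV').
have im V' : P.-integrable setT (EFin \o V') ->
    P.-integrable setT (EFin \o (fun w => Num.max (- V' w) 0)).
  by move=> iV'; exact: (integrable_funrneg measurableT iV').
have mxE (x : R) : x = Num.max x 0 - Num.max (- x) 0.
  by rewrite !maxr_absE !subr0 normrN !addr0; field.
pose Up w := Num.max (U w) 0; pose Um w := Num.max (- U w) 0.
pose Vp w := Num.max (V w) 0; pose Vm w := Num.max (- V w) 0.
have mUp : measurable_fun setT Up by exact: (measurableT_comp mp).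
have mUm : measurable_fun setT Um by exact: (measurableT_comp mm).
have mVp : measurable_fun setT Vp by exact: (measurableT_comp mp).
have mVm : measurable_fun setT Vm by exact: (measurableT_comp mm).
have p0 (x : R) : 0 <= Num.max x 0 by rewrite le_max lexx orbT.
have pp : independent Up Vp by exact: (independent_comp mp mp).
have pm : independent Up Vm by exact: (independent_comp mp mm).
have mp' : independent Um Vp by exact: (independent_comp mm mp).
have mm' : independent Um Vm by exact: (independent_comp mm mm).
have iUp := ip _ iU; have iUm := im _ iU; have iVp := ip _ iV; have iVm := im _ iV.
have -> : \int[P]_w U w = \int[P]_w Up w - \int[P]_w Um w.
  by rewrite -RintegralB//; apply: eq_Rintegral => w _; exact: mxE.
have -> : \int[P]_w V w = \int[P]_w Vp w - \int[P]_w Vm w.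
  by rewrite -RintegralB//; apply: eq_Rintegral => w _; exact: mxE.
have -> : \int[P]_w (U w * V w) =
    \int[P]_w (Up w * Vp w - Up w * Vm w - (Um w * Vp w - Um w * Vm w)).
  apply: eq_Rintegral => w _.
  by rewrite [in LHS](mxE (U w)) [in LHS](mxE (V w)) -/(Up w) -/(Um w) -/(Vp w) -/(Vm w); ring.
have I1 := independent_integrableM mUp mVp pp iUp iVp.
have I2 := independent_integrableM mUp mVm pm iUp iVm.
have I3 := independent_integrableM mUm mVp mp' iUm iVp.
have I4 := independent_integrableM mUm mVm mm' iUm iVm.
rewrite RintegralB//; last 2 first.
- exact: (integrableB measurableT I1 I2).
- exact: (integrableB measurableT I3 I4).
rewrite !RintegralB// !ge0M//; try by move=> w; exact: p0.
by ring.
Qed.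

(** Viewing [T] with the generated sigma-algebra lets the general closure results for measurable
    functions, products in particular, feed [independent_families]. *)
Lemma measurable_family (Z : nat -> {RV P >-> R}) (f : T -> R)
    (G := \bigcup_j preimage_set_system setT (Z j : T -> R) measurable) :
  measurable_fun (setT : set (g_sigma_algebraType G)) (f : g_sigma_algebraType G -> R) ->
  forall B, measurable B -> family_sigma_algebra Z (f @^-1` B).
Proof.
by move=> mf B mB; have := mf measurableT B mB; rewrite setTI.
Qed.

Lemma measurable_family_coord (Z : nat -> {RV P >-> R}) i
    (G := \bigcup_j preimage_set_system setT (Z j : T -> R) measurable) :
  measurable_fun (setT : set (g_sigma_algebraType G)) (Z i : g_sigma_algebraType G -> R).
Proof.
move=> _ B mB; apply: sub_gen_smallest; exists i => //=.
by exists B.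
Qed.

End Independence.

(** * Measurability of pointwise limits with a default value *)

Section MeasurableLimit.
Context d (T : measurableType d) (R : realType).

(** All quantifiers are countable, so the set of convergence is a countable combination of
    measurable sets. *)
Lemma cvgn_cauchyP (u : nat -> R) : cvgn u <->
  forall k, exists N, forall n, `|u (N + n)%N - u N| <= k.+1%:R^-1.
Proof.
split=> [cu k|cu].
  have e0 : 0 < (k.+1%:R^-1 / 2 : R) by rewrite divr_gt0.
  have /cvgrPdist_le/(_ _ e0)[N _ uN] := cu.
  exists N => n; rewrite (_ : _ - _ = (limn u - u N) - (limn u - u (N + n)%N)); last by ring.
  apply: (le_trans (ler_normB _ _)); rewrite [leRHS]splitr lerD//; apply: uN => /=//.
  exact: leq_addr.
apply: cauchy_cvg; apply: cauchy_exP => e e0.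
have [k _ ke] : exists2 k, True & k.+1%:R^-1 < e.
  exists (Num.trunc e^-1) => //; rewrite -[ltRHS]invrK ltf_pV2 ?posrE ?invr_gt0//.
  by have /andP[] := truncn_itv (ltW (etrans (invr_gt0 e) e0)).
have [N uN] := cu k; exists (u N); exists N => // n /= Nn.
rewrite /ball/= distrC; apply: le_lt_trans ke.
by have := uN (n - N)%N; rewrite subnKC.
Qed.

Lemma measurable_fun_limn (S : nat -> T -> R) :
  (forall n, measurable_fun setT (S n)) ->
  measurable_fun setT (fun w => limn (fun n => S n w)).
Proof.
move=> mS.
pose C := [set w | cvgn (fun n => S n w)].
have CE : C = \bigcap_k \bigcup_N \bigcap_n
    [set w | `|S (N + n)%N w - S N w| <= k.+1%:R^-1].
  apply/seteqP; split => w /=.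
    move=> /cvgn_cauchyP h k _; have [N hN] := h k.
    by exists N => // n _; exact: hN.
  move=> h; apply/cvgn_cauchyP => k; have [N _ hN] := h k I.
  by exists N => n; exact: hN.
have mC : measurable C.
  rewrite CE; apply: bigcap_measurable => // k _; apply: bigcup_measurable => N _.
  apply: bigcap_measurable => // n _; rewrite -[X in measurable X]setTI.
  apply: (@measurable_fun_ler _ _ _ setT (fun w => `|S (N + n)%N w - S N w|)
    (cst k.+1%:R^-1)) => //.
  by apply: measurableT_comp => //; exact: measurable_funB.
pose p : R := point.
(* Off [C] the sequence is frozen at [point], the value that [limn] takes on divergent sequences. *)
apply: (@measurable_fun_cvg _ _ _ _ (fun n w => if w \in C then S n w else p)).
  move=> n; apply: measurable_fun_ifT => //.
  by apply: (measurable_fun_bool true); rewrite setTI/= preimage_mem_true.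
move=> w _; have [wC|wC] := boolP (w \in C); first by move: wC; rewrite inE.
rewrite dvgP; first exact: cvg_cst.
by move/negP: wC; rewrite inE.
Qed.

End MeasurableLimit.

(** * Real-valued integrals *)

Section RealIntegrals.
Context d (T : measurableType d) (R : realType) (P : probability T R).
Implicit Types (f g : T -> R).

Definition Rintegrable f := P.-integrable setT (EFin \o f).

Lemma Rintegrable_measurable f : Rintegrable f -> measurable_fun setT f.
Proof. by move=> /integrableP[/measurable_EFinP]. Qed.

Lemma Rintegrable_le f g : measurable_fun setT f -> Rintegrable g ->
  (forall w, `|f w| <= g w) -> Rintegrable f.
Proof.
move=> mf ig fg; apply: le_integrable ig => //.
  exact/measurable_EFinP.
by move=> w _ /=; rewrite lee_fin (le_trans (fg w))// ler_norm.
Qed.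

Lemma RintegrableD f g : Rintegrable f -> Rintegrable g ->
  Rintegrable (fun w => f w + g w).
Proof. by move=> If Ig; exact: (integrableD measurableT If Ig). Qed.

Lemma RintegrableB f g : Rintegrable f -> Rintegrable g ->
  Rintegrable (fun w => f w - g w).
Proof. by move=> If Ig; exact: (integrableB measurableT If Ig). Qed.

Lemma RintegrableZ (a : R) f : Rintegrable f -> Rintegrable (fun w => a * f w).
Proof. by move=> If; exact: (integrableZl measurableT a If). Qed.

Lemma Rintegrable_cst (a : R) : Rintegrable (fun=> a).
Proof. by apply: finite_measure_integrable_cst. Qed.

Lemma Rintegrable_norm f : Rintegrable f -> Rintegrable (fun w => `|f w|).
Proof. by move=> If; exact: integrable_norm. Qed.

Lemma Rintegrable_bounded f (M : R) : measurable_fun setT f ->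
  (forall w, `|f w| <= M) -> Rintegrable f.
Proof. by move=> mf fM; apply: Rintegrable_le (Rintegrable_cst M) _. Qed.

Lemma Rintegral1 : \int[P]_w (1 : R) = 1.
Proof. by rewrite Rintegral_cst// mul1r; exact: (congr1 fine (probability_setT P)). Qed.

Lemma Rintegrable_sum n (h : nat -> T -> R) : (forall i, Rintegrable (h i)) ->
  Rintegrable (fun w => \sum_(0 <= i < n) h i w) /\
  \int[P]_w \sum_(0 <= i < n) h i w = \sum_(0 <= i < n) \int[P]_w h i w.
Proof.
move=> Ih; elim: n => [|n [IH1 IH2]].
  rewrite big_nil (_ : (fun w => _) = (fun=> 0)); last first.
    by apply/funext => w; rewrite big_nil.
  by split; [exact: Rintegrable_cst|rewrite Rintegral_cst// mul0r].
rewrite (_ : (fun w => _) = (fun w => \sum_(0 <= i < n) h i w + h n w)); last first.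
  by apply/funext => w; rewrite big_nat_recr.
split; first exact: RintegrableD.
by rewrite (RintegralD measurableT IH1 (Ih n)) IH2 big_nat_recr.
Qed.

Lemma ge0_Rintegrable f : measurable_fun setT f -> (forall w, 0 <= f w) ->
  (\int[P]_w (f w)%:E < +oo)%E -> Rintegrable f.
Proof.
move=> mf f0 If; apply/integrableP; split; first exact/measurable_EFinP.
by under eq_integral do rewrite /= ger0_norm//.
Qed.

Lemma RintegralE f : Rintegrable f -> (\int[P]_w (f w)%:E = (\int[P]_w f w)%:E)%E.
Proof. by move=> If; rewrite fineK//; exact: integrable_fin_num. Qed.

Lemma Rintegral_dominated (f_ : nat -> T -> R) f g :
  (forall n, measurable_fun setT (f_ n)) -> measurable_fun setT f ->
  Rintegrable g -> {ae P, forall w, f_ n w @[n --> \oo] --> f w} ->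
  {ae P, forall w, forall n, `|f_ n w| <= g w} ->
  Rintegrable f /\ \int[P]_w f_ n w @[n --> \oo] --> \int[P]_w f w.
Proof.
move=> mf_ mf Ig cf fg.
have [|||||If _ cI] := @dominated_convergence _ T R P setT measurableT
    (fun n => EFin \o f_ n) (EFin \o f) (EFin \o g) => //.
- by move=> n; exact/measurable_EFinP.
- exact/measurable_EFinP.
- by apply: filterS cf => w cw _; apply: cvg_EFin => //; exact: nearW.
- by apply: filterS fg => w fw n _; rewrite /= lee_fin.
by split=> //; apply: fine_cvg; have <- := RintegralE If; exact: cI.
Qed.

End RealIntegrals.

(** * One weight sequence: partial sums, quasi-additivity, domination, second moments *)

Section WeightedSums.
Context d (T : measurableType d) (R : realType) (P : probability T R).
Variables (W Xs : nat -> {RV P >-> R}) (X : {RV P >-> R}).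
Hypotheses (HW : subprobability_weights W) (HX : iid (seq_cons X Xs)).
Hypothesis HWX : independent_families (seq_cons X Xs) W.

Local Notation Rintegrable := (Rintegrable P).

Lemma weight_ge0 j w : 0 <= W j w. Proof. by have [] := HW w. Qed.

Lemma sum_weight_le1 n w : \sum_(0 <= j < n) W j w <= 1.
Proof.
have [W0] := HW w; rewrite -lee_fin -sumEFin; apply: le_trans.
by apply: nneseries_lim_ge => i _ _; rewrite lee_fin.
Qed.

Lemma weight_le1 j w : W j w <= 1.
Proof.
apply: le_trans (sum_weight_le1 j.+1 w); rewrite big_nat_recr//= lerDr.
by rewrite sumr_ge0// => i _; exact: weight_ge0.
Qed.

Lemma Rintegrable_weight j : Rintegrable (W j).
Proof.
by apply: (@Rintegrable_bounded _ _ _ _ _ 1) => // w; rewrite ger0_norm ?weight_ge0 ?weight_le1.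
Qed.

Lemma Rintegrable_weightM i j : Rintegrable (fun w => W i w * W j w).
Proof.
apply: (@Rintegrable_bounded _ _ _ _ _ 1); first exact: measurable_funM.
by move=> w; rewrite ger0_norm ?mulr_ge0 ?weight_ge0// mulr_ile1 ?weight_ge0 ?weight_le1.
Qed.

Lemma ge0_integral_iid (h : R -> \bar R) j : measurable_fun setT h ->
  (forall x, 0 <= h x)%E -> (\int[P]_w h (Xs j w) = \int[P]_w h (X w))%E.
Proof.
move=> mh h0.
have := @ge0_integral_distribution _ _ _ _ _ P (Xs j) h mh h0 => /= <-.
have := @ge0_integral_distribution _ _ _ _ _ P X h mh h0 => /= <-.
apply: eq_measure_integral => A mA _; have [_ hd] := HX.
exact: (hd j.+1 0%N A mA).
Qed.

Lemma independent_XX i j : i != j -> independent P (Xs i) (Xs j).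
Proof.
move=> ij A B mA mB; have [hi _] := HX.
have := hi [:: i.+1; j.+1] (fun n => if n == i.+1 then A else B).
rewrite !big_cons !big_nil/= eqxx eqSS [j == i]eq_sym (negbTE ij) setIT mule1.
apply; first by rewrite /= inE eqSS ij.
by move=> n; case: ifP.
Qed.

Let GX := \bigcup_j preimage_set_system setT (seq_cons X Xs j : T -> R) measurable.
Let GW := \bigcup_j preimage_set_system setT (W j : T -> R) measurable.

Lemma independent_families_functions (U V : T -> R) :
  measurable_fun (setT : set (g_sigma_algebraType GW)) (U : g_sigma_algebraType GW -> R) ->
  measurable_fun (setT : set (g_sigma_algebraType GX)) (V : g_sigma_algebraType GX -> R) ->
  independent P U V.
Proof.
move=> mU mV A B mA mB; rewrite setIC muleC; apply: HWX.
  exact: (measurable_family mV).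
exact: (measurable_family mU).
Qed.

Lemma measurable_WG i :
  measurable_fun (setT : set (g_sigma_algebraType GW)) (W i : g_sigma_algebraType GW -> R).
Proof. exact: measurable_family_coord. Qed.

Lemma measurable_XG i :
  measurable_fun (setT : set (g_sigma_algebraType GX)) (Xs i : g_sigma_algebraType GX -> R).
Proof.
by move=> _ B mB; apply: sub_gen_smallest; exists i.+1 => //=; exists B.
Qed.

Lemma independent_WX i j : independent P (W i) (Xs j).
Proof.
by apply: independent_families_functions; [exact: measurable_WG|exact: measurable_XG].
Qed.

Lemma independent_WWXX i j : independent P (fun w => W i w * W j w)
  (fun w => Xs i w * Xs j w).
Proof.
apply: independent_families_functions.
  by apply: measurable_funM; exact: measurable_WG.
by apply: measurable_funM; exact: measurable_XG.
Qed.

Hypothesis IX : Rintegrable X.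

Let mu := \int[P]_w `|X w|.

Lemma Rintegrable_X j : Rintegrable (Xs j).
Proof.
apply/integrableP; split; first exact/measurable_EFinP.
move/integrableP : IX => [_].
have := @ge0_integral_iid (fun x => `|x|%:E) j.
by move=> -> //; apply/measurable_EFinP; exact: normr_measurable.
Qed.

Lemma Rintegral_normX j : \int[P]_w `|Xs j w| = mu.
Proof.
congr fine; apply: (@ge0_integral_iid (fun x => `|x|%:E) j) => [|x].
  by apply/measurable_EFinP; exact: normr_measurable.
by rewrite lee_fin.
Qed.

Lemma absolute_moment_ge0 : 0 <= mu. Proof. exact: Rintegral_ge0. Qed.

Lemma Rintegral_WX i j : Rintegrable (fun w => W i w * `|Xs j w|) /\
  \int[P]_w (W i w * `|Xs j w|) = (\int[P]_w W i w) * mu.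
Proof.
have mn : measurable_fun setT (fun x : R => `|x|) by exact: normr_measurable.
have mX : measurable_fun setT (fun w => `|Xs j w|) by exact: measurableT_comp.
have ind : independent P (W i) (fun w => `|Xs j w|).
  exact: (@independent_comp _ _ _ _ _ _ id _ _ mn (independent_WX i j)).
have IXj := Rintegrable_norm (Rintegrable_X j).
split; first exact: (independent_integrableM _ _ ind (Rintegrable_weight i)).
by rewrite (RintegralM_independent _ _ ind (Rintegrable_weight i))// Rintegral_normX.
Qed.

Lemma Rintegral_WWXX i j : i != j ->
  Rintegrable (fun w => W i w * `|Xs i w| * (W j w * `|Xs j w|)) /\
  \int[P]_w (W i w * `|Xs i w| * (W j w * `|Xs j w|)) =
  (\int[P]_w (W i w * W j w)) * mu ^+ 2.
Proof.
move=> ij.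
have mn : measurable_fun setT (fun x : R => `|x|) by exact: normr_measurable.
have mX k : measurable_fun setT (fun w => `|Xs k w|) by exact: measurableT_comp.
have ind : independent P (fun w => W i w * W j w) (fun w => `|Xs i w * Xs j w|).
  exact: (@independent_comp _ _ _ _ _ _ id _ _ mn (independent_WWXX i j)).
have indX : independent P (fun w => `|Xs i w|) (fun w => `|Xs j w|).
  exact: (@independent_comp _ _ _ _ _ _ _ _ mn mn (independent_XX ij)).
have mXX : measurable_fun setT (fun w => `|Xs i w * Xs j w|).
  by apply: measurableT_comp => //; exact: measurable_funM.
have IXX : Rintegrable (fun w => `|Xs i w * Xs j w|).
  under [X in Rintegrable X]funext do rewrite normrM.
  by apply: independent_integrableM => //; exact/Rintegrable_norm/Rintegrable_X.
have EXX : \int[P]_w `|Xs i w * Xs j w| = mu ^+ 2.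
  under eq_Rintegral do rewrite normrM.
  rewrite RintegralM_independent ?Rintegral_normX//.
    exact/Rintegrable_norm/Rintegrable_X.
  exact/Rintegrable_norm/Rintegrable_X.
have -> : (fun w => W i w * `|Xs i w| * (W j w * `|Xs j w|)) =
    (fun w => W i w * W j w * `|Xs i w * Xs j w|).
  by apply/funext => w; rewrite normrM; ring.
have mWW : measurable_fun setT (fun w => W i w * W j w) by exact: measurable_funM.
have IWW := Rintegrable_weightM i j.
split; first exact: (independent_integrableM mWW mXX ind IWW IXX).
by rewrite (RintegralM_independent mWW mXX ind IWW IXX) EXX.
Qed.

Definition partial_sum n w := \sum_(0 <= j < n) W j w * Xs j w.
Definition partial_abs n w := \sum_(0 <= j < n) W j w * `|Xs j w|.

Lemma measurable_partial_sum n : measurable_fun setT (partial_sum n).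
Proof. by apply: measurable_sum => j; exact: measurable_funM. Qed.

Lemma partial_sum_le n w : `|partial_sum n w| <= partial_abs n w.
Proof.
apply: (le_trans (ler_norm_sum _ _ _)); apply: ler_sum => j _.
by rewrite normrM ger0_norm ?weight_ge0.
Qed.

Lemma Rintegral_partial_abs n : Rintegrable (partial_abs n) /\
  \int[P]_w partial_abs n w <= mu.
Proof.
have [I1 I2] := Rintegrable_sum n (fun j => (Rintegral_WX j j).1).
split=> //; rewrite /partial_abs I2.
under eq_bigr do rewrite (Rintegral_WX _ _).2.
have [J1 J2] := Rintegrable_sum n Rintegrable_weight.
rewrite -mulr_suml -J2 ler_piMl ?absolute_moment_ge0// -[leRHS](Rintegral1 P).
by apply: le_Rintegral => //; [exact: Rintegrable_cst|move=> w _; exact: sum_weight_le1].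
Qed.

Section QuasiAdditive.
Variables (G : R -> R) (Lam L : R).
Hypotheses (mG : measurable_fun setT G) (GLam : forall x, `|G x| <= Lam * `|x|).
Hypotheses (L0 : 0 <= L).
Hypothesis GL : forall s x, `|G (s + x) - G s - G x| <= L * ((1 + `|s|) * `|x|).

Let Lam0 : 0 <= Lam.
Proof. by have := GLam 1; rewrite normr1 mulr1; exact: le_trans. Qed.

Lemma Rintegrable_GWX j : Rintegrable (fun w => G (W j w * Xs j w)).
Proof.
apply: (@Rintegrable_le _ _ _ _ _ (fun w => Lam * (W j w * `|Xs j w|))).
- by apply: measurableT_comp => //; exact: measurable_funM.
- exact/RintegrableZ/(Rintegral_WX _ _).1.
- move=> w; apply: (le_trans (GLam _)).
  by rewrite normrM (ger0_norm (weight_ge0 _ _)).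
Qed.

Lemma Rintegrable_Gsum n : Rintegrable (fun w => G (partial_sum n w)).
Proof.
apply: (@Rintegrable_le _ _ _ _ _ (fun w => Lam * partial_abs n w)).
- by apply: measurableT_comp => //; exact: measurable_partial_sum.
- exact/RintegrableZ/(Rintegral_partial_abs _).1.
- move=> w; apply: (le_trans (GLam _)).
  by rewrite ler_wpM2l ?partial_sum_le.
Qed.

(** Majorant of [(1 + |s|) * |x|] when [s] is the [n]-th partial sum and [x] the next term. *)
Let cross n w := W n w * `|Xs n w| +
  \sum_(0 <= i < n) W i w * `|Xs i w| * (W n w * `|Xs n w|).

Let cross_integral n : Rintegrable (cross n) /\ \int[P]_w cross n w =
  (\int[P]_w W n w) * mu + (\int[P]_w (\sum_(0 <= i < n) W i w * W n w)) * mu ^+ 2.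
Proof.
have IW : forall i, Rintegrable (fun w => W i w * W n w).
  by move=> i; exact: Rintegrable_weightM.
have [_ ->] := Rintegrable_sum n IW.
(* The cut-off excludes the diagonal index, whose term would require a second moment of [X]. *)
pose h i := if (i < n)%N then fun w => W i w * `|Xs i w| * (W n w * `|Xs n w|)
  else fun=> 0.
have Ih i : Rintegrable (h i).
  rewrite /h; case: ifP => [i_n|_]; last exact: Rintegrable_cst.
  by apply: (Rintegral_WWXX _).1; rewrite ltn_eqF.
have [I1 I2] := Rintegrable_sum n Ih.
have hE : (fun w => \sum_(0 <= i < n) W i w * `|Xs i w| * (W n w * `|Xs n w|)) =
    (fun w => \sum_(0 <= i < n) h i w).
  by apply/funext => w; apply: eq_big_nat => i /andP[_ i_n]; rewrite /h i_n.
have [J1 J2] := Rintegral_WX n n.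
rewrite /cross; split; first by apply: RintegrableD => //; rewrite hE.
rewrite RintegralD//; last by rewrite hE.
rewrite J2; congr (_ + _); rewrite hE I2 mulr_suml.
apply: eq_big_nat => i /andP[_ i_n]; rewrite /h i_n.
by apply: (Rintegral_WWXX _).2; rewrite ltn_eqF.
Qed.

(** Each added term costs [L] times the mean of [cross]. Since the weights sum to at most 1, so do
    their products over pairs [i < j]; the costs therefore total at most [L * (mu + mu ^+ 2)],
    whatever [n] is. *)
Lemma quasi_additive_bound n :
  `|\int[P]_w G (partial_sum n w) - \sum_(0 <= j < n) \int[P]_w G (W j w * Xs j w)|
  <= L * (mu + mu ^+ 2).
Proof.
have G0 : G 0 = 0.
  by apply/eqP; rewrite -normr_le0; apply: (le_trans (GLam 0)); rewrite normr0 mulr0.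
have step m : `|\int[P]_w G (partial_sum m w) -
    \sum_(0 <= j < m) \int[P]_w G (W j w * Xs j w)| <=
    L * \sum_(0 <= j < m) \int[P]_w cross j w.
  elim: m => [|m IHm].
    rewrite !big_nil subr0 mulr0 (_ : (fun w => _) = (fun=> 0)); last first.
      by apply/funext => w; rewrite /partial_sum big_nil G0.
    by rewrite Rintegral_cst// mul0r normr0.
  rewrite !big_nat_recr//= mulrDr.
  set s := \sum_(0 <= j < m) \int[P]_w G (W j w * Xs j w) in IHm *.
  have -> : \int[P]_w G (partial_sum m.+1 w) - (s + \int[P]_w G (W m w * Xs m w)) =
      (\int[P]_w G (partial_sum m w) - s) +
      \int[P]_w (G (partial_sum m.+1 w) - G (partial_sum m w) - G (W m w * Xs m w)).
    rewrite RintegralB//; last 2 first.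
    - apply: RintegrableB; exact: Rintegrable_Gsum.
    - exact: Rintegrable_GWX.
    rewrite RintegralB//; [ring|exact: Rintegrable_Gsum|exact: Rintegrable_Gsum].
  apply: (le_trans (ler_normD _ _)); apply: lerD => //.
  have Idiff : Rintegrable (fun w =>
      G (partial_sum m.+1 w) - G (partial_sum m w) - G (W m w * Xs m w)).
    by apply: RintegrableB; [apply: RintegrableB; exact: Rintegrable_Gsum|
      exact: Rintegrable_GWX].
  apply: (le_trans (le_normr_Rintegral measurableT Idiff)).
  have [C1 C2] := cross_integral m.
  rewrite -RintegralZl//; apply: le_Rintegral => //.
  - exact: Rintegrable_norm.
  - exact: RintegrableZ.
  move=> w _; rewrite {1}/partial_sum big_nat_recr//=.
  apply: (le_trans (GL _ _)); rewrite ler_wpM2l// normrM (ger0_norm (weight_ge0 _ _)).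
  rewrite /cross mulrDl mul1r lerD2l -mulr_suml ler_wpM2r ?mulr_ge0 ?weight_ge0//.
  exact: partial_sum_le.
apply: (le_trans (step n)); rewrite ler_wpM2l//.
under eq_bigr do rewrite (cross_integral _).2.
rewrite big_split/= -!mulr_suml.
have [J1 J2] := Rintegrable_sum n Rintegrable_weight.
have [K1 K2] := Rintegrable_sum n (fun j =>
  (Rintegrable_sum j (fun i => Rintegrable_weightM i j)).1).
rewrite -J2 -K2 lerD//.
  rewrite ler_piMl ?absolute_moment_ge0// -[leRHS](Rintegral1 P).
  by apply: le_Rintegral => //; [exact: Rintegrable_cst|move=> w _; exact: sum_weight_le1].
rewrite ler_piMl ?exprn_ge0 ?absolute_moment_ge0// -[leRHS](Rintegral1 P).
apply: le_Rintegral => //; first exact: Rintegrable_cst.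
move=> w _; apply: le_trans (sum_weight_le1 n w); apply: ler_sum => j _.
by rewrite -mulr_suml ler_piMl ?weight_ge0// sum_weight_le1.
Qed.

End QuasiAdditive.

Lemma Rintegral_weight_function (a g : R -> R) i j : measurable_fun setT a ->
  measurable_fun setT g -> (forall x, 0 <= g x) ->
  Rintegrable (fun w => a (W i w)) -> Rintegrable (fun w => g (X w)) ->
  [/\ Rintegrable (fun w => g (Xs j w)), \int[P]_w g (Xs j w) = \int[P]_w g (X w),
      Rintegrable (fun w => a (W i w) * g (Xs j w)) &
      \int[P]_w (a (W i w) * g (Xs j w)) =
      (\int[P]_w a (W i w)) * \int[P]_w g (X w)].
Proof.
move=> ma mg g0 Ia IgX.
have mgX : measurable_fun setT (fun w => g (Xs j w)) by exact: measurableT_comp.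
have maW : measurable_fun setT (fun w => a (W i w)) by exact: measurableT_comp.
have eg : (\int[P]_w (g (Xs j w))%:E = \int[P]_w (g (X w))%:E)%E.
  by apply: (@ge0_integral_iid (EFin \o g)) => //; exact/measurable_EFinP.
have Ig : Rintegrable (fun w => g (Xs j w)).
  by apply: ge0_Rintegrable => //; rewrite eg (RintegralE IgX) ltry.
have ind : independent P (fun w => a (W i w)) (fun w => g (Xs j w)).
  exact: (independent_comp ma mg (independent_WX i j)).
have e1 : \int[P]_w g (Xs j w) = \int[P]_w g (X w) by rewrite /Rintegral eg.
split=> //; first exact: independent_integrableM.
by rewrite RintegralM_independent// e1.
Qed.

Lemma Rintegral_weighted_function (g : R -> R) n : measurable_fun setT g ->
  (forall x, 0 <= g x) -> Rintegrable (fun w => g (X w)) ->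
  [/\ Rintegrable (fun w => \sum_(0 <= j < n) W j w * g (Xs j w)) &
  \int[P]_w (\sum_(0 <= j < n) W j w * g (Xs j w)) <= \int[P]_w g (X w)].
Proof.
move=> mg g0 IgX.
have WG j := Rintegral_weight_function j (@measurable_id _ _ setT) mg g0 (Rintegrable_weight j) IgX.
have [I1 ->] := @Rintegrable_sum _ _ _ P n (fun j w => W j w * g (Xs j w))
  (fun j => let: And4 _ _ H _ := WG j in H).
split => //.
have -> : \sum_(0 <= j < n) \int[P]_w (W j w * g (Xs j w)) =
    (\sum_(0 <= j < n) \int[P]_w W j w) * \int[P]_w g (X w).
  by rewrite mulr_suml; apply: eq_bigr => j _; have [_ _ _] := WG j.
have [J1 J2] := Rintegrable_sum n Rintegrable_weight.
rewrite -J2 ler_piMl ?Rintegral_ge0// -[leRHS](Rintegral1 P).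
by apply: le_Rintegral => //; [exact: Rintegrable_cst|move=> w _; exact: sum_weight_le1].
Qed.

(** The full series has mean at most [E g(X)], hence is almost everywhere finite; its finite part
    dominates all partial sums at once. *)
Lemma weighted_function_dominated (g : R -> R) : measurable_fun setT g ->
  (forall x, 0 <= g x) -> Rintegrable (fun w => g (X w)) ->
  exists A : T -> R, Rintegrable A /\
    {ae P, forall w, forall n, \sum_(0 <= j < n) W j w * g (Xs j w) <= A w}.
Proof.
move=> mg g0 IgX.
pose Ae w := (\sum_(0 <= j <oo) (W j w * g (Xs j w))%:E)%E.
have me j : measurable_fun setT (fun w => (W j w * g (Xs j w))%:E).
  by apply/measurable_EFinP; apply: measurable_funM => //; exact: measurableT_comp.
have e0 j w : (0 <= (W j w * g (Xs j w))%:E)%E.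
  by rewrite lee_fin mulr_ge0 ?weight_ge0.
have mAe : measurable_fun setT Ae by exact: ge0_emeasurable_sum.
have Ae0 w : (0 <= Ae w)%E by exact: nneseries_ge0.
have IAe : (\int[P]_w Ae w <= (\int[P]_w g (X w))%:E)%E.
  rewrite /Ae integral_nneseries//; apply: lime_le.
    by apply: is_cvg_nneseries => n _ _; exact: integral_ge0.
  apply: nearW => n; rewrite -ge0_integral_sum//.
  have [I1 I2] := Rintegral_weighted_function n mg g0 IgX.
  rewrite (_ : (\int[P]_w _)%E = (\int[P]_w \sum_(0 <= j < n) W j w * g (Xs j w))%:E).
    by rewrite lee_fin.
  rewrite -RintegralE//; apply: eq_integral => w _.
  by rewrite sumEFin.
have IAe' : P.-integrable setT Ae.
  apply/integrableP; split => //.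
  under eq_integral do rewrite gee0_abs//.
  exact: le_lt_trans IAe (ltry _).
exists (fine \o Ae); split.
  apply: ge0_Rintegrable; first exact: measurableT_comp.
    by move=> w; exact: fine_ge0.
  apply: le_lt_trans (le_lt_trans IAe (ltry _)).
  apply: ge0_le_integral => //.
  - by move=> w _; rewrite lee_fin fine_ge0.
  - by apply/measurable_EFinP; exact: measurableT_comp.
  - move=> w _ /=; have := Ae0 w; case: (Ae w) => //= _; exact: leey.
have := integrable_ae measurableT IAe'; apply: filterS => w /(_ I) fA n.
rewrite -lee_fin /= fineK// -sumEFin.
exact: nneseries_lim_ge.
Qed.

Lemma ae_partial_sum_cvg :
  {ae P, forall w, partial_sum n w @[n --> \oo] --> weighted_sum W Xs w}.
Proof.
have mn : measurable_fun setT (fun x : R => `|x|) by exact: normr_measurable.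
have [A [_]] := weighted_function_dominated mn (fun x => normr_ge0 x) (Rintegrable_norm IX).
apply: filterS => w hA; have : cvgn (series (fun j => W j w * Xs j w)).
  apply: normed_cvg; apply: nondecreasing_is_cvgn.
    by apply: nondecreasing_series => i _ _ /=.
  exists (A w) => _ [n _ <-]; apply: le_trans (hA n).
  rewrite /series/=; apply: ler_sum => j _.
  by rewrite normrM ger0_norm ?weight_ge0.
by move=> /cvg_ex[l cl]; rewrite /weighted_sum; apply/cvg_ex; exists l.
Qed.

Lemma measurable_weighted_sum : measurable_fun setT (weighted_sum W Xs).
Proof. exact/measurable_fun_limn/measurable_partial_sum. Qed.

Lemma Rintegral_weighted_sum_cvg (G g : R -> R) : continuous G ->
  measurable_fun setT g -> (forall x, 0 <= g x) -> Rintegrable (fun w => g (X w)) ->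
  (forall n w, `|G (partial_sum n w)| <= \sum_(0 <= j < n) W j w * g (Xs j w)) ->
  Rintegrable (fun w => G (weighted_sum W Xs w)) /\
  \int[P]_w G (partial_sum n w) @[n --> \oo] --> \int[P]_w G (weighted_sum W Xs w).
Proof.
move=> cG mg g0 IgX Gg.
have [A [IA hA]] := weighted_function_dominated mg g0 IgX.
have mG : measurable_fun setT G by exact: continuous_measurable_fun.
apply: (Rintegral_dominated _ _ IA).
- by move=> n; apply: measurableT_comp => //; exact: measurable_partial_sum.
- by apply: measurableT_comp => //; exact: measurable_weighted_sum.
- by apply: filterS ae_partial_sum_cvg => w; apply: continuous_cvg; exact: cG.
- by apply: filterS hA => w hw n; exact: le_trans (Gg n w) (hw n).
Qed.

Lemma Rintegral_le_weighted_sum (G g : R -> R) : continuous G ->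
  measurable_fun setT g -> (forall x, 0 <= g x) -> Rintegrable (fun w => g (X w)) ->
  (forall n w, `|G (partial_sum n w)| <= \sum_(0 <= j < n) W j w * g (Xs j w)) ->
  Rintegrable (fun w => G (weighted_sum W Xs w)) /\
  \int[P]_w G (weighted_sum W Xs w) <= \int[P]_w g (X w).
Proof.
move=> cG mg g0 IgX Gg.
have [I1 cI] := Rintegral_weighted_sum_cvg cG mg g0 IgX Gg.
split=> //; apply: (cvgr_to_le cI); apply: nearW => n.
have [J1 J2] := Rintegral_weighted_function n mg g0 IgX.
have mG : measurable_fun setT G by exact: continuous_measurable_fun.
apply: le_trans J2; apply: le_Rintegral => //.
  apply: Rintegrable_le J1 (Gg n).
  by apply: measurableT_comp => //; exact: measurable_partial_sum.
by move=> w _; apply: le_trans (Gg n w); exact: ler_norm.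
Qed.

(** Convexity: with total mass at most 1 and [u >= 0], [sum W |X| - u <= sum W (|X| - u)]. The bound
    does not depend on the weights, which makes the family [R_t] uniformly integrable. *)
Lemma Rintegral_hinge_weighted_sum (u : R) : 0 <= u ->
  Rintegrable (fun w => hinge u (weighted_sum W Xs w)) /\
  \int[P]_w hinge u (weighted_sum W Xs w) <= \int[P]_w hinge u (X w).
Proof.
move=> u0; have ch := lipschitz_continuous (hinge_lipschitz u).
have mh : measurable_fun setT (hinge u) by exact: continuous_measurable_fun.
apply: (@Rintegral_le_weighted_sum (hinge u) (hinge u)) => //.
- exact: hinge_ge0.
- apply: Rintegrable_le (Rintegrable_norm IX) _; first exact: measurableT_comp.
  by move=> w; rewrite ger0_norm ?hinge_ge0// hinge_le.
move=> n w; rewrite ger0_norm ?hinge_ge0// ge_max; apply/andP; split; last first.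
  by rewrite sumr_ge0// => j _; rewrite mulr_ge0 ?hinge_ge0 ?weight_ge0.
apply: (@le_trans _ _ (\sum_(0 <= j < n) W j w * (`|Xs j w| - u))); last first.
  by apply: ler_sum => j _; rewrite ler_wpM2l ?weight_ge0// le_max lexx.
under eq_bigr do rewrite mulrBr.
rewrite big_split/= sumrN -mulr_suml lerB//; first exact: partial_sum_le.
by rewrite ler_piMl// sum_weight_le1.
Qed.

Lemma Rintegral_norm_weighted_sum (c : R) :
  (forall n, \sum_(0 <= j < n) \int[P]_w W j w <= c) ->
  Rintegrable (fun w => `|weighted_sum W Xs w|) /\
  \int[P]_w `|weighted_sum W Xs w| <= mu * c.
Proof.
move=> Wc.
have mn : measurable_fun setT (fun x : R => `|x|) by exact: normr_measurable.
have cn : continuous (fun x : R => `|x|) by exact: norm_continuous.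
have le n w : `| `|partial_sum n w| | <= \sum_(0 <= j < n) W j w * `|Xs j w|.
  by rewrite normr_id; exact: partial_sum_le.
have [I1 cI] := Rintegral_weighted_sum_cvg cn mn (fun x => normr_ge0 x) (Rintegrable_norm IX) le.
split=> //; apply: (cvgr_to_le cI); apply: nearW => n.
have [J1 J2] := Rintegrable_sum n (fun j => (Rintegral_WX j j).1).
apply: (@le_trans _ _ (\int[P]_w partial_abs n w)).
  apply: le_Rintegral => //.
    apply: Rintegrable_le J1 _ => [|w].
      by apply: measurableT_comp => //; exact: measurable_partial_sum.
    by rewrite normr_id; exact: partial_sum_le.
  by move=> w _; exact: partial_sum_le.
rewrite J2; under eq_bigr do rewrite (Rintegral_WX _ _).2.
by rewrite -mulr_suml mulrC ler_wpM2l// absolute_moment_ge0.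
Qed.

(** The function [f_G] of the overview: a weight [w = e^-v] times its value at [v] is the mean of
    [G (w X)]. *)
Definition scaled_mean (G : R -> R) (v : R) := expR v * \int[P]_w G (expR (- v) * X w).

Lemma Rintegral_scaled_mean (G : R -> R) (Lam : R) j : continuous G ->
  (forall x, 0 <= G x) -> (forall x, `|G x| <= Lam * `|x|) ->
  \int[P]_w G (W j w * Xs j w) = \int[P]_w (W j w * scaled_mean G (- ln (W j w))).
Proof.
move=> cG G0 GLam.
have mG : measurable_fun setT G by exact: continuous_measurable_fun.
have G00 : G 0 = 0.
  by apply/eqP; rewrite -normr_le0; apply: (le_trans (GLam 0)); rewrite normr0 mulr0.
have mF : measurable_fun setT (fun z : R * R => (G (z.1 * z.2))%:E).
  apply/measurable_EFinP; apply: measurableT_comp => //.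
  by apply: measurable_funM.
have IG y : Rintegrable (fun w => G (y * X w)).
  apply: (@Rintegrable_le _ _ _ _ _ (fun w => Lam * `|y| * `|X w|)).
  - by apply: measurableT_comp => //; exact: measurable_funM.
  - exact/RintegrableZ/Rintegrable_norm.
  - by move=> w; apply: (le_trans (GLam _)); rewrite normrM mulrA.
rewrite /Rintegral; congr fine.
rewrite (@ge0_integral_independent _ _ _ _ _ _ _ _ _ (independent_WX j j) mF)//; last first.
  by move=> z; rewrite lee_fin.
apply: eq_integral => w _ /=.
rewrite (@ge0_integral_iid (fun x => (G (W j w * x))%:E))//; last 2 first.
- apply/measurable_EFinP; apply: measurableT_comp => //.
- by move=> x; rewrite lee_fin.
rewrite RintegralE//; congr EFin.
(* At a zero weight both sides vanish, whatever the default value of [ln 0]. *)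
have [W0|W0] := leP (W j w) 0.
  have -> : W j w = 0 by apply/eqP; rewrite eq_le W0 weight_ge0.
  rewrite mul0r; under eq_Rintegral do rewrite mul0r G00.
  by rewrite Rintegral_cst// mul0r.
by rewrite /scaled_mean opprK mulrA expRN lnK ?posrE// mulfV ?gt_eqF// mul1r.
Qed.

Lemma weighted_sum_scaled_mean (G : R -> R) (Lam L : R) : continuous G ->
  (forall x, 0 <= G x) -> (forall x, `|G x| <= Lam * `|x|) -> 0 <= L ->
  (forall s x, `|G (s + x) - G s - G x| <= L * ((1 + `|s|) * `|x|)) ->
  `|\int[P]_w G (weighted_sum W Xs w) - limn (series
     (fun j => \int[P]_w (W j w * scaled_mean G (- ln (W j w)))))| <=
  L * (mu + mu ^+ 2).
Proof.
move=> cG G0 GLam L0 GL.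
have mG : measurable_fun setT G by exact: continuous_measurable_fun.
have Lam0 : 0 <= Lam by have := GLam 1; rewrite normr1 mulr1; exact: le_trans.
have mn : measurable_fun setT (fun x : R => Lam * `|x|).
  by apply: measurable_funM => //; exact: normr_measurable.
have nn (x : R) : 0 <= Lam * `|x| by rewrite mulr_ge0.
have le n w : `|G (partial_sum n w)| <= \sum_(0 <= j < n) W j w * (Lam * `|Xs j w|).
  apply: (le_trans (GLam _)); apply: (le_trans (ler_wpM2l Lam0 (partial_sum_le n w))).
  by rewrite mulr_sumr; apply: ler_sum => j _; rewrite mulrCA.
have [I1 cI] := Rintegral_weighted_sum_cvg cG mn nn (RintegrableZ Lam (Rintegrable_norm IX)) le.
pose a j := \int[P]_w (W j w * scaled_mean G (- ln (W j w))).
rewrite -/a.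
have aE n : series a n = \sum_(0 <= j < n) \int[P]_w G (W j w * Xs j w).
  by rewrite /series/=; apply: eq_bigr => j _; rewrite (Rintegral_scaled_mean _ cG G0 GLam).
have Q n := quasi_additive_bound mG GLam L0 GL n.
(* The terms are nonnegative and the partial sums stay within a fixed distance of a convergent
   sequence. *)
have ca : cvgn (series a).
  apply: nondecreasing_is_cvgn.
    apply: nondecreasing_series => j _ _.
    by rewrite /a -(Rintegral_scaled_mean _ cG G0 GLam) Rintegral_ge0.
  have [M [_ hM]] := cvg_seq_bounded (cvgP _ cI).
  have MM1 : M < M + 1 by rewrite ltrDl.
  have hM1 := hM (M + 1) MM1.
  exists (M + 1 + L * (mu + mu ^+ 2)) => _ [n _ <-]; rewrite aE.
  have := Q n; rewrite ler_norml => /andP[q1 _].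
  have q2 := le_trans (ler_norm _) (hM1 n I); lra.
have cd : `|\int[P]_w G (partial_sum n w) - series a n| @[n --> \oo] -->
    `|\int[P]_w G (weighted_sum W Xs w) - limn (series a)|.
  by apply: cvg_norm; exact: cvgB.
by apply: (cvgr_to_le cd); apply: nearW => n; rewrite aE.
Qed.

Lemma Rintegral_X j : \int[P]_w Xs j w = \int[P]_w X w.
Proof.
congr fine.
have := @integral_distribution _ _ _ _ _ P (Xs j) EFin (@EFin_measurable _ setT) (Rintegrable_X j).
have := @integral_distribution _ _ _ _ _ P X EFin (@EFin_measurable _ setT) IX.
move=> /= <- <-; apply: eq_measure_integral => A mA _; have [_ hd] := HX.
exact: (hd j.+1 0%N A mA).
Qed.

Lemma Rintegral_WWXX_centered i j : \int[P]_w X w = 0 -> i != j ->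
  Rintegrable (fun w => W i w * Xs i w * (W j w * Xs j w)) /\
  \int[P]_w (W i w * Xs i w * (W j w * Xs j w)) = 0.
Proof.
move=> EX0 ij.
have IXX : Rintegrable (fun w => Xs i w * Xs j w).
  by apply: independent_integrableM; [| |exact: independent_XX|exact: Rintegrable_X..].
have EXX : \int[P]_w (Xs i w * Xs j w) = 0.
  rewrite RintegralM_independent//; last 3 first.
  - exact: independent_XX.
  - exact: Rintegrable_X.
  - exact: Rintegrable_X.
  by rewrite !Rintegral_X EX0 mulr0.
have -> : (fun w => W i w * Xs i w * (W j w * Xs j w)) =
    (fun w => W i w * W j w * (Xs i w * Xs j w)).
  by apply/funext => w; ring.
have mWW : measurable_fun setT (fun w => W i w * W j w) by exact: measurable_funM.
have mXX : measurable_fun setT (fun w => Xs i w * Xs j w) by exact: measurable_funM.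
have IWW := Rintegrable_weightM i j.
have ind := independent_WWXX i j.
split; first exact: (independent_integrableM mWW mXX ind IWW IXX).
by rewrite (RintegralM_independent mWW mXX ind IWW IXX) EXX mulr0.
Qed.

(** Jensen for total mass at most 1, by expanding [0 <= sum W_j (X_j - s)^2] around [s], the partial
    sum itself. *)
Lemma partial_sum_sqr_le n w :
  partial_sum n w ^+ 2 <= \sum_(0 <= j < n) W j w * Xs j w ^+ 2.
Proof.
set s := partial_sum n w; set A := \sum_(0 <= j < n) W j w * Xs j w ^+ 2.
have : 0 <= \sum_(0 <= j < n) W j w * (Xs j w - s) ^+ 2.
  by rewrite sumr_ge0// => j _; rewrite mulr_ge0 ?weight_ge0 ?sqr_ge0.
have -> : \sum_(0 <= j < n) W j w * (Xs j w - s) ^+ 2 =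
    A + - (2 * s) * s + s ^+ 2 * \sum_(0 <= j < n) W j w.
  rewrite {3}/s /partial_sum mulr_sumr [in X in _ + X]mulr_sumr -!big_split/=.
  by apply: eq_bigr => j _; rewrite -/s; ring.
have := ler_wpM2l (sqr_ge0 s) (sum_weight_le1 n w); lra.
Qed.

Lemma Rintegral_partial_sum_sqr n : \int[P]_w X w = 0 ->
  Rintegrable (fun w => X w ^+ 2) ->
  Rintegrable (fun w => partial_sum n w ^+ 2) /\
  \int[P]_w partial_sum n w ^+ 2 =
    (\int[P]_w X w ^+ 2) * \sum_(0 <= j < n) \int[P]_w W j w ^+ 2.
Proof.
move=> EX0 IX2.
have msq : measurable_fun setT (fun x : R => x ^+ 2).
  by apply: continuous_measurable_fun; exact: exprn_continuous.
have IW2 j : Rintegrable (fun w => W j w ^+ 2) by exact: Rintegrable_weightM.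
have WX2 j := Rintegral_weight_function j msq msq (fun x => sqr_ge0 x) (IW2 j) IX2.
elim: n => [|n [IH1 IH2]].
  rewrite big_nil mulr0 (_ : (fun w => _) = (fun=> 0)); last first.
    by apply/funext => w; rewrite /partial_sum big_nil expr0n.
  by split; [exact: Rintegrable_cst|rewrite Rintegral_cst// mul0r].
have [_ _ I1 E1] := WX2 n.
(* Only genuine cross terms, each of mean 0; the diagonal term is integrated separately through
   [E X^2]. *)
pose h i := if (i < n)%N then fun w => W i w * Xs i w * (W n w * Xs n w)
  else fun=> 0.
have Ih i : Rintegrable (h i) /\ \int[P]_w h i w = 0.
  rewrite /h; case: ifP => [i_n|_]; last first.
    by split; [exact: Rintegrable_cst|rewrite Rintegral_cst// mul0r].
  by apply: Rintegral_WWXX_centered => //; rewrite ltn_eqF.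
have [J1 J2] := Rintegrable_sum n (fun i => (Ih i).1).
have hE w : partial_sum n w * (W n w * Xs n w) = \sum_(0 <= i < n) h i w.
  by rewrite /partial_sum mulr_suml; apply: eq_big_nat => i /andP[_ i_n]; rewrite /h i_n.
have -> : (fun w => partial_sum n.+1 w ^+ 2) = (fun w => partial_sum n w ^+ 2 +
    2 * (\sum_(0 <= i < n) h i w) + W n w ^+ 2 * Xs n w ^+ 2).
  by apply/funext => w; rewrite -hE /partial_sum big_nat_recr//=; ring.
have J3 := RintegrableZ 2 J1; have J4 := RintegrableD IH1 J3.
split; first exact: RintegrableD.
rewrite (RintegralD measurableT J4 I1) (RintegralD measurableT IH1 J3) IH2 E1.
have J0 : \sum_(0 <= i < n) \int[P]_w h i w = 0 by apply: big1 => i _; have [] := Ih i.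
rewrite (RintegralZl 2 measurableT J1) J2 J0 mulr0 addr0.
by rewrite big_nat_recr//=; ring.
Qed.

(** The last clause is uniform integrability of [R_t^2], by the same convexity as for hinges. *)
Lemma Rintegral_square_weighted_sum : \int[P]_w X w = 0 ->
  Rintegrable (fun w => X w ^+ 2) ->
  [/\ Rintegrable (fun w => weighted_sum W Xs w ^+ 2),
      (\int[P]_w X w ^+ 2) * \sum_(0 <= j < n) \int[P]_w W j w ^+ 2
        @[n --> \oo] --> \int[P]_w weighted_sum W Xs w ^+ 2 &
      forall u, 0 <= u -> \int[P]_w Num.max (weighted_sum W Xs w ^+ 2 - u) 0 <=
                \int[P]_w Num.max (X w ^+ 2 - u) 0].
Proof.
move=> EX0 IX2.
have sq : continuous (fun x : R => x ^+ 2) by exact: exprn_continuous.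
have msq : measurable_fun setT (fun x : R => x ^+ 2) by exact: continuous_measurable_fun.
have le1 n w : `|partial_sum n w ^+ 2| <= \sum_(0 <= j < n) W j w * Xs j w ^+ 2.
  by rewrite ger0_norm ?sqr_ge0// partial_sum_sqr_le.
have [I1 cI] := Rintegral_weighted_sum_cvg sq msq (fun x => sqr_ge0 x) IX2 le1.
split => //.
  by under eq_fun do rewrite -(Rintegral_partial_sum_sqr _ EX0 IX2).2.
move=> u u0; pose g (x : R) := Num.max (x ^+ 2 - u) 0.
have cg : continuous g.
  rewrite /g (_ : (fun x : R => _) = (fun x => (x ^+ 2 - u + 0 + `|x ^+ 2 - u - 0|) / 2)).
    move=> x; apply: cvgM; last exact: cvg_cst.
    have c1 : x0 ^+ 2 - u @[x0 --> x] --> x ^+ 2 - u.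
      by apply: cvgB; [exact: sq|exact: cvg_cst].
    apply: cvgD; first by apply: cvgD; [exact: c1|exact: cvg_cst].
    by apply: cvg_norm; apply: cvgB; [exact: c1|exact: cvg_cst].
  by apply/funext => x; rewrite maxr_absE.
have g0 x : 0 <= g x by rewrite le_max lexx orbT.
have mg : measurable_fun setT g by exact: continuous_measurable_fun.
apply: (Rintegral_le_weighted_sum cg mg g0 _ _).2.
- apply: Rintegrable_le IX2 _; first exact: measurableT_comp.
  by move=> w; rewrite ger0_norm// ge_max sqr_ge0 andbT; lra.
- move=> n w; rewrite ger0_norm// ge_max; apply/andP; split; last first.
    by rewrite sumr_ge0// => j _; rewrite mulr_ge0 ?weight_ge0.
  apply: (@le_trans _ _ (\sum_(0 <= j < n) W j w * (Xs j w ^+ 2 - u))); last first.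
    by apply: ler_sum => j _; rewrite ler_wpM2l ?weight_ge0// le_max lexx.
  under eq_bigr do rewrite mulrBr.
  rewrite big_split/= sumrN -mulr_suml lerB ?partial_sum_sqr_le//.
  by rewrite ler_piMl// sum_weight_le1.
Qed.

(** The map from [y] to the mean of [G (y X)] is Lipschitz with constant [Lam * mu] and vanishes at
    0, so at [y = e^-v] it compensates the factor [e^v]. *)
Lemma scaled_mean_dominated (G : R -> R) (Lam kappa : R) : 0 <= kappa ->
  G 0 = 0 -> (forall a b, `|G a - G b| <= Lam * `|a - b|) ->
  exp_dominated kappa (scaled_mean G).
Proof.
move=> kap0 G0 GL; have cG := lipschitz_continuous GL.
have mG : measurable_fun setT G by exact: continuous_measurable_fun.
have GLam x : `|G x| <= Lam * `|x| by have := GL x 0; rewrite G0 !subr0.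
have IG y : Rintegrable (fun w => G (y * X w)).
  apply: (@Rintegrable_le _ _ _ _ _ (fun w => Lam * `|y| * `|X w|)).
  - by apply: measurableT_comp => //; exact: measurable_funM.
  - exact/RintegrableZ/Rintegrable_norm.
  - by move=> w; apply: (le_trans (GLam _)); rewrite normrM mulrA.
have lip y z : `|\int[P]_w G (y * X w) - \int[P]_w G (z * X w)| <= Lam * mu * `|y - z|.
  rewrite -(RintegralB measurableT (IG y) (IG z)).
  apply: (le_trans (le_normr_Rintegral measurableT (RintegrableB (IG y) (IG z)))).
  rewrite (_ : Lam * mu * `|y - z| = \int[P]_w (Lam * `|y - z| * `|X w|)); last first.
    by rewrite RintegralZl//; [rewrite -/mu; ring|exact: Rintegrable_norm].
  apply: le_Rintegral => //.
  - exact/Rintegrable_norm/RintegrableB.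
  - exact/RintegrableZ/Rintegrable_norm.
  - by move=> w _; apply: (le_trans (GL _ _)); rewrite -mulrBl normrM mulrA.
apply: (@exp_dominated_le _ _ (Lam * mu)).
  move=> v; apply: cvgM; first exact: continuous_expR.
  apply: (@continuous_comp _ _ _ (fun v => expR (- v)) (fun y => \int[P]_w G (y * X w))).
    apply: (@continuous_comp _ _ _ (fun v => - v) expR); last exact: continuous_expR.
    by apply: cvgN; exact: cvg_id.
  exact: (lipschitz_continuous lip).
move=> v v0; rewrite /scaled_mean normrM (ger0_norm (expR_ge0 _)).
have := lip (expR (- v)) 0.
rewrite [X in `|_ - X|](_ : _ = 0); last first.
  under eq_Rintegral do rewrite mul0r G0.
  by rewrite Rintegral_cst// mul0r.
rewrite !subr0 (ger0_norm (expR_ge0 _)) => h.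
apply: (le_trans (ler_wpM2l (expR_ge0 v) h)).
rewrite mulrCA -expRD addrN expR0 mulr1 ler_peMr//.
  by have := le_trans (normr_ge0 _) (lip 1 0); rewrite subr0 normr1 mulr1.
by rewrite -expR0 ler_expR mulr_ge0.
Qed.

End WeightedSums.

(** * The functional [m_t] for one weight sequence *)

Section WeightFunctional.
Context d (T : measurableType d) (R : realType) (P : probability T R).
Variables (W : nat -> {RV P >-> R}).
Hypotheses (HW : subprobability_weights W).

Local Notation Rintegrable := (Rintegrable P).

(* [W j] is parametrised as [expR (- v)]; where [W j] vanishes, [ln 0 = 0] is
   harmless because of the factor [W j]. *)
Definition weight_functional (f : R -> R) :=
  limn (series (fun j => \int[P]_w (W j w * f (- ln (W j w))))).

Lemma measurable_weight_powR s j : measurable_fun setT (fun w => W j w `^ s).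
Proof.
apply: (@measurableT_comp _ _ _ _ _ _ (fun x => x `^ s) _ (W j)) => //.
Qed.

Lemma Rintegrable_weight_powR s j : 0 <= s -> Rintegrable (fun w => W j w `^ s).
Proof.
move=> s0; apply: (@Rintegrable_bounded _ _ _ _ _ 1).
  exact: measurable_weight_powR.
move=> w; rewrite ger0_norm ?powR_ge0//; have -> : (1 : R) = 1 `^ s by rewrite powR1.
by apply: ge0_ler_powR => //; rewrite ?nnegrE ?(weight_ge0 HW) ?(weight_le1 HW).
Qed.

Lemma weight_momentE s : 0 < s ->
  (weight_moment W s = \sum_(0 <= j <oo) (\int[P]_w W j w `^ s)%:E)%E.
Proof.
move=> s0; rewrite /weight_moment.
transitivity (\int[P]_w \sum_(0 <= j <oo) (W j w `^ s)%:E)%E.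
  apply: eq_integral => w _; rewrite eseries_mkcond; apply: eq_eseriesr => j _.
  by case: eqP => //= ->; rewrite powR0 ?gt_eqF.
rewrite integral_nneseries//.
- by apply: eq_eseriesr => j _; rewrite RintegralE//; exact/Rintegrable_weight_powR/ltW.
- move=> j; apply/measurable_EFinP; exact: measurable_weight_powR.
- by move=> j w _; rewrite lee_fin powR_ge0.
Qed.

Lemma weight_moment_series s (M : R) : 0 < s -> (weight_moment W s <= M%:E)%E ->
  forall n, \sum_(0 <= j < n) \int[P]_w W j w `^ s <= M.
Proof.
move=> s0; rewrite weight_momentE// => h n; rewrite -lee_fin -sumEFin.
apply: le_trans h; apply: nneseries_lim_ge => j _ _.
by rewrite lee_fin Rintegral_ge0// => w _; exact: powR_ge0.
Qed.

Section Dominated.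
Variables (kappa M : R).
Hypotheses (kappa_gt0 : 0 < kappa) (kappa_lt1 : kappa < 1).
Hypothesis HM : forall n, \sum_(0 <= j < n) \int[P]_w W j w `^ (1 - kappa) <= M.

Lemma weight_functional_term (f : R -> R) j : continuous f ->
  measurable_fun setT (fun w => W j w * f (- ln (W j w))).
Proof.
move=> cf; apply: measurable_funM => //.
apply: measurableT_comp; first exact: continuous_measurable_fun.
by apply: measurable_funN; apply: measurableT_comp => //; exact: measurable_ln.
Qed.

(** For [v = - ln w], [w * e^(kappa v)] is [w^(1 - kappa)]: this ties the growth rate of the class
    to the order of the bounded moment. *)
Lemma weight_functional_le (f : R -> R) (b : R) j w :
  (forall v : R, 0 <= v -> `|f v| <= b * expR (kappa * v)) ->
  `|W j w * f (- ln (W j w))| <= b * W j w `^ (1 - kappa).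
Proof.
move=> fb; have W0 := weight_ge0 HW j w; have W1 := weight_le1 HW j w.
have b0 : 0 <= b.
  by have := fb _ (lexx 0); rewrite mulr0 expR0 mulr1; exact: le_trans.
rewrite normrM (ger0_norm W0).
move: W0; rewrite le_eqVlt => /predU1P[<-|W0]; first by rewrite mul0r mulr_ge0 ?powR_ge0.
have l0 : 0 <= - ln (W j w) by rewrite oppr_ge0 ln_le0.
apply: (le_trans (ler_wpM2l (ltW W0) (fb _ l0))).
rewrite mulrCA ler_wpM2l// /powR gt_eqF// mulrBl mul1r expRD lnK ?posrE//.
by rewrite mulrN.
Qed.

Lemma Rintegrable_weight_functional f j : exp_dominated kappa f ->
  Rintegrable (fun w => W j w * f (- ln (W j w))).
Proof.
move=> [cf [b fb]].
apply: (@Rintegrable_le _ _ _ _ _ (fun w => b * W j w `^ (1 - kappa))).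
- exact: weight_functional_term.
- by apply/RintegrableZ/Rintegrable_weight_powR; rewrite subr_ge0 ltW.
- by move=> w; exact: weight_functional_le.
Qed.

Lemma weight_functional_bound (f : R -> R) (b : R) : continuous f ->
  (forall v : R, 0 <= v -> `|f v| <= b * expR (kappa * v)) ->
  cvgn (series (fun j => \int[P]_w (W j w * f (- ln (W j w))))) /\
  `|weight_functional f| <= M * b.
Proof.
move=> cf fb; set a := fun j => _.
have b0 : 0 <= b.
  by have := fb _ (lexx 0); rewrite mulr0 expR0 mulr1; exact: le_trans.
have df : exp_dominated kappa f by split => //; exists b.
have k0 : 0 <= 1 - kappa by rewrite subr_ge0 ltW.
have ab j : `|a j| <= b * \int[P]_w W j w `^ (1 - kappa).
  have If := Rintegrable_weight_functional j df.
  apply: (le_trans (le_normr_Rintegral measurableT If)).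
  rewrite -RintegralZl//; last exact: Rintegrable_weight_powR.
  apply: le_Rintegral => //; first exact: Rintegrable_norm.
    exact/RintegrableZ/Rintegrable_weight_powR.
  by move=> w _; exact: weight_functional_le.
have sb n : \sum_(0 <= j < n) `|a j| <= M * b.
  apply: (@le_trans _ _ (\sum_(0 <= j < n) b * \int[P]_w W j w `^ (1 - kappa))).
    by apply: ler_sum => j _.
  by rewrite -mulr_sumr mulrC ler_wpM2r.
have ca : cvgn (series a).
  apply: normed_cvg; apply: nondecreasing_is_cvgn.
    by apply: nondecreasing_series => i _ _ /=.
  by exists (M * b) => _ [n _ <-]; exact: sb.
split=> //.
have cn : `|series a n| @[n --> \oo] --> `|weight_functional f| by exact: cvg_norm.
apply: (cvgr_to_le cn); apply: nearW => n.
by apply: le_trans (sb n); exact: ler_norm_sum.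
Qed.

Lemma weight_functionalD f g : exp_dominated kappa f -> exp_dominated kappa g ->
  weight_functional (fun v => f v + g v) = weight_functional f + weight_functional g.
Proof.
move=> df dg; have [cf [b fb]] := df; have [cg [c gc]] := dg.
have [c1 _] := weight_functional_bound cf fb.
have [c2 _] := weight_functional_bound cg gc.
apply/cvg_lim => //; have cc := cvgD c1 c2.
move: cc; set a := series _; set a' := series _; set a'' := series _.
move=> cc; suff -> : a'' = a + a' by exact: cc.
apply/funext => n; change (a'' n = a n + a' n).
rewrite /a /a' /a'' /series/= -big_split/=; apply: eq_bigr => j _.
rewrite -RintegralD//; last 2 first.
- exact: Rintegrable_weight_functional.
- exact: Rintegrable_weight_functional.
by apply: eq_Rintegral => w _; rewrite mulrDr.
Qed.

Lemma weight_functionalZ a f : exp_dominated kappa f ->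
  weight_functional (fun v => a * f v) = a * weight_functional f.
Proof.
move=> df; have [cf [b fb]] := df.
have [c1 _] := weight_functional_bound cf fb.
apply/cvg_lim => //; have cc := cvgM (cvg_cst a) c1.
move: cc; set u := series _; set u' := series _.
move=> cc; suff -> : u' = (fun n => a * u n) by exact: cc.
apply/funext => n.
rewrite /u /u' /series/= mulr_sumr; apply: eq_bigr => j _.
rewrite -RintegralZl//; last exact: Rintegrable_weight_functional.
by apply: eq_Rintegral => w _; rewrite mulrCA.
Qed.

(** For [s >= 1] the exponential is bounded by 1 on [v >= 0], hence lies in the class and its series
    converges to a real number. The limit form serves the comparison of [m_t(2)] with [E R_t^2]. *)
Lemma weight_moment_functional s : 1 <= s ->
  (weight_moment W s = (weight_functional (fun v => expR (- ((s - 1) * v))))%:E)%E /\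
  weight_functional (fun v => expR (- ((s - 1) * v))) =
    limn (series (fun j => \int[P]_w W j w `^ s)).
Proof.
move=> s1; have s0 : 0 < s by exact: lt_le_trans s1.
have term j : \int[P]_w (W j w * expR (- ((s - 1) * - ln (W j w)))) =
    \int[P]_w W j w `^ s.
  apply: eq_Rintegral => w _.
  have := weight_ge0 HW j w; rewrite le_eqVlt => /predU1P[<-|W0].
    by rewrite mul0r powR0// gt_eqF.
  have {1}<- : expR (ln (W j w)) = W j w by rewrite lnK// posrE.
  rewrite mulrN opprK -expRD /powR gt_eqF//.
  by congr expR; ring.
have E : weight_functional (fun v => expR (- ((s - 1) * v))) =
    limn (series (fun j => \int[P]_w W j w `^ s)).
  by congr (limn (series _)); apply/funext => j; exact: term.
split=> //; rewrite E weight_momentE//.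
have ce := @continuous_expRN R (s - 1).
have be v : 0 <= v -> `|expR (- ((s - 1) * v))| <= 1 * expR (kappa * v).
  move=> v0; rewrite ger0_norm ?expR_ge0// mul1r ler_expR.
  rewrite (@le_trans _ _ 0)// ?oppr_le0 mulr_ge0 ?subr_ge0//; exact: ltW.
have [c1 _] := weight_functional_bound ce be.
rewrite (_ : (fun j => _) = (fun j => \int[P]_w W j w `^ s)) in c1; last first.
  by apply/funext => j; exact: term.
rewrite -EFin_lim//; congr (limn _); apply/funext => n.
by rewrite /series/= sumEFin.
Qed.

End Dominated.

Lemma weight_moment_le1 s : 1 <= s -> (0 <= weight_moment W s <= 1)%E.
Proof.
move=> s1; rewrite /weight_moment; apply/andP; split.
  by apply: integral_ge0 => w _; apply: nneseries_ge0 => j _ _; rewrite lee_fin powR_ge0.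
have s0 : 0 < s by exact: lt_le_trans s1.
rewrite -/(weight_moment W s) weight_momentE//.
apply: lime_le.
  apply: is_cvg_nneseries => j _ _.
  by rewrite lee_fin Rintegral_ge0// => w _; exact: powR_ge0.
apply: nearW => n; rewrite sumEFin lee_fin.
have [J1 J2] := Rintegrable_sum n (Rintegrable_weight HW).
apply: (@le_trans _ _ (\sum_(0 <= j < n) \int[P]_w W j w)).
  apply: ler_sum => j _; apply: le_Rintegral => //.
  - exact/Rintegrable_weight_powR/ltW.
  - exact: Rintegrable_weight.
  move=> w _; have := weight_ge0 HW j w; rewrite le_eqVlt => /predU1P[<-|W0].
    by rewrite powR0// gt_eqF.
  by apply: ge1r_powR => //; rewrite W0 (weight_le1 HW).
rewrite -J2 -[leRHS](Rintegral1 P); apply: le_Rintegral => //.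
  exact: Rintegrable_cst.
by move=> w _; exact: (sum_weight_le1 HW).
Qed.

End WeightFunctional.

(** * The functions [k] and [g] built from the law of [X] *)

Section TailFunctions.
Context d (T : measurableType d) (R : realType) (P : probability T R).
Variable X : {RV P >-> R}.

Local Notation Rintegrable := (Rintegrable P).

Lemma measurable_hinge (u : R) : measurable_fun setT (hinge u).
Proof. by apply: continuous_measurable_fun; exact: lipschitz_continuous (hinge_lipschitz u). Qed.

Lemma Rintegral_hinge_cvg0 (f : T -> R) (e : R) : Rintegrable f -> 0 < e ->
  exists2 n : nat, (0 < n)%N & \int[P]_w hinge n%:R (f w) <= e.
Proof.
move=> If e0; have mf := Rintegrable_measurable If.
have mh (n : nat) : measurable_fun setT (fun w => hinge n%:R (f w)).
  by apply: measurableT_comp => //; exact: measurable_hinge.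
have c0 : {ae P, forall w, hinge n%:R (f w) @[n --> \oo] --> (0 : R)}.
  apply: aeW => w; apply: cvg_near_cst; near=> n.
  rewrite /hinge max_r// subr_le0; near: n; exact: nbhs_infty_ger.
have d0 : {ae P, forall w (n : nat), `|hinge n%:R (f w)| <= `|f w|}.
  by apply: aeW => w n; rewrite ger0_norm ?hinge_ge0// hinge_le.
have [_] := Rintegral_dominated mh (measurable_cst _) (Rintegrable_norm If) c0 d0.
rewrite Rintegral_cst// mul0r.
move=> /cvgrPdist_le/(_ _ e0)[N _ hN].
(* A positive level, so that its logarithm can serve as [tau]. *)
exists N.+1 => //; have := hN N.+1 (leqnSn N).
by rewrite sub0r normrN => /(le_trans (ler_norm _)).
Unshelve. all: by end_near. Qed.

Lemma measurable_abs_powR (s : R) : measurable_fun setT (fun w => `|X w| `^ s).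
Proof.
apply: (@measurableT_comp _ _ _ _ _ _ (fun x => x `^ s) _ (fun w => `|X w|)) => //.
exact: measurableT_comp.
Qed.

Hypothesis IX : Rintegrable X.

Definition tail_mean (tau : R) := \int[P]_w hinge (expR tau) (X w).

Definition growth_mean (p tau : R) := \int[P]_w truncated_power p (expR tau) (X w).

Lemma hinge_scale (u v x : R) :
  expR v * hinge u (expR (- v) * x) = hinge (u * expR v) x.
Proof.
rewrite /hinge maxr_pMr ?expR_ge0// mulr0 normrM (ger0_norm (expR_ge0 _)).
by rewrite mulrBr mulrA -expRD addrN expR0 mul1r [u * _]mulrC.
Qed.

Lemma Rintegrable_hinge (u : R) : 0 <= u -> Rintegrable (fun w => hinge u (X w)).
Proof.
move=> u0; apply: Rintegrable_le (Rintegrable_norm IX) _.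
  by apply: measurableT_comp => //; exact: measurable_hinge.
by move=> w; rewrite ger0_norm ?hinge_ge0// hinge_le.
Qed.

Lemma scaled_mean_hinge (tau v : R) :
  scaled_mean X (hinge (expR tau)) v = tail_mean (tau + v).
Proof.
rewrite /scaled_mean -RintegralZl//; last first.
  apply: (@Rintegrable_le _ _ _ _ _ (fun w => expR (- v) * `|X w|)).
  - apply: measurableT_comp; first exact: measurable_hinge.
    exact: measurable_funM.
  - exact/RintegrableZ/Rintegrable_norm.
  - move=> w; rewrite ger0_norm ?hinge_ge0//.
    by apply: (le_trans (hinge_le _ (expR_ge0 _))); rewrite normrM ger0_norm ?expR_ge0.
by apply: eq_Rintegral => w _; rewrite hinge_scale -expRD.
Qed.

Lemma tail_mean_ge0 tau : 0 <= tail_mean tau.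
Proof. by apply: Rintegral_ge0 => w _; exact: hinge_ge0. Qed.

Lemma tail_mean_homo : {homo tail_mean : x y / x <= y >-> y <= x}.
Proof.
move=> x y xy; apply: le_Rintegral => //.
- exact: Rintegrable_hinge (expR_ge0 _).
- exact: Rintegrable_hinge (expR_ge0 _).
move=> w _; rewrite /hinge ge_max; apply/andP; split; last exact: hinge_ge0.
by rewrite le_max lerD2l lerN2 ler_expR xy.
Qed.

(** Obtained from the scaled mean of the hinge at level 1, whose continuity is already known. *)
Lemma continuous_tail_mean : continuous tail_mean.
Proof.
have h0 : hinge (expR 0) 0 = 0 :> R.
  by rewrite /hinge normr0 sub0r max_r// oppr_le0 expR_ge0.
have [c _] := scaled_mean_dominated IX (lexx 0) h0 (hinge_lipschitz (expR 0)).
have <- : scaled_mean X (hinge (expR 0)) = tail_mean.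
  by apply/funext => v; rewrite scaled_mean_hinge add0r.
exact: c.
Qed.

Lemma tail_mean_cvg0 e : 0 < e -> exists2 tau, 0 <= tau & tail_mean tau <= e.
Proof.
move=> e0; have [n n0 ne] := Rintegral_hinge_cvg0 IX e0.
exists (ln n%:R); first by rewrite ln_ge0// ler1n.
by rewrite /tail_mean lnK// posrE ltr0n.
Qed.

Section Growth.
Variable p : R.
Hypotheses (p_gt0 : 0 < p) (p_le1 : p <= 1).

Lemma measurable_truncated_power (u : R) : 0 < u ->
  measurable_fun setT (truncated_power p u).
Proof.
move=> u0; apply: continuous_measurable_fun.
by apply: (@lipschitz_continuous _ _ (2 * u `^ p)) => a b; exact: truncated_power_lipschitz.
Qed.

Lemma Rintegrable_truncated_power (u : R) : 0 < u ->
  Rintegrable (fun w => truncated_power p u (X w)).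
Proof.
move=> u0; apply: Rintegrable_le (RintegrableZ (2 * u `^ p) (Rintegrable_norm IX)) _.
  by apply: measurableT_comp => //; exact: measurable_truncated_power.
move=> w; have := truncated_power_lipschitz (X w) 0 p_gt0 p_le1 u0.
by rewrite truncated_power0 !subr0.
Qed.

Lemma scaled_mean_truncated_power (tau v : R) :
  scaled_mean X (truncated_power p (expR tau)) v =
  expR (- (p * v)) * growth_mean p (tau + v).
Proof.
rewrite /scaled_mean.
under eq_Rintegral do rewrite (truncated_power_scale _ _ _ (expR_ge0 _)) -expRD.
rewrite RintegralZl//; last exact: Rintegrable_truncated_power (expR_gt0 _).
by rewrite mulrA -expRD; congr (expR _ * _); ring.
Qed.

Lemma growth_mean_homo : {homo growth_mean p : x y / x <= y}.
Proof.
move=> x y xy; apply: (le_Rintegral measurableT).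
- exact: Rintegrable_truncated_power (expR_gt0 _).
- exact: Rintegrable_truncated_power (expR_gt0 _).
by move=> w _; apply: truncated_power_homo; rewrite ?(ltW p_gt0) ?expR_ge0 ?ler_expR.
Qed.

Lemma growth_mean_shift tau v : 0 <= v ->
  growth_mean p (tau + v) <= expR (p * v) * growth_mean p tau.
Proof.
move=> v0; rewrite -RintegralZl//; last exact: Rintegrable_truncated_power (expR_gt0 _).
apply: (le_Rintegral measurableT).
- exact: Rintegrable_truncated_power (expR_gt0 _).
- exact: RintegrableZ (Rintegrable_truncated_power (expR_gt0 _)).
by move=> w _; rewrite expRD; apply: truncated_power_growth; rewrite ?(ltW p_gt0) ?expR_ge0.
Qed.

Lemma continuous_growth_mean : continuous (growth_mean p).
Proof.
have [c _] := scaled_mean_dominated IX (lexx 0) (truncated_power0 p (expR 0))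
  (fun a b => truncated_power_lipschitz a b p_gt0 p_le1 (expR_gt0 0)).
have -> : growth_mean p =
    (fun v => expR (p * v) * scaled_mean X (truncated_power p (expR 0)) v).
  apply/funext => v; rewrite scaled_mean_truncated_power add0r mulrA -expRD.
  by rewrite addrN expR0 mul1r.
move=> x; apply: cvgM; last exact: c.
apply: (@continuous_comp _ _ _ (fun v => p * v) expR).
  by apply: cvgM; [exact: cvg_cst|exact: cvg_id].
exact: continuous_expR.
Qed.

Lemma growth_mean_le_expR eta tau : 0 <= eta -> eta <= p ->
  Rintegrable (fun w => `|X w| `^ (1 + p - eta)) ->
  growth_mean p tau <= (\int[P]_w `|X w| `^ (1 + p - eta)) * expR (eta * tau).
Proof.
move=> e0 ep Ip; rewrite mulrC -(RintegralZl _ measurableT Ip).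
apply: (le_Rintegral measurableT).
- exact: Rintegrable_truncated_power (expR_gt0 _).
- exact: RintegrableZ.
by move=> w _; rewrite mulrC; exact: truncated_power_le_expR.
Qed.

(** Monotone convergence along the cutoffs [n + 1]: a uniform bound would make the full power
    integrable. *)
Lemma growth_mean_unbounded : ~ Rintegrable (fun w => `|X w| `^ (1 + p)) ->
  forall N, exists2 tau, 0 <= tau & N <= growth_mean p tau.
Proof.
move=> nI N; apply: contrapT => /forall2NP h; apply: nI.
have {}h n : growth_mean p (ln n.+1%:R) <= N.
  have [|/negP] := h (ln n.+1%:R); first by rewrite ln_ge0// ler1n.
  by rewrite -ltNge => /ltW.
have e n : expR (ln n.+1%:R) = n.+1%:R :> R by rewrite lnK// posrE.
apply: ge0_Rintegrable; first exact: measurable_abs_powR.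
  by move=> w; exact: powR_ge0.
have mt n : measurable_fun setT (fun w => (truncated_power p n.+1%:R (X w))%:E).
  apply/measurable_EFinP; apply: measurableT_comp => //.
  exact: measurable_truncated_power.
have t0 n w : (0 <= (truncated_power p n.+1%:R (X w))%:E)%E.
  by rewrite lee_fin truncated_power_ge0.
rewrite (_ : \int[P]_w _ = limn (fun n => \int[P]_w (truncated_power p n.+1%:R (X w))%:E))%E.
  apply: (@le_lt_trans _ _ N%:E); last exact: ltry.
  apply: lime_le.
    apply: ereal_nondecreasing_is_cvgn => n m nm; apply: ge0_le_integral => //.
    move=> w _; rewrite lee_fin; apply: truncated_power_homo; rewrite ?(ltW p_gt0)//.
    by rewrite ler_nat ltnS.
  apply: nearW => n; have := h n; rewrite /growth_mean e => hn.
  by rewrite RintegralE ?lee_fin//; exact: Rintegrable_truncated_power.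
rewrite -monotone_convergence//; last first.
  move=> w _ n m nm; rewrite lee_fin; apply: truncated_power_homo; rewrite ?(ltW p_gt0)//.
  by rewrite ler_nat ltnS.
apply: eq_integral => w _; apply/esym/cvg_lim => //.
apply: cvg_near_cst; near=> n; congr EFin.
have xn : `|X w| <= n.+1%:R.
  apply: (@le_trans _ _ n%:R); last by rewrite ler_nat.
  by near: n; exact: nbhs_infty_ger.
rewrite /truncated_power min_l//.
have [->|x0] := eqVneq `|X w| 0; first by rewrite mul0r powR0// gt_eqF// addr_gt0.
by rewrite powRD ?powRr1// x0 implybT.
Unshelve. all: by end_near. Qed.

End Growth.

(* Dyadic decomposition: [|x|^(1+c)] is dominated by a series of hinges at [2^n]. *)
Lemma tail_mean_integrable (b c A : R) : 0 < c -> c < b ->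
  (forall tau, 0 <= tau -> tail_mean tau <= A * expR (- b * tau)) ->
  Rintegrable (fun w => `|X w| `^ (1 + c)).
Proof.
move=> c0 cb hA; have b0 : 0 < b by exact: lt_trans cb.
pose s n : R := 2 ^+ n.
have s0 n : 0 < s n by rewrite exprn_gt0.
pose a n w := (2 * (4 * s n) `^ c * hinge (s n) (X w))%:E.
have a0 n w : (0 <= a n w)%E by rewrite lee_fin !mulr_ge0 ?powR_ge0 ?hinge_ge0.
have ma n : measurable_fun setT (a n).
  apply/measurable_EFinP; apply: measurable_funM => //.
  by apply: measurableT_comp => //; exact: measurable_hinge.
have dom w : ((`|X w| `^ (1 + c))%:E <= (2 `^ (1 + c))%:E + \sum_(0 <= n <oo) a n w)%E.
  have [x2|x2] := leP `|X w| 2.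
    apply: (@le_trans _ _ (2 `^ (1 + c))%:E); last by rewrite leeDl// nneseries_ge0.
    by rewrite lee_fin; apply: ge0_ler_powR; rewrite ?nnegrE// addr_ge0// ltW.
  (* The lower bound gives [|x| <= 2 (|x| - s n)], the upper one [|x|^c <= (4 s n)^c]; a single term
     of the series then suffices. The index is minimal for the upper bound. *)
  have [n [sn ns]] : exists n, 2 * s n <= `|X w| /\ `|X w| <= 4 * s n.
    have ex : exists n, `|X w| <= 4 * s n.
      exists (Num.trunc `|X w|).+1.
      have /andP[_ /ltW xt] := truncn_itv (normr_ge0 (X w)).
      apply: (le_trans xt); apply: (@le_trans _ _ (s (Num.trunc `|X w|).+1)).
        by rewrite /s -natrX ler_nat ltnW// ltn_expl.
      by rewrite ler_peMl ?(ltW (s0 _))// ler1n.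
    have := ex_minnP ex => -[[|n] hn mn].
      by exists 0%N; rewrite hn /s expr0 mulr1 ltW.
    exists n.+1; split => //; rewrite leNgt; apply/negP => lt.
    have := mn n; rewrite ltnn => /(_ _)/negP; apply => //.
    by apply: ltW; move: lt; rewrite /s exprS; lra.
  apply: (@le_trans _ _ (a n w)).
    rewrite lee_fin; have x0 : 0 < `|X w| by exact: lt_trans x2.
    rewrite powRD; last by rewrite (gt_eqF x0) implybT.
    rewrite powRr1// [leRHS]mulrAC; apply: ler_pM; rewrite ?powR_ge0//.
      apply: (@le_trans _ _ (2 * (`|X w| - s n))); last by rewrite ler_wpM2l// le_max lexx.
      lra.
    by apply: ge0_ler_powR; rewrite ?nnegrE ?(ltW c0)// mulr_ge0// ltW.
  have : (a n w <= \sum_(0 <= n <oo) a n w)%E.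
    apply: (@le_trans _ _ (\sum_(0 <= i < n.+1) a i w)%E).
      by rewrite big_nat_recr//= leeDr// sume_ge0.
    exact: nneseries_lim_ge.
  by move/le_trans; apply; rewrite leeDr// lee_fin powR_ge0.
(* At [tau = ln (2^n)] the tail is at most [A 2^(-b n)], against a prefactor of order [2^(c n)]: a
   geometric series, as [c < b]. *)
have ia n : (\int[P]_w a n w <= (2 * 4 `^ c * A * (2 `^ (c - b)) ^+ n)%:E)%E.
  have Ih := RintegrableZ (2 * (4 * s n) `^ c) (Rintegrable_hinge (ltW (s0 n))).
  rewrite /a RintegralE// lee_fin RintegralZl//; last exact: Rintegrable_hinge (ltW (s0 n)).
  have hs : \int[P]_w hinge (s n) (X w) <= A * expR (- b * ln (s n)).
    have := hA (ln (s n)); rewrite /tail_mean lnK ?posrE//; apply.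
    by rewrite ln_ge0// exprn_ege1// ler1n.
  have c4 : 0 <= 2 * (4 * s n) `^ c by rewrite mulr_ge0 ?powR_ge0.
  apply: (le_trans (ler_wpM2l c4 hs)).
  rewrite powRM// ?(ltW (s0 n))//.
  have -> : s n `^ c = expR (c * ln (s n)) by rewrite /powR gt_eqF.
  have -> : (2 `^ (c - b)) ^+ n = expR (c * ln (s n)) * expR (- b * ln (s n)) :> R.
    rewrite -expRD -mulrDl /powR pnatr_eq0/= -expRM_natl /s lnXn//.
    by rewrite -mulr_natl; congr expR; ring.
  rewrite le_eqVlt; apply/orP; left; apply/eqP; ring.
apply: ge0_Rintegrable; first exact: measurable_abs_powR.
  by move=> w; exact: powR_ge0.
pose z : R := 2 `^ (c - b).
have z0 : 0 <= z by exact: powR_ge0.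
have z1 : z < 1.
  have l2 : 0 < ln (2 : R) by rewrite ln_gt0// ltr1n.
  by rewrite /z /powR pnatr_eq0/= -[ltRHS]expR0 ltr_expR pmulr_llt0// subr_lt0.
have A0 : 0 <= A.
  by have := hA 0 (lexx 0); rewrite mulr0 expR0 mulr1; exact: le_trans (tail_mean_ge0 0).
have isum : (\int[P]_w \sum_(0 <= n <oo) a n w <= (2 * 4 `^ c * A / (1 - z))%:E)%E.
  rewrite integral_nneseries//; apply: lime_le.
    by apply: is_cvg_nneseries => n _ _; exact: integral_ge0.
  apply: nearW => n; apply: (@le_trans _ _ (\sum_(0 <= i < n) (2 * 4 `^ c * A * z ^+ i)%:E)%E).
    by apply: lee_sum => i _; exact: ia.
  rewrite sumEFin lee_fin -mulr_sumr ler_wpM2l ?mulr_ge0 ?powR_ge0//.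
  rewrite big_mkord -[leRHS]mul1r ler_pdivlMr ?subr_gt0// mulrC.
  have := subrX1 z n => /(congr1 -%R); rewrite opprB -mulNr opprB => <-.
  by rewrite lerBlDr lerDl exprn_ge0.
apply: (@le_lt_trans _ _ (\int[P]_w ((2 `^ (1 + c))%:E + \sum_(0 <= n <oo) a n w))%E).
  apply: ge0_le_integral => //.
  - by apply/measurable_EFinP; exact: measurable_abs_powR.
  - by apply: emeasurable_funD => //; exact: ge0_emeasurable_sum.
rewrite ge0_integralD//; last 2 first.
- by move=> w _; exact: nneseries_ge0.
- exact: ge0_emeasurable_sum.
rewrite lte_add_pinfty//; last exact: le_lt_trans isum (ltry _).
rewrite integral_cst// lte_mul_pinfty ?lee_fin ?powR_ge0//.
by rewrite (le_lt_trans (probability_le1 _ _)) ?ltry.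
Qed.

End TailFunctions.

(** * Oscillation of a function along a filter *)

Section Oscillation.
Context {R : realType} (F : set_system R) {FF : ProperFilter F}.
Implicit Types (a b : R -> R) (c : R).

Definition osc_le a c := exists2 A, F A & forall t u, A t -> A u -> `|a t - a u| <= c.

(** A real infimum, with default 0 when the set is empty. A small value is therefore informative
    only together with some witness [osc_le a c]. *)
Definition oscillation a := inf [set c | 0 <= c /\ osc_le a c].

Lemma osc_leW a c c' : c <= c' -> osc_le a c -> osc_le a c'.
Proof. move=> cc' [A FA hA]; exists A => // t u At Au; by apply: le_trans cc'; exact: hA. Qed.

Lemma oscillation_le a c : 0 <= c -> osc_le a c -> oscillation a <= c.
Proof. by move=> c0 ac; apply: ge_inf; [exists 0 => x []|]. Qed.

Lemma osc_le_oscillation a e c : 0 <= c -> osc_le a c -> 0 < e ->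
  exists2 b, b <= oscillation a + e & 0 <= b /\ osc_le a b.
Proof.
move=> c0 ac e0; have : has_inf [set c | 0 <= c /\ osc_le a c].
  by split; [exists c|exists 0 => x []].
by move=> /(inf_adherent e0)[b hb be]; exists b => //; exact: ltW.
Qed.

Lemma osc_leD a b c c' : osc_le a c -> osc_le b c' ->
  osc_le (fun t => a t + b t) (c + c').
Proof.
move=> [A FA hA] [B FB hB]; exists (A `&` B); first exact: filterI.
move=> t u [At Bt] [Au Bu].
rewrite (_ : _ - _ = (a t - a u) + (b t - b u)); last by ring.
by apply: (le_trans (ler_normD _ _)); rewrite lerD ?hA ?hB.
Qed.

Lemma osc_leZ k a c : osc_le a c -> osc_le (fun t => k * a t) (`|k| * c).
Proof.
by move=> [A FA hA]; exists A => // t u At Au; rewrite -mulrBr normrM ler_wpM2l ?hA.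
Qed.

Lemma osc_le_bound a c : (\forall t \near F, `|a t| <= c) -> osc_le a (2 * c).
Proof.
move=> ac; exists [set t | `|a t| <= c] => // t u /= atc auc.
by apply: (le_trans (ler_normB _ _)); lra.
Qed.

Lemma osc_le_near a b c e : (\forall t \near F, `|a t - b t| <= e) ->
  osc_le b c -> osc_le a (c + 2 * e).
Proof.
move=> ab [B FB hB]; exists (B `&` [set t | `|a t - b t| <= e]); first exact: filterI.
move=> t u [Bt /= abt] [Bu /= abu].
rewrite (_ : a t - a u = (b t - b u) + ((a t - b t) - (a u - b u))); last by ring.
apply: (le_trans (ler_normD _ _)); rewrite lerD ?hB//.
by apply: (le_trans (ler_normB _ _)); lra.
Qed.

Lemma osc_le_cvg a : (forall e, 0 < e -> osc_le a e) -> cvg (a t @[t --> F]).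
Proof.
move=> h; apply: cauchy_cvg; apply: cauchy_exP => e e0.
have [A FA hA] := h _ (divr_gt0 e0 (ltr0Sn R 1)).
have [t At] := filter_ex FA; exists (a t).
suff : F (a @^-1` ball (a t) e) by [].
apply: filterS FA => u Au; rewrite /ball/=.
by apply: (le_lt_trans (hA _ _ At Au)); lra.
Qed.

Lemma cvg_osc_le a e : 0 < e -> cvg (a t @[t --> F]) -> osc_le a e.
Proof.
move=> e0 /cvg_ex[l al].
have /cvgrPdist_le/(_ _ (divr_gt0 e0 (ltr0Sn R 1))) la := al.
exists [set t | `|l - a t| <= e / 2] => // t u /= lt lu.
rewrite (_ : a t - a u = (l - a u) - (l - a t)); last by ring.
by apply: (le_trans (ler_normB _ _)); lra.
Qed.

Lemma oscillation_eq0_cvg a c : 0 <= c -> osc_le a c -> oscillation a <= 0 ->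
  cvg (a t @[t --> F]).
Proof.
move=> c0 ac a0; apply: osc_le_cvg => e e0.
have [b be [_ ab]] := osc_le_oscillation c0 ac e0.
by apply: osc_leW ab; apply: (le_trans be); lra.
Qed.

(** Linearity and the bound are available only eventually; the sets witnessing oscillation are
    intersected with those where they hold. The factor 2 comes from comparing two indices. *)
Lemma exp_seminorm_oscillation (m : R -> (R -> R) -> R) (kappa M : R) :
  (\forall t \near F,
    [/\ forall f g, exp_dominated kappa f -> exp_dominated kappa g ->
          m t (fun v => f v + g v) = m t f + m t g,
        forall k f, exp_dominated kappa f -> m t (fun v => k * f v) = k * m t f &
        forall (f : R -> R) (b : R), continuous f ->
          (forall v : R, 0 <= v -> `|f v| <= b * expR (kappa * v)) ->
          `|m t f| <= M * b]) ->
  exp_seminorm kappa (2 * M) (fun f => oscillation (m^~ f)).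
Proof.
move=> mF.
have bnd (f : R -> R) (b : R) : continuous f ->
    (forall v : R, 0 <= v -> `|f v| <= b * expR (kappa * v)) ->
    osc_le (m^~ f) (2 * M * b).
  move=> cf fb; rewrite -mulrA; apply: osc_le_bound.
  by apply: filterS mF => t [_ _]; apply.
have M0 : 0 <= M.
  have [t [_ _ h]] := filter_ex mF.
  have c0 : continuous (fun _ : R => 0 : R) by move=> x; exact: cvg_cst.
  have z0 (v : R) : 0 <= v -> `|0 : R| <= 1 * expR (kappa * v).
    by move=> _; rewrite normr0 mul1r expR_ge0.
  by have := h _ 1 c0 z0; rewrite mulr1; exact: le_trans.
have dom f : exp_dominated kappa f -> exists2 c, 0 <= c & osc_le (m^~ f) c.
  move=> [cf [b fb]]; exists (2 * M * b); last exact: bnd.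
  rewrite !mulr_ge0//.
  by have := fb _ (lexx 0); rewrite mulr0 expR0 mulr1; exact: le_trans.
split.
- move=> f g df dg; have [c c0 fc] := dom _ df; have [c' c'0 gc] := dom _ dg.
  apply/ler_addgt0Pr => e e0; have e2 : 0 < e / 2 by rewrite divr_gt0.
  have [b1 b1e [b10 fb1]] := osc_le_oscillation c0 fc e2.
  have [b2 b2e [b20 gb2]] := osc_le_oscillation c'0 gc e2.
  apply: (@le_trans _ _ (b1 + b2)); last lra.
  apply: oscillation_le; first exact: addr_ge0.
  have [A FA hA] := osc_leD fb1 gb2.
  exists (A `&` [set t | m t (fun v => f v + g v) = m t f + m t g]).
    apply: filterI => //; apply: filterS mF => t [h _ _]; exact: h.
  by move=> t u [At /= ->] [Au /= ->]; exact: hA.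
- move=> k f df; have [c c0 fc] := dom _ df.
  apply/ler_addgt0Pr => e e0.
  have k1 : 0 < `|k| + 1 by rewrite ltr_wpDl.
  have [b1 b1e [b10 fb1]] := osc_le_oscillation c0 fc (divr_gt0 e0 k1).
  apply: (@le_trans _ _ (`|k| * b1)).
    apply: oscillation_le; first by rewrite mulr_ge0.
    have [A FA hA] := osc_leZ k fb1.
    exists (A `&` [set t | m t (fun v => k * f v) = k * m t f]).
      apply: filterI => //; apply: filterS mF => t [_ h _]; exact: h.
    by move=> t u [At /= ->] [Au /= ->]; exact: hA.
  apply: (le_trans (ler_wpM2l (normr_ge0 k) b1e)); rewrite mulrDr lerD2l.
  by rewrite mulrCA ler_piMr ?(ltW e0)// ler_pdivrMr// mul1r lerDl.
- move=> f b cf fb; apply: oscillation_le (bnd _ _ cf fb).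
  rewrite !mulr_ge0//.
  by have := fb _ (lexx 0); rewrite mulr0 expR0 mulr1; exact: le_trans.
Qed.

End Oscillation.

(** * The oscillation seminorm of [m_t] along [star] *)

Section WeightOscillation.
Context d (T : measurableType d) (R : realType) (P : probability T R).
Context (star : set_system R) {FF : ProperFilter star}.
Variables (W : R -> nat -> {RV P >-> R}) (X : {RV P >-> R}) (Xs : nat -> {RV P >-> R}).
Hypothesis HX : iid (seq_cons X Xs).
Hypothesis HW : \forall t \near star, subprobability_weights (W t) /\
  independent_families (seq_cons X Xs) (W t).
Hypothesis IX : Rintegrable P X.
Variables (r M : R).
Hypotheses (r_gt0 : 0 < r) (r_lt1 : r < 1).
Hypothesis HM : \forall t \near star, (weight_moment (W t) r <= M%:E)%E.
Context d' (T' : measurableType d') (P' : probability T' R) (Rlim : {RV P' >-> R}).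
Hypothesis HR : cvg_in_distribution star P (fun t => weighted_sum (W t) Xs) P' Rlim.

Let mu := \int[P]_w `|X w|.

Let near_moment : \forall t \near star,
  forall n, \sum_(0 <= j < n) \int[P]_w W t j w `^ (1 - (1 - r)) <= M.
Proof.
near=> t; have [Wt _] : subprobability_weights (W t) /\
  independent_families (seq_cons X Xs) (W t) by near: t.
rewrite subKr; apply: weight_moment_series => //; by near: t.
Unshelve. all: by end_near. Qed.

Let kappa_gt0 : 0 < 1 - r. Proof. by rewrite subr_gt0. Qed.
Let kappa_lt1 : 1 - r < 1. Proof. by rewrite ltrBlDr ltrDl. Qed.

Definition weight_oscillation (f : R -> R) :=
  oscillation star (fun t => weight_functional (W t) f).

Lemma exp_seminorm_weight_oscillation : exp_seminorm (1 - r) (2 * M) weight_oscillation.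
Proof.
apply: (exp_seminorm_oscillation (m := fun t => weight_functional (W t))).
near=> t; have [Wt _] : subprobability_weights (W t) /\
  independent_families (seq_cons X Xs) (W t) by near: t.
have Mt : forall n, \sum_(0 <= j < n) \int[P]_w W t j w `^ (1 - (1 - r)) <= M by near: t.
split.
- by move=> f g df dg; rewrite (weight_functionalD Wt kappa_lt1 Mt df dg).
- by move=> k f df; rewrite (weight_functionalZ Wt kappa_lt1 Mt k df).
- by move=> f b cf fb; have [] := weight_functional_bound Wt kappa_lt1 Mt cf fb.
Unshelve. all: by end_near. Qed.

Lemma cvg_in_distribution_Rintegral (f : R -> R) (c : R) : continuous f ->
  (forall x, `|f x| <= c) ->
  \int[P]_w f (weighted_sum (W t) Xs w) @[t --> star] --> \int[P']_w f (Rlim w).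
Proof.
move=> cf fc; have := HR cf (ex_intro _ c fc).
rewrite unlock => h; apply: fine_cvg; rewrite -RintegralE; first exact: h.
apply: (@Rintegrable_bounded _ _ _ _ _ c) => //.
by apply: measurableT_comp => //; exact: continuous_measurable_fun.
Qed.

Let Rintegrable_bounded_weighted_sum t (f : R -> R) (c : R) : continuous f ->
  (forall x, `|f x| <= c) -> Rintegrable P (fun w => f (weighted_sum (W t) Xs w)).
Proof.
move=> cf fc; apply: (@Rintegrable_bounded _ _ _ _ _ c) => //.
apply: measurableT_comp; first exact: continuous_measurable_fun.
exact: measurable_weighted_sum.
Qed.

(** Convergence in distribution tests bounded functions only. Clipping the argument at [n] changes
    [E G(R_t)] by at most [Lam] times a hinge mean, small uniformly in [t] by convexity. *)
Lemma osc_weighted_sum_lipschitz (G : R -> R) (Lam e : R) : 0 <= Lam -> G 0 = 0 ->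
  (forall a b, `|G a - G b| <= Lam * `|a - b|) -> 0 < e ->
  osc_le star (fun t => \int[P]_w G (weighted_sum (W t) Xs w)) e.
Proof.
move=> Lam0 G0 GL e0; have Lam1 : 0 < Lam + 1 by rewrite ltr_wpDl.
have [n n0 hn] := Rintegral_hinge_cvg0 IX (divr_gt0 e0 (mulr_gt0 (ltr0Sn R 3) Lam1)).
(* The projection onto [[-n, n]]; the distance to it is exactly the hinge at [n]. *)
pose clip (x : R) := Num.max (- n%:R) (Num.min n%:R x).
have n0' : 0 <= n%:R :> R by [].
have clip_dist a : `|a - clip a| = hinge n%:R a.
  rewrite /clip /hinge; case: (leP n%:R a) => na.
    rewrite max_r; last by rewrite (le_trans _ n0')// oppr_le0.
    by rewrite !ger0_norm ?subr_ge0// ?max_l// ?subr_ge0// (le_trans n0').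
  case: (leP (- n%:R) a) => an.
    rewrite subrr normr0 max_r// subr_le0 ler_norml an/=; exact: ltW.
  rewrite opprK ltr0_norm; last by rewrite -ltrBrDr sub0r.
  by rewrite ltr0_norm ?max_l; [ring|lra|lra].
have clip_lip a b : `|clip a - clip b| <= 1 * `|a - b|.
  rewrite mul1r; have cP c : [\/ clip c = n%:R /\ n%:R <= c, clip c = - n%:R /\ c <= - n%:R |
      clip c = c /\ - n%:R <= c <= n%:R].
    rewrite /clip; case: (leP n%:R c) => nc.
      by rewrite max_r; [exact: Or31|rewrite (le_trans _ n0')// oppr_le0].
    case: (leP (- n%:R) c) => cn; last by apply: Or32; split => //; exact: ltW.
    by apply: Or33; rewrite (ltW nc).
  have := ler_norm (a - b); have := ler_norm (b - a); rewrite (distrC b a) => h1 h2.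
  move: (cP a) (cP b) n0'; move: (clip a) (clip b) (n%:R : R) => ca cb N.
  case=> -[-> ha]; case=> -[-> hb] N0; rewrite ler_norml; apply/andP; split; lra.
have clip_le a : `|clip a| <= n%:R.
  rewrite ler_norml /clip le_max lexx/= ge_max ge_min lexx/= andbT; lra.
have HL a b : `|G (clip a) - G (clip b)| <= Lam * `|a - b|.
  by apply: (le_trans (GL _ _)); rewrite ler_wpM2l// -[leRHS]mul1r clip_lip.
have cH := lipschitz_continuous HL.
have Hb a : `|G (clip a)| <= Lam * n%:R.
  by rewrite -[G _]subr0 -G0; apply: (le_trans (GL _ _)); rewrite subr0 ler_wpM2l.
have cvH := cvg_in_distribution_Rintegral cH Hb.
have e2 : 0 < e / 2 by rewrite divr_gt0.
rewrite (_ : e = e / 2 + 2 * (e / 4)); last by field.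
apply: (@osc_le_near _ _ _ _ (fun t => \int[P]_w G (clip (weighted_sum (W t) Xs w)))).
  near=> t; have [Wt It] : subprobability_weights (W t) /\
    independent_families (seq_cons X Xs) (W t) by near: t.
  have mS : measurable_fun setT (weighted_sum (W t) Xs) by exact: measurable_weighted_sum.
  have [Ih ih] := Rintegral_hinge_weighted_sum Wt HX It IX n0'.
  have IH := Rintegrable_bounded_weighted_sum t cH Hb.
  have Gc a : `|G a - G (clip a)| <= Lam * hinge n%:R a.
    by rewrite -clip_dist; exact: GL.
  have mG : measurable_fun setT (fun w => G (weighted_sum (W t) Xs w)).
    apply: measurableT_comp => //; apply: continuous_measurable_fun.
    exact: lipschitz_continuous GL.
  have ID : Rintegrable P (fun w =>
      G (weighted_sum (W t) Xs w) - G (clip (weighted_sum (W t) Xs w))).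
    apply: Rintegrable_le (RintegrableZ Lam Ih) _ => //.
    by apply: measurable_funB => //; exact: Rintegrable_measurable IH.
  have IG : Rintegrable P (fun w => G (weighted_sum (W t) Xs w)).
    have := RintegrableD ID IH; congr (Rintegrable P _).
    by apply/funext => w; rewrite subrK.
  rewrite -RintegralB//; apply: (le_trans (le_normr_Rintegral measurableT ID)).
  apply: (@le_trans _ _ (\int[P]_w (Lam * hinge n%:R (weighted_sum (W t) Xs w)))).
    apply: (le_Rintegral measurableT); [exact: Rintegrable_norm|exact: RintegrableZ|by move=> w _].
  rewrite RintegralZl//; apply: (@le_trans _ _ ((Lam + 1) * (e / (4 * (Lam + 1))))).
    apply: ler_pM => //; last 2 first.
    - by rewrite lerDl.
    - exact: le_trans hn.
    by apply: Rintegral_ge0 => w _; exact: hinge_ge0.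
  by rewrite le_eqVlt; apply/orP; left; apply/eqP; field; rewrite gt_eqF.
apply: cvg_osc_le => //; apply/cvg_ex; eexists; exact: cvH.
Unshelve. all: by end_near. Qed.

(** [E G(R_t)] has arbitrarily small oscillation, and [m_t] of the scaled mean stays within
    [L * (mu + mu ^+ 2)] of it at each of the two compared indices. *)
Lemma weight_oscillation_scaled_mean (G : R -> R) (Lam L : R) : 0 <= Lam -> 0 <= L ->
  (forall x, 0 <= G x) -> G 0 = 0 ->
  (forall a b, `|G a - G b| <= Lam * `|a - b|) ->
  (forall s x, `|G (s + x) - G s - G x| <= L * ((1 + `|s|) * `|x|)) ->
  weight_oscillation (scaled_mean X G) <= 2 * (L * (mu + mu ^+ 2)).
Proof.
move=> Lam0 L0 Gge0 G0 GL Gq; apply/ler_addgt0Pl => e e0.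
have mu0 : 0 <= mu by exact: Rintegral_ge0.
apply: oscillation_le.
  by rewrite addr_ge0 ?(ltW e0)// !mulr_ge0// addr_ge0// exprn_ge0.
apply: osc_le_near (osc_weighted_sum_lipschitz Lam0 G0 GL e0).
near=> t; have [Wt It] : subprobability_weights (W t) /\
  independent_families (seq_cons X Xs) (W t) by near: t.
rewrite distrC; apply: (weighted_sum_scaled_mean (Lam := Lam) Wt HX It IX) => //.
  exact: lipschitz_continuous GL.
by move=> x; have := GL x 0; rewrite G0 !subr0.
Unshelve. all: by end_near. Qed.

Lemma weight_oscillation_tail_mean tau :
  weight_oscillation (fun v => tail_mean X (tau + v)) <=
  8 * (mu + mu ^+ 2) * expR (- tau).
Proof.
have h0 : hinge (expR tau) 0 = 0.
  by rewrite /hinge normr0 sub0r max_r// oppr_le0 expR_ge0.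
have := @weight_oscillation_scaled_mean (hinge (expR tau)) 1 (4 / expR tau).
rewrite (_ : scaled_mean _ _ = fun v => tail_mean X (tau + v)); last first.
  by apply/funext => v; rewrite scaled_mean_hinge.
move=> h; rewrite (_ : 8 * _ * _ = 2 * (4 / expR tau * (mu + mu ^+ 2))).
  apply: h => //.
  - by move=> x; exact: hinge_ge0.
  - exact: hinge_lipschitz.
  - by move=> s x; apply: hinge_quasi_additive; exact: expR_gt0.
by rewrite expRN; ring.
Qed.

Lemma weight_oscillation_growth_mean p tau : 0 < p -> p <= 1 ->
  weight_oscillation (fun v => expR (- (p * v)) * growth_mean X p (tau + v)) <=
  20 * (mu + mu ^+ 2).
Proof.
move=> p0 p1; have := @weight_oscillation_scaled_mean
  (truncated_power p (expR tau)) (2 * expR tau `^ p) 10.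
rewrite (_ : scaled_mean _ _ = fun v => expR (- (p * v)) * growth_mean X p (tau + v)); last first.
  by apply/funext => v; rewrite scaled_mean_truncated_power.
move=> h; rewrite (_ : 20 * _ = 2 * (10 * (mu + mu ^+ 2))); last by ring.
apply: h => //.
- by move=> x; exact: truncated_power_ge0.
- exact: truncated_power0.
- by move=> a b; apply: truncated_power_lipschitz; rewrite ?expR_gt0.
- by move=> s x; apply: truncated_power_quasi_additive; rewrite ?expR_gt0.
Qed.

Lemma weight_oscillation_subexponential z : subexponential (tail_mean X) -> 0 <= z ->
  weight_oscillation (fun v => expR (- (z * v))) <= 0.
Proof.
move=> sub z0; apply: (esn_expRN kappa_gt0 exp_seminorm_weight_oscillation
  (tail_mean_homo IX) (tail_mean_ge0 X) (continuous_tail_mean IX) _ sub _ z0).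
  by move=> e e0; exact: tail_mean_cvg0.
by move=> tau _; exact: weight_oscillation_tail_mean.
Qed.

(** The truncated power has exponent [a + b] and [eta = 2 e]. Its mean is unbounded by the infinite
    moment and slow by the finite one. A positive [b] serves when the moment of order [1 + a] may be
    finite; [a + b <= 1] is the range of quasi-additivity, and [d0 <= a / 2] ensures
    [eta <= a + b]. *)
Lemma weight_oscillation_regular_growth a d0 : 0 < a -> 0 < d0 -> d0 <= a / 2 ->
  (forall e, 0 < e -> e < d0 -> exists b, [/\ 0 <= b <= e, a + b <= 1,
    Rintegrable P (fun w => `|X w| `^ (1 + (a + b) - 2 * e)) &
    ~ Rintegrable P (fun w => `|X w| `^ (1 + (a + b)))]) ->
  weight_oscillation (fun v => expR (- (a * v))) <= 0.
Proof.
move=> a0 d00 d0a hb; apply: (esn_expRN_approx (d0 := d0) kappa_gt0 (ltW a0) _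
  exp_seminorm_weight_oscillation) => // e L e0 ed L0.
have [b [/andP[b0 be] ab1 I1 I2]] := hb e e0 ed.
exists b; first by rewrite b0.
have ab0 : 0 < a + b by rewrite ltr_pwDl.
have ee : 0 <= 2 * e by rewrite mulr_ge0// ltW.
have eab : 2 * e <= a + b by lra.
rewrite (_ : 4 * e * L = 2 * (2 * e) * L); last by ring.
apply: (@esn_expRN_growth _ (1 - r) (2 * M) (20 * (mu + mu ^+ 2)) (a + b) (2 * e)
  (\int[P]_w `|X w| `^ (1 + (a + b) - 2 * e)) L _ (growth_mean X (a + b)) kappa_gt0).
- exact: ltW.
- exact: exp_seminorm_weight_oscillation.
- exact: growth_mean_homo.
- exact: continuous_growth_mean.
- by move=> tau v v0; exact: growth_mean_shift.
- by rewrite mulr_gt0.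
- by [].
- by move=> tau _; exact: growth_mean_le_expR.
- exact: growth_mean_unbounded.
- by move=> tau _; exact: weight_oscillation_growth_mean.
Qed.

Lemma osc_weighted_sum_square e : \int[P]_w X w = 0 ->
  Rintegrable P (fun w => X w ^+ 2) -> 0 < e ->
  osc_le star (fun t => \int[P]_w weighted_sum (W t) Xs w ^+ 2) e.
Proof.
move=> X0 IX2 e0; have e2 : 0 < e / 2 by rewrite divr_gt0.
have e4 : 0 < e / 4 by rewrite divr_gt0.
have [n n0 hn] := Rintegral_hinge_cvg0 IX2 e4.
(* This is [min (x^2, n)], bounded and continuous; the discarded hinge is uniformly small in [t]. *)
pose f (x : R) := x ^+ 2 - hinge n%:R (x ^+ 2).
have cs : continuous (fun x : R => x ^+ 2) by exact: exprn_continuous.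
have cf : continuous f.
  move=> x; apply: cvgB; first exact: cs.
  apply: (@continuous_comp _ _ _ (fun x : R => x ^+ 2) (hinge n%:R)); first exact: cs.
  exact: (lipschitz_continuous (hinge_lipschitz n%:R)).
have fb x : `|f x| <= n%:R.
  rewrite /f /hinge (ger0_norm (sqr_ge0 x)); case: (leP (x ^+ 2 - n%:R) 0) => h.
    by rewrite subr0 ger0_norm ?sqr_ge0// -subr_le0.
  by rewrite subKr ger0_norm.
rewrite (_ : e = e / 2 + 2 * (e / 4)); last by field.
apply: (@osc_le_near _ _ _ _ (fun t => \int[P]_w f (weighted_sum (W t) Xs w))); last first.
  apply: cvg_osc_le => //; apply/cvg_ex; eexists.
  exact: cvg_in_distribution_Rintegral cf fb.
near=> t; have [Wt It] : subprobability_weights (W t) /\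
  independent_families (seq_cons X Xs) (W t) by near: t.
have [I2 _ h2] := Rintegral_square_weighted_sum Wt HX It IX X0 IX2.
have If := Rintegrable_bounded_weighted_sum t cf fb.
rewrite -RintegralB//.
under eq_Rintegral do rewrite /f subKr.
rewrite ger0_norm; last by apply: Rintegral_ge0 => w _; exact: hinge_ge0.
apply: le_trans hn; rewrite /hinge.
under eq_Rintegral do rewrite (ger0_norm (sqr_ge0 _)).
under [leRHS]eq_Rintegral do rewrite (ger0_norm (sqr_ge0 _)).
exact: h2.
Unshelve. all: by end_near. Qed.

Lemma weight_oscillation_square : \int[P]_w X w = 0 ->
  Rintegrable P (fun w => X w ^+ 2) -> 0 < \int[P]_w X w ^+ 2 ->
  weight_oscillation (fun v => expR (- ((2 - 1) * v))) <= 0.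
Proof.
move=> X0 IX2 s0; set s := \int[P]_w X w ^+ 2 in s0 *.
apply/ler_addgt0Pl => e e0; rewrite addr0; apply: oscillation_le; first exact: ltW.
have := osc_weighted_sum_square X0 IX2 (mulr_gt0 e0 s0).
move=> /(osc_leZ s^-1); rewrite gtr0_norm ?invr_gt0// mulrCA mulVf ?gt_eqF// mulr1.
move=> h; rewrite (_ : e = e + 2 * 0); last by rewrite mulr0 addr0.
apply: osc_le_near h; near=> t.
have [Wt It] : subprobability_weights (W t) /\
  independent_families (seq_cons X Xs) (W t) by near: t.
have Mt : forall n, \sum_(0 <= j < n) \int[P]_w W t j w `^ (1 - (1 - r)) <= M by near: t.
have [_ ->] := weight_moment_functional Wt kappa_gt0 kappa_lt1 Mt (ler1n R 2).
have [_ c2 _] := Rintegral_square_weighted_sum Wt HX It IX X0 IX2.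
rewrite (_ : limn _ = s^-1 * \int[P]_w weighted_sum (W t) Xs w ^+ 2).
  by rewrite subrr normr0.
apply/cvg_lim => //.
rewrite (_ : series _ = fun n => s^-1 * (s * \sum_(0 <= j < n) \int[P]_w W t j w ^+ 2)).
  by apply: cvgM => //; exact: cvg_cst.
apply/funext => n; rewrite mulKf ?gt_eqF//; apply: eq_bigr => j _.
by apply: eq_Rintegral => w _; rewrite -powR_mulrn// (weight_ge0 Wt).
Unshelve. all: by end_near. Qed.

Hypothesis Hnd : nondegenerate_rv P' Rlim.

(** Interpolating the first power between [r] and [s] would make the total mean weight, hence
    [E|R_t|], tend to 0, and the limit would vanish almost surely. *)
Lemma weight_moment_not_cvg0 s : 1 <= s ->
  ~ weight_moment (W t) s @[t --> star] --> 0%E.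
Proof.
move=> s1 c0; apply: Hnd; exists 0.
have s0 : 0 < s by exact: lt_le_trans s1.
have M0 : 0 <= M.
  have [t Mt] := filter_ex near_moment.
  by have := Mt 0%N; rewrite big_nil.
have mu0 : 0 <= mu by exact: Rintegral_ge0.
pose f (x : R) := Num.min `|x| 1.
have cf : continuous f.
  apply: (@lipschitz_continuous _ _ 1) => a b; rewrite mul1r /f.
  have := ler_dist_dist a b; rewrite ler_norml => /andP[h1 h2].
  by rewrite ler_norml; case: (leP `|a| 1) => ha; case: (leP `|b| 1) => hb; apply/andP; split; lra.
have f0 x : 0 <= f x by rewrite le_min normr_ge0 ler01.
have fb x : `|f x| <= 1 by rewrite ger0_norm// ge_min lexx orbT.
have small e : 0 < e -> \int[P']_w f (Rlim w) <= mu * (e * M + e).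
  move=> e0; have := cvg_in_distribution_Rintegral cf fb => cR.
  apply: (cvgr_to_le cR).
  (* Threshold for [y <= e y^r + C y^s]: below [del], [y^(1-r) <= e]; above it, [C y^(s-1) >= 1] by
     the choice of [C]. *)
  pose del := e `^ (1 - r)^-1.
  have del0 : 0 < del by exact: powR_gt0.
  pose C := del `^ (1 - s).
  have C0 : 0 < C by exact: powR_gt0.
  have yC y : 0 <= y -> y <= e * y `^ r + C * y `^ s.
    rewrite le_eqVlt => /predU1P[<-|y0].
      by rewrite addr_ge0// mulr_ge0 ?powR_ge0// ltW.
    have [yd|dy] := leP y del.
      apply: (@le_trans _ _ (e * y `^ r)); last by rewrite lerDl mulr_ge0 ?powR_ge0// ltW.
      rewrite -[leLHS](powRr1 (ltW y0)) -{1}(subrK r 1) powRD ?(gt_eqF y0) ?implybT//.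
      rewrite ler_wpM2r ?powR_ge0//.
      have -> : e = del `^ (1 - r) by rewrite /del -powRrM mulVf ?powRr1 ?(ltW e0)// gt_eqF.
      by apply: ge0_ler_powR => //; rewrite ?nnegrE ltW.
    apply: (@le_trans _ _ (C * y `^ s)); last by rewrite lerDr mulr_ge0 ?powR_ge0// ltW.
    have := ge0_ler_powR (_ : 0 <= s - 1) (_ : del \in Num.nneg) (_ : y \in Num.nneg) (ltW dy).
    rewrite subr_ge0 !nnegrE => /(_ s1 (ltW del0) (ltW y0)) h.
    have -> : y `^ s = y * y `^ (s - 1).
      by rewrite -{2}(powRr1 (ltW y0)) -powRD ?(gt_eqF y0) ?implybT// addrC subrK.
    rewrite mulrCA ler_peMr ?(ltW y0)//.
    apply: (@le_trans _ _ (C * del `^ (s - 1))); last by rewrite ler_wpM2l// ltW.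
    by rewrite /C -powRD ?(gt_eqF del0) ?implybT// addrA subrK subrr powRr0.
  have Cm : \forall t \near star, (weight_moment (W t) s <= (e / C)%:E)%E.
    have /fine_cvgP[fi /cvgrPdist_le/(_ _ (divr_gt0 e0 C0)) h] := c0.
    near=> t; have fit : weight_moment (W t) s \is a fin_num by near: t.
    rewrite -(fineK fit) lee_fin.
    have : `|0 - fine (weight_moment (W t) s)| <= e / C by near: t.
    by rewrite sub0r normrN => /(le_trans (ler_norm _)).
  near=> t; have [Wt It] : subprobability_weights (W t) /\
    independent_families (seq_cons X Xs) (W t) by near: t.
  have Mt : forall n, \sum_(0 <= j < n) \int[P]_w W t j w `^ (1 - (1 - r)) <= M by near: t.
  have Ct : (weight_moment (W t) s <= (e / C)%:E)%E by near: t.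
  have {}Ct := weight_moment_series Wt s0 Ct.
  have [|Ia ia] := Rintegral_norm_weighted_sum Wt HX It IX (c := e * M + e).
    move=> n; apply: (@le_trans _ _ (\sum_(0 <= j < n)
      (e * (\int[P]_w W t j w `^ r) + C * \int[P]_w W t j w `^ s))).
      apply: ler_sum => j _.
      have I1 := Rintegrable_weight_powR Wt j (ltW r_gt0).
      have I2 := Rintegrable_weight_powR Wt j (ltW s0).
      rewrite -!RintegralZl// -RintegralD//; [|exact: RintegrableZ..].
      apply: (le_Rintegral measurableT); first exact: Rintegrable_weight.
        by apply: RintegrableD; exact: RintegrableZ.
      by move=> w _; apply: yC; exact: weight_ge0.
    rewrite big_split/= -!mulr_sumr lerD//.
      by rewrite ler_wpM2l ?(ltW e0)//; have := Mt n; rewrite subKr.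
    by rewrite mulrC -ler_pdivlMr.
  apply: le_trans ia; apply: (le_Rintegral measurableT) => //.
    exact: Rintegrable_bounded_weighted_sum cf fb.
  by move=> w _; rewrite ge_min lexx.
have If : Rintegrable P' (fun w => f (Rlim w)).
  apply: (@Rintegrable_bounded _ _ _ _ _ 1) => //.
  by apply: measurableT_comp => //; exact: continuous_measurable_fun.
have int0 : \int[P']_w f (Rlim w) = 0.
  apply/eqP; rewrite eq_le Rintegral_ge0// andbT; apply/ler_addgt0Pl => e e0.
  rewrite addr0; have k0 : 0 < mu * (M + 1) + 1 by rewrite ltr_wpDl// mulr_ge0// addr_ge0.
  apply: (le_trans (small _ (divr_gt0 e0 k0))).
  rewrite (_ : mu * _ = e * (mu * (M + 1)) / (mu * (M + 1) + 1)); last by field; rewrite gt_eqF.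
  by rewrite ler_pdivrMr// ler_wpM2l ?(ltW e0)// lerDl.
have : (\int[P']_w `|(f (Rlim w))%:E| = 0)%E.
  under eq_integral do rewrite gee0_abs ?lee_fin//.
  by rewrite RintegralE// int0.
have mf : measurable_fun setT (fun w => (f (Rlim w))%:E).
  exact/measurable_EFinP/(Rintegrable_measurable If).
move/(ae_eq_integral_abs P' measurableT mf) => h.
apply: filterS h => w /(_ Logic.I)[fw0].
apply/eqP; rewrite -normr_le0; move: fw0; rewrite /f; case: (leP `|Rlim w| 1) => [_ ->//|_ /eqP].
by rewrite oner_eq0.
Unshelve. all: by end_near. Qed.

Lemma weight_moment_cvg s : 1 <= s ->
  weight_oscillation (fun v => expR (- ((s - 1) * v))) <= 0 ->
  exists c, [/\ 0 < c, c <= 1 & weight_moment (W t) s @[t --> star] --> c%:E].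
Proof.
move=> s1 q0; pose m t := weight_functional (W t) (fun v => expR (- ((s - 1) * v))).
have mE : \forall t \near star, weight_moment (W t) s = (m t)%:E /\ 0 <= m t <= 1.
  near=> t; have [Wt It] : subprobability_weights (W t) /\
    independent_families (seq_cons X Xs) (W t) by near: t.
  have Mt : forall n, \sum_(0 <= j < n) \int[P]_w W t j w `^ (1 - (1 - r)) <= M by near: t.
  have [e _] := weight_moment_functional Wt kappa_gt0 kappa_lt1 Mt s1.
  by have := weight_moment_le1 Wt s1; rewrite e !lee_fin; split.
have m1 : osc_le star m (2 * 1).
  apply: osc_le_bound; apply: filterS mE => t [_ /andP[m0 m1]].
  by rewrite ger0_norm.
have /cvg_ex[c mc] : cvg (m t @[t --> star]).
  exact: oscillation_eq0_cvg (mulr_ge0 (ler0n R 2) ler01) m1 q0.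
have cW : weight_moment (W t) s @[t --> star] --> c%:E.
  have : (m t)%:E @[t --> star] --> c%:E by apply: cvg_EFin => //; exact: nearW.
  by apply: cvg_trans; apply: near_eq_cvg; apply: filterS mE => t [].
exists c; split => //; last first.
  by apply: (cvgr_to_le mc); apply: filterS mE => t [_ /andP[]].
rewrite lt_neqAle; apply/andP; split.
  by apply/eqP => c0; apply: (weight_moment_not_cvg0 s1); rewrite -c0 in cW.
by apply: (cvgr_to_ge mc); apply: filterS mE => t [_ /andP[]].
Unshelve. all: by end_near. Qed.

End WeightOscillation.

(** * Moment indices and integrability of powers of [|X|] *)

Section MomentIndex.
Context d (T : measurableType d) (R : realType) (P : probability T R).
Variable X : {RV P >-> R}.

Local Notation aX := (Order.min (moment_index P (X^\+)) (moment_index P (X^\-))).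

(** Some exponent [s > q] has a finite moment, and [Y^q <= 1 + Y^s]. *)
Lemma moment_index_gt_Rintegrable (Y : T -> R) q : measurable_fun setT Y ->
  (forall w, 0 <= Y w) -> 0 <= q -> (q%:E < moment_index P Y)%E ->
  Rintegrable P (fun w => Y w `^ q).
Proof.
move=> mY Y0 q0 /ereal_sup_gt[_ [s [s0 Ys] <-]]; rewrite lte_fin => qs.
have mp z : measurable_fun setT (fun w => Y w `^ z).
  exact: (@measurableT_comp _ _ _ _ _ _ (fun x => x `^ z) _ Y).
have Is : Rintegrable P (fun w => Y w `^ s).
  apply: ge0_Rintegrable => //; first by move=> w; exact: powR_ge0.
  by move: Ys; rewrite unlock.
apply: Rintegrable_le (RintegrableD (Rintegrable_cst P 1) Is) _ => // w.
rewrite ger0_norm ?powR_ge0//; have [Y1|/ltW Y1] := leP (Y w) 1.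
  apply: (@le_trans _ _ (1 `^ q)); last by rewrite powR1 lerDl powR_ge0.
  by apply: ge0_ler_powR; rewrite ?nnegrE.
by apply: ler_wpDl => //; rewrite ler_powR// ltW.
Qed.

Let mpos : measurable_fun setT (X^\+). Proof. exact: measurable_funrpos. Qed.
Let mneg : measurable_fun setT (X^\-). Proof. exact: measurable_funrneg. Qed.

Lemma lt_moment_index q : 0 <= q -> (q%:E < aX)%E ->
  Rintegrable P (fun w => `|X w| `^ q).
Proof.
move=> q0; rewrite lt_min => /andP[h1 h2].
have I1 := moment_index_gt_Rintegrable mpos (funrpos_ge0 X) q0 h1.
have I2 := moment_index_gt_Rintegrable mneg (funrneg_ge0 X) q0 h2.
apply: Rintegrable_le (RintegrableD I1 I2) _; first exact: measurable_abs_powR.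
move=> w; rewrite ger0_norm ?powR_ge0// /funrpos /funrneg.
have [X0|/ltW X0] := leP 0 (X w).
  by rewrite (ger0_norm X0) lerDl powR_ge0.
have X0' : 0 <= - X w by rewrite oppr_ge0.
by rewrite (ler0_norm X0) (max_l X0') lerDr powR_ge0.
Qed.

Lemma moment_index_ge q : 0 < q -> Rintegrable P (fun w => `|X w| `^ q) ->
  (q%:E <= aX)%E.
Proof.
move=> q0 Iq.
have ub (Y : T -> R) : measurable_fun setT Y -> (forall w, 0 <= Y w) ->
    (forall w, Y w <= `|X w|) -> (q%:E <= moment_index P Y)%E.
  move=> mY Y0 YX; apply: ereal_sup_ubound; exists q => //; split => //.
  rewrite unlock; apply: (@le_lt_trans _ _ (\int[P]_w (`|X w| `^ q)%:E)%E).
    apply: ge0_le_integral => //.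
    - by move=> w _; rewrite lee_fin powR_ge0.
    - by apply/measurable_EFinP; exact: (@measurableT_comp _ _ _ _ _ _ (fun x => x `^ q) _ Y).
    - by apply/measurable_EFinP; exact: measurable_abs_powR.
    by move=> w _; rewrite lee_fin; apply: ge0_ler_powR; rewrite ?nnegrE ?(ltW q0).
  by rewrite RintegralE// ltry.
rewrite le_min; apply/andP; split; apply: ub => // w.
- by rewrite /funrpos ge_max normr_ge0 ler_norm.
- by rewrite /funrneg ge_max normr_ge0 -normrN ler_norm.
Qed.

Lemma moment_index_ge1 : Rintegrable P X -> (1 <= aX)%E.
Proof.
move=> IX; apply: moment_index_ge => //.
have := Rintegrable_norm IX; congr (Rintegrable P _).
by apply/funext => w; rewrite powRr1.
Qed.

(** Exponential decay of the tail mean at rate [beta] would give a finite moment of order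
    [1 + beta / 2], above the index. *)
Lemma subexponential_tail_mean : Rintegrable P X -> aX = 1%E ->
  subexponential (tail_mean X).
Proof.
move=> IX a1 beta C b0; apply: contrapT => /forall2NP h.
have b2 : 0 < beta / 2 by rewrite divr_gt0.
have I : Rintegrable P (fun w => `|X w| `^ (1 + beta / 2)).
  apply: (tail_mean_integrable IX (b := beta) (A := C)) => //; first lra.
  by move=> tau t0; case: (h tau) => // /negP; rewrite -leNgt.
have := moment_index_ge (addr_gt0 ltr01 b2) I.
by rewrite a1 lee_fin; lra.
Qed.

End MomentIndex.

Theorem theorem2p1 (R : realType)
  (d : measure_display) (T : measurableType d) (P : probability T R)
  (star : set_system R) (Hstar : star = 0^'+ \/ star = +oo_R)
  (W : R -> nat -> {RV P >-> R})
  (X : {RV P >-> R}) (Xs : nat -> {RV P >-> R})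
  (HW : forall t : R, 0 < t -> subprobability_weights (W t))
  (HX : iid (seq_cons X Xs))
  (HWX : forall t : R, 0 < t -> independent_families (seq_cons X Xs) (W t))
  (EX0 : ('E_P[X] = 0)%E)
  (EX_gt0 : (0 < 'E_P[fun w => `|X w|%R])%E)
  (EX_fin : ('E_P[fun w => `|X w|%R] < +oo)%E)
  (r : R) (r_gt0 : 0 < r) (r_lt1 : r < 1)
  (Hr : (limf_esup (fun t : R => weight_moment (W t) r) star < +oo)%E)
  (d' : measure_display) (T' : measurableType d') (P' : probability T' R)
  (Rlim : {RV P' >-> R})
  (HR : cvg_in_distribution star P (fun t : R => weighted_sum (W t) Xs) P' Rlim)
  (Hnd : nondegenerate_rv P' Rlim) :
  (exists p c : R, [/\ 1 < p, p <= 2, 0 < c, c <= 1 &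
     weight_moment (W t) p @[t --> star] --> c%:E]) /\
  (let aX := Order.min (moment_index P (X^\+)) (moment_index P (X^\-)) in
   [/\ aX = 1%E ->
         forall p : R, 1 < p -> p < 2 ->
         exists c : R, [/\ 0 < c, c <= 1 &
           weight_moment (W t) p @[t --> star] --> c%:E],
       forall p : R, aX = p%:E -> 1 < p -> p < 2 ->
         exists c : R, [/\ 0 < c, c <= 1 &
           weight_moment (W t) p @[t --> star] --> c%:E] &
       (2%:E <= aX)%E ->
         exists c : R, [/\ 0 < c, c <= 1 &
           weight_moment (W t) 2 @[t --> star] --> c%:E]]).
Proof.
have FF : ProperFilter star by case: Hstar => ->; exact: _.
have star0 : \forall t \near star, 0 < t.
  by case: Hstar => ->; [exact: nbhs_right_gt|exact: nbhs_pinfty_gt].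
have HW' : \forall t \near star, subprobability_weights (W t) /\
    independent_families (seq_cons X Xs) (W t).
  by apply: filterS star0 => t t0; split; [exact: HW|exact: HWX].
have IX : Rintegrable P X.
  apply/integrableP; split; first exact/measurable_EFinP.
  by move: EX_fin; rewrite unlock.
have X0 : \int[P]_w X w = 0.
  by move: EX0; rewrite unlock => /(congr1 fine).
(* A finite upper limit provides a set of the filter on which the supremum is below infinity;
   nonnegativity of the moments makes it a real number. *)
have [M HM] : exists M, \forall t \near star, (weight_moment (W t) r <= M%:E)%E.
  move: Hr; rewrite /limf_esup => /ereal_inf_lt[_ [V sV <-] Vfin].
  exists (fine (ereal_sup [set weight_moment (W t) r | t in V])).
  apply: filterS sV => t Vt.
  have le : (weight_moment (W t) r <= ereal_sup [set weight_moment (W t) r | t in V])%E.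
    by apply: ereal_sup_ubound; exists t.
  apply: (le_trans le); rewrite fineK// ge0_fin_numE//.
  apply: le_trans le; apply: integral_ge0 => w _; apply: nneseries_ge0 => j _ _.
  by rewrite lee_fin powR_ge0.
have cvg s : 1 <= s ->
    weight_oscillation star W (fun v => expR (- ((s - 1) * v))) <= 0 ->
    exists c, [/\ 0 < c, c <= 1 & weight_moment (W t) s @[t --> star] --> c%:E].
  exact: (weight_moment_cvg HX HW' IX r_gt0 r_lt1 HM HR Hnd).
set aX := Order.min _ _.
have case1 : aX = 1%E -> forall p : R, 1 < p -> p < 2 -> exists c : R,
    [/\ 0 < c, c <= 1 & weight_moment (W t) p @[t --> star] --> c%:E].
  move=> a1 p p1 _; apply: cvg; first exact: ltW.
  apply: (weight_oscillation_subexponential HX HW' IX r_gt0 r_lt1 HM HR).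
    exact: subexponential_tail_mean.
  by rewrite subr_ge0 ltW.
have case2 p : aX = p%:E -> 1 < p -> p < 2 -> exists c : R,
    [/\ 0 < c, c <= 1 & weight_moment (W t) p @[t --> star] --> c%:E].
  move=> ap p1 p2; apply: cvg; first exact: ltW.
  (* The bound [e < 2 - p] keeps the exponent [p - 1 + e] at most 1. *)
  pose d0 := Num.min ((p - 1) / 2) (2 - p).
  have d01 : d0 <= (p - 1) / 2 by rewrite ge_min lexx.
  have d02 : d0 <= 2 - p by rewrite ge_min lexx orbT.
  apply: (weight_oscillation_regular_growth HX HW' IX r_gt0 r_lt1 HM HR (d0 := d0)) => //.
  - by rewrite subr_gt0.
  - by rewrite lt_min; apply/andP; split; lra.
  (* With [b = e] the two moment orders are [p - e] and [p + e], on either side of the index;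
     nothing is needed at [p] itself. *)
  move=> e e0 ed; exists e; split.
  - by rewrite (ltW e0) lexx.
  - lra.
  - apply: lt_moment_index; first lra.
    by rewrite -/aX ap lte_fin; lra.
  - move=> /moment_index_ge; rewrite -/aX ap lee_fin; lra.
have case3 : (2%:E <= aX)%E -> exists c : R,
    [/\ 0 < c, c <= 1 & weight_moment (W t) 2 @[t --> star] --> c%:E].
  move=> a2; apply: cvg; first exact: ler1n.
  have sq : (fun w => `|X w| `^ 2) = (fun w => X w ^+ 2).
    by apply/funext => w; rewrite powR_mulrn// real_normK// num_real.
  (* An index at least 2 does not decide whether [E X^2] is finite. If it is, the second-moment
     identity applies; if not, the truncated powers do, with [b = 0]. *)
  have [I2|nI2] := pselect (Rintegrable P (fun w => X w ^+ 2)).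
    apply: (weight_oscillation_square HX HW' IX r_gt0 r_lt1 HM HR) => //.
    rewrite lt_neqAle Rintegral_ge0 ?andbT; last by move=> w _; exact: sqr_ge0.
    (* [E X^2 = 0] would make [X] vanish almost everywhere, against [E|X| > 0]. *)
    apply/eqP => /esym s0; move: EX_gt0; rewrite unlock.
    have ms : measurable_fun setT (fun w => (X w ^+ 2)%:E).
      exact/measurable_EFinP/(Rintegrable_measurable I2).
    have : (\int[P]_w `|(X w ^+ 2)%:E| = 0)%E.
      under eq_integral do rewrite gee0_abs ?lee_fin ?sqr_ge0//.
      by rewrite RintegralE// s0.
    move/(ae_eq_integral_abs P measurableT ms) => h.
    rewrite (_ : \int[P]_w `|X w|%:E = 0)%E ?ltxx//.
    rewrite -(integral0 P setT); apply: ae_eq_integral => //.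
      by apply/measurable_EFinP; exact: measurableT_comp.
    apply: filterS h => w /(_ Logic.I)[/eqP]; rewrite sqrf_eq0 => /eqP Xw _.
    by rewrite /= Xw normr0.
  rewrite (_ : 2 - 1 = 1 :> R); last by ring.
  apply: (weight_oscillation_regular_growth HX HW' IX r_gt0 r_lt1 HM HR (d0 := 1 / 2)) => //.
  move=> e e0 ed; exists 0; split.
  - by rewrite lexx ltW.
  - by rewrite addr0.
  - apply: lt_moment_index; first lra.
    by apply: lt_le_trans a2; rewrite lte_fin; lra.
  - by rewrite addr0 sq.
split; last by split.
have [a2|a2] := leP 2%:E aX.
  by have [c [c0 c1 cc]] := case3 a2; exists 2, c; split => //; rewrite ltr1n.
have : (1 <= aX)%E by exact: moment_index_ge1.
rewrite le_eqVlt => /predU1P[/esym a1|a1].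
  (* When the index is 1, any exponent strictly between 1 and 2 would do. *)
  have p1 : 1 < 3 / 2 :> R by lra.
  have p2 : 3 / 2 < 2 :> R by lra.
  by have [c [c0 c1 cc]] := case1 a1 _ p1 p2; exists (3 / 2), c; split => //; exact: ltW.
have afin : aX \is a fin_num by rewrite ge0_fin_numE ?(lt_trans a2) ?ltry// (le_trans _ (ltW a1)).
move: a1 a2 (esym (fineK afin)); set p := fine aX => a1 a2 ap.
rewrite ap !lte_fin in a1 a2.
by have [c [c0 c1 cc]] := case2 p ap a1 a2; exists p, c; split => //; exact: ltW.
Unshelve. all: by end_near. Qed.
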